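(* Suppose that $A=\varinjlim_n\{A_n,\phi_n\}$, where each $A_n=\bigoplus_i C(Z_n^i)\otimes M_{r_n^i}$ is a finite direct sum, the $Z_n^i$ are non-degenerate $1$-dimensional connected CW-complexes (i.e. non-degenerate finite connected graphs), and $\phi_n:A_n\to A_{n+1}$ are unital, injective homomorphisms. Then there exist unital, injective and maximally homogeneous homomorphisms $\varphi_n:A_n\to A_{n+1}$ such that $A\cong\varinjlim_n\{A_n,\varphi_n\}$.
   Context: Homomorphism means $*$-homomorphism. Put $Z_n=\coprod_i Z_n^i$, and for $x\in Z_n$ let $\mathrm{ev}_x$ denote evaluation at $x$, an irreducible representation of $A_n$. If $\varphi:A_n\to A_{n+1}$ is a unital homomorphism, then for every $y\in Z_{n+1}$ the representation $\mathrm{ev}_y\circ\varphi$ is unitarily equivalent to $\bigoplus_{\mu\in M_y}\mathrm{ev}_{x_\mu}$ for some finite index set $M_y$ and points $x_\mu\in Z_n$. The homomorphism $\varphi$ is called maximally homogeneous if for every $y\in Z_{n+1}$ the points $x_\mu$, $\mu\in M_y$, are pairwise distinct. Non-degenerate means that the graph is not reduced to a single point. *)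

(* Defs.v *)
From HB Require Import structures.
From mathcomp Require Import all_boot all_order all_algebra.
From mathcomp Require Import complex ring.
From mathcomp Require Import boolp classical_sets functions cardinality reals.
From mathcomp Require Import topology normedtype.

Set Implicit Arguments.
Unset Strict Implicit.
Unset Printing Implicit Defensive.

Import Order.TTheory GRing.Theory Num.Theory.
Import numFieldNormedType.Exports.

Local Open Scope classical_set_scope.
Local Open Scope complex_scope.
Local Open Scope ring_scope.
Local Open Scope sesquilinear_scope.

(* The modulus topology on R[i]. *)
HB.instance Definition _ (R : realType) :=
  NormedModule.copy R[i] (R[i] : numFieldType)^o.

Section ComplexComplete.
Variable R : realType.
Local Notation normc := (@Normc.normc R).
Local Notation Re := (@complex.Re R).
Local Notation Im := (@complex.Im R).

Lemma normcE (x : R[i]) : `|x| = (normc x)%:C.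
Proof. by []. Qed.

Lemma normc_ge0 (x : R[i]) : 0 <= normc x.
Proof. by rewrite -ler0c -normcE. Qed.

Lemma ler_normcD (x y : R[i]) : normc (x + y) <= normc x + normc y.
Proof. by have := ler_normD x y; rewrite !normcE -rmorphD lecR. Qed.

Lemma normcN (x : R[i]) : normc (- x) = normc x.
Proof. by have := normrN x; rewrite !normcE => -[]. Qed.

Lemma normcBC (x y : R[i]) : normc (x - y) = normc (y - x).
Proof. by rewrite -opprB normcN. Qed.

Lemma ler_normc_dist (x y : R[i]) : `|normc x - normc y| <= normc (x - y).
Proof.
have A u v : normc u - normc v <= normc (u - v).
  by rewrite lerBlDr -{1}(subrK v u) ler_normcD.
by rewrite ler_norml A andbT lerNl opprB normcBC.
Qed.

Lemma Re_le_normc (x : R[i]) : `|Re x| <= normc x.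
Proof.
case: x => a b /=; rewrite -[`|a|]sqrtr_sqr; apply: ler_wsqrtr.
by rewrite lerDl sqr_ge0.
Qed.

Lemma Im_le_normc (x : R[i]) : `|Im x| <= normc x.
Proof.
case: x => a b /=; rewrite -[`|b|]sqrtr_sqr; apply: ler_wsqrtr.
by rewrite lerDr sqr_ge0.
Qed.

Lemma normc_le_ReIm (x : R[i]) : normc x <= `|Re x| + `|Im x|.
Proof.
case: x => a b /=; rewrite -[leRHS]ger0_norm ?addr_ge0// -sqrtr_sqr.
apply: ler_wsqrtr; rewrite sqrrD !real_normK ?num_real//.
by rewrite -addrA [_ *+ 2 + _]addrC addrA lerDl mulrn_wge0// mulr_ge0.
Qed.

Lemma posc (e : R[i]) : 0 < e -> exists2 d : R, 0 < d & e = d%:C.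
Proof.
by case: e => a b; rewrite ltcE/= => /andP[/eqP -> ?]; exists a.
Qed.

Lemma cvgcP T (F : set_system T) (f : T -> R[i]) (l : R[i]) : Filter F ->
  (f @ F --> l) <-> (forall e : R, 0 < e -> \forall x \near F, normc (l - f x) < e).
Proof.
move=> FF; split => [/cvgrPdist_lt H e e0|H].
  have /H : 0 < e%:C :> R[i] by rewrite ltcR.
  by apply: filterS => x; rewrite normcE ltcR.
apply/cvgrPdist_lt => _ /posc[d d0 ->]; have := H d d0.
by apply: filterS => x; rewrite normcE ltcR.
Qed.

Lemma complex_complete (F : set_system R[i]) :
  ProperFilter F -> cauchy F -> cvg F.
Proof.
move=> FF /cauchyP Fc.
have part (p : R[i] -> R) :
    (forall x y, `|p x - p y| <= normc (x - y)) -> cvg (p @ F).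
  move=> pL; apply: R_complete; apply/cauchyP => e e0.
  have /Fc[x Fx] : 0 < e%:C :> R[i] by rewrite ltcR.
  exists (p x); suff : \forall y \near F, ball (p x) e (p y) by [].
  apply: filterS Fx => y; rewrite -!ball_normE /ball_/= normcE ltcR.
  exact: le_lt_trans (pL x y).
have /cvg_ex[/= a /cvgrPdist_lt Ha] : cvg (Re @ F).
  by apply: part => x y; rewrite -raddfB; exact: Re_le_normc.
have /cvg_ex[/= b /cvgrPdist_lt Hb] : cvg (Im @ F).
  by apply: part => x y; rewrite -raddfB; exact: Im_le_normc.
apply/cvg_ex; exists (a +i* b);
apply/(@cvgcP _ F id) => e e0; have e20 : 0 < e / 2 by rewrite divr_gt0.
have := Ha _ e20; have := Hb _ e20; apply: filterS2 => x /= Hy Hx.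
apply: le_lt_trans (normc_le_ReIm _) _; rewrite !raddfB/= (splitr e).
exact: ltrD.
Qed.

HB.instance Definition _ := Uniform_isComplete.Build R[i] complex_complete.

End ComplexComplete.

Section OperatorNorm.
Variable R : realType.
Local Notation normc := (@Normc.normc R).

Definition enorm n (v : 'cV[R[i]]_n) : R :=
  Num.sqrt (\sum_k normc (v k 0) ^+ 2).

Definition opnorm m n (M : 'M[R[i]]_(m, n)) : R :=
  sup [set enorm (M *m v) | v in [set v | enorm v <= 1]].

Lemma enorm_ge0 n (v : 'cV[R[i]]_n) : 0 <= enorm v.
Proof. exact: sqrtr_ge0. Qed.

Lemma enorm_sqr n (v : 'cV[R[i]]_n) :
  ((enorm v) ^+ 2)%:C = (v^t* *m v) 0 0.
Proof.
rewrite sqr_sqrtr ?sumr_ge0// => [|k _]; last exact: sqr_ge0.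
rewrite rmorph_sum mxE; apply: eq_bigr => k _.
by rewrite rmorphXn/= -normcE !mxE normCKC.
Qed.

Lemma enormE n (v : 'cV[R[i]]_n) : (enorm v)%:C = sqrtC (dotmx v^T v^T).
Proof.
rewrite dotmxE -[LHS]sqrCK ?ler0c ?enorm_ge0// -rmorphXn/= enorm_sqr.
by congr sqrtC; rewrite !mxE; apply: eq_bigr => k _; rewrite !mxE mulrC.
Qed.

Lemma enormD n (u v : 'cV[R[i]]_n) : enorm (u + v) <= enorm u + enorm v.
Proof.
rewrite -lecR rmorphD/= !enormE linearD/=.
exact: (triangle_lerif (@dotmx R[i] n) u^T v^T).
Qed.

Lemma enorm_CS n (u v : 'cV[R[i]]_n) :
  normc ((u^t* *m v) 0 0) <= enorm u * enorm v.
Proof.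
have <- : dotmx v^T u^T = (u^t* *m v) 0 0.
  rewrite dotmxE !mxE; apply: eq_bigr => k _.
  by rewrite !mxE mulrC.
rewrite -lecR -normcE rmorphM/= mulrC !enormE.
by have [] := CauchySchwarz_sqrt (@dotmx R[i] n) v^T u^T.
Qed.

Lemma enormZ n (a : R[i]) (v : 'cV[R[i]]_n) : enorm (a *: v) = normc a * enorm v.
Proof.
rewrite /enorm -[normc a]ger0_norm ?normc_ge0// -sqrtr_sqr -sqrtrM ?sqr_ge0//.
congr Num.sqrt; rewrite mulr_sumr; apply: eq_bigr => k _.
by rewrite mxE Normc.normcM exprMn.
Qed.

Lemma enorm0 n : enorm (0 : 'cV[R[i]]_n) = 0.
Proof.
rewrite /enorm big1 ?sqrtr0// => k _.
by rewrite mxE Normc.normc0 expr0n.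
Qed.

Lemma normc_le_enorm n (v : 'cV[R[i]]_n) k : normc (v k 0) <= enorm v.
Proof.
rewrite -[leLHS]ger0_norm ?normc_ge0// -sqrtr_sqr; apply: ler_wsqrtr.
by rewrite (bigD1 k)//= lerDl sumr_ge0// => ? _; exact: sqr_ge0.
Qed.

Lemma enorm_le_sum n (v : 'cV[R[i]]_n) : enorm v <= \sum_k normc (v k 0).
Proof.
have s0 : 0 <= \sum_k normc (v k 0) by apply: sumr_ge0 => k _; exact: normc_ge0.
rewrite -[leRHS]ger0_norm// -sqrtr_sqr; apply: ler_wsqrtr.
rewrite expr2 mulr_suml; apply: ler_sum => k _.
rewrite expr2 ler_wpM2l ?normc_ge0// (bigD1 k)//= lerDl.
by apply: sumr_ge0 => j _; exact: normc_ge0.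
Qed.

Definition entsum m n (M : 'M[R[i]]_(m, n)) : R := \sum_k \sum_l normc (M k l).

Lemma enorm_le_entsum m n (M : 'M[R[i]]_(m, n)) v :
  enorm (M *m v) <= entsum M * enorm v.
Proof.
apply: le_trans (enorm_le_sum _) _; rewrite mulr_suml; apply: ler_sum => k _.
rewrite mxE mulr_suml.
elim/big_ind2 : _ => [|x a y b xa yb|l _].
- by rewrite Normc.normc0.
- exact: le_trans (ler_normcD _ _) (lerD xa yb).
- by rewrite Normc.normcM ler_wpM2l ?normc_ge0 ?normc_le_enorm.
Qed.

Lemma entsum_ge0 m n (M : 'M[R[i]]_(m, n)) : 0 <= entsum M.
Proof. by do 2!apply: sumr_ge0 => ? _; exact: normc_ge0. Qed.

Lemma opnorm_ub m n (M : 'M[R[i]]_(m, n)) :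
  has_ubound [set enorm (M *m v) | v in [set v | enorm v <= 1]].
Proof.
exists (entsum M) => _ [v /= v1 <-]; apply: le_trans (enorm_le_entsum _ _) _.
by rewrite -[leRHS]mulr1 ler_wpM2l ?entsum_ge0.
Qed.

Lemma opnorm_ge0 m n (M : 'M[R[i]]_(m, n)) : 0 <= opnorm M.
Proof.
apply: le_trans (ub_le_sup (opnorm_ub M) _); last first.
  by exists 0 => //=; rewrite enorm0.
exact: enorm_ge0.
Qed.

Lemma enorm_mul m n (M : 'M[R[i]]_(m, n)) v :
  enorm (M *m v) <= opnorm M * enorm v.
Proof.
have [v0|v0] := eqVneq (enorm v) 0.
  by have := enorm_le_entsum M v; rewrite v0 !mulr0.
have vp : 0 < enorm v by rewrite lt_neqAle eq_sym v0 enorm_ge0.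
rewrite -ler_pdivrMr// mulrC.
have nE : normc ((enorm v)^-1)%:C = (enorm v)^-1.
  by apply: complexI; rewrite -normcE ger0_norm// ler0c invr_ge0 ltW.
rewrite -{1}nE -enormZ scalemxAr; apply: ub_le_sup; first exact: opnorm_ub.
by exists ((enorm v)^-1%:C *: v) => //=; rewrite enormZ nE mulVf.
Qed.

Lemma opnorm_le m n (M : 'M[R[i]]_(m, n)) c : 0 <= c ->
  (forall v, enorm (M *m v) <= c * enorm v) -> opnorm M <= c.
Proof.
move=> c0 H; apply: ge_sup.
  by exists (enorm (M *m 0)); exists 0 => //=; rewrite enorm0.
by move=> _ [v /= v1 <-]; rewrite (le_trans (H v))// -[leRHS]mulr1 ler_wpM2l.
Qed.

Lemma opnorm_le_entsum m n (M : 'M[R[i]]_(m, n)) : opnorm M <= entsum M.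
Proof. by apply: opnorm_le (entsum_ge0 M) _ => v; exact: enorm_le_entsum. Qed.

Lemma normc_le_opnorm m n (M : 'M[R[i]]_(m, n)) k l : normc (M k l) <= opnorm M.
Proof.
have e1 : enorm (delta_mx l 0 : 'cV[R[i]]_n) <= 1.
  apply: le_trans (enorm_le_sum _) _; rewrite (bigD1 l)//= big1 => [|j jl].
    by rewrite mxE !eqxx Normc.normc1 addr0.
  by rewrite mxE (negbTE jl) Normc.normc0.
have := normc_le_enorm (M *m delta_mx l 0) k; rewrite -colE mxE => /le_trans; apply.
rewrite colE; apply: le_trans (enorm_mul _ _) _.
by rewrite -[leRHS]mulr1 ler_wpM2l ?opnorm_ge0.
Qed.

Lemma opnormD m n (M N : 'M[R[i]]_(m, n)) : opnorm (M + N) <= opnorm M + opnorm N.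
Proof.
apply: opnorm_le => [|v]; first by rewrite addr_ge0 ?opnorm_ge0.
rewrite mulmxDl mulrDl (le_trans (enormD _ _))// lerD//; exact: enorm_mul.
Qed.

Lemma opnormZ_le m n a (M : 'M[R[i]]_(m, n)) :
  opnorm (a *: M) <= normc a * opnorm M.
Proof.
apply: opnorm_le => [|v]; first by rewrite mulr_ge0 ?normc_ge0 ?opnorm_ge0.
by rewrite -scalemxAl enormZ -mulrA ler_wpM2l ?normc_ge0 ?enorm_mul.
Qed.

Lemma opnormM m n p (M : 'M[R[i]]_(m, n)) (N : 'M[R[i]]_(n, p)) :
  opnorm (M *m N) <= opnorm M * opnorm N.
Proof.
apply: opnorm_le => [|v]; first by rewrite mulr_ge0 ?opnorm_ge0.
rewrite -mulmxA (le_trans (enorm_mul _ _))// -mulrA.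
by rewrite ler_wpM2l ?opnorm_ge0 ?enorm_mul.
Qed.

Lemma enorm_adj m n (M : 'M[R[i]]_(m, n)) v :
  enorm (M *m v) ^+ 2 <= enorm (M^t* *m M *m v) * enorm v.
Proof.
have -> : enorm (M *m v) ^+ 2 = normc (((M *m v)^t* *m (M *m v)) 0 0).
  apply: complexI; rewrite -normcE -enorm_sqr ger0_norm// ler0c.
  exact: sqr_ge0.
have -> : (M *m v)^t* *m (M *m v) = (M^t* *m M *m v)^t* *m v.
  by rewrite !trmx_mul !map_mxM/= trmxCK !mulmxA.
exact: enorm_CS.
Qed.

Lemma opnorm_adj_le m n (M : 'M[R[i]]_(m, n)) : opnorm M <= opnorm (M^t*).
Proof.
apply: opnorm_le => [|v]; first exact: opnorm_ge0.
have [->|Mv0] := eqVneq (enorm (M *m v)) 0.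
  by rewrite mulr_ge0 ?opnorm_ge0 ?enorm_ge0.
have Mvp : 0 < enorm (M *m v) by rewrite lt_neqAle eq_sym Mv0 enorm_ge0.
rewrite -(ler_pM2l Mvp) -expr2 (le_trans (enorm_adj _ _))// mulrA.
by rewrite ler_wpM2r ?enorm_ge0// mulrC -mulmxA enorm_mul.
Qed.

Lemma opnorm_adj m n (M : 'M[R[i]]_(m, n)) : opnorm (M^t*) = opnorm M.
Proof.
apply/le_anti; rewrite opnorm_adj_le andbT.
by have := opnorm_adj_le (M^t*); rewrite trmxCK.
Qed.

Lemma opnorm_cstar m n (M : 'M[R[i]]_(m, n)) :
  opnorm M ^+ 2 <= opnorm (M^t* *m M).
Proof.
rewrite -[leRHS]sqr_sqrtr ?opnorm_ge0// ler_sqr ?nnegrE ?sqrtr_ge0 ?opnorm_ge0//.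
apply: opnorm_le => [|v]; first exact: sqrtr_ge0.
rewrite -ler_sqr ?nnegrE ?mulr_ge0 ?sqrtr_ge0 ?enorm_ge0//.
rewrite exprMn [Num.sqrt (opnorm _) ^+ 2]sqr_sqrtr ?opnorm_ge0//.
apply: le_trans (enorm_adj _ _) _.
by rewrite expr2 mulrA ler_wpM2r ?enorm_ge0 ?enorm_mul.
Qed.

End OperatorNorm.

(* Hausdorff spaces carrying the structure of a finite CW complex of dimension
   at most one: finitely many 0-cells V, and finitely many closed 1-cells with
   characteristic maps e k : [0, 1] -> X.  As there are finitely many cells and
   X is Hausdorff, X automatically carries the weak topology of its cells.
   Loops and multiple edges are allowed. *)
Definition finite_graph (R : realType) (X : topologicalType) : Prop :=
  hausdorff_space X /\
  exists (V : set X) (E : finType) (e : E -> R -> X),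
    [/\ finite_set V,
        forall k, {within `[0, 1], continuous (e k)},
        forall k, V (e k 0) /\ V (e k 1),
        (forall k k' t t', 0 < t < 1 -> 0 < t' < 1 ->
           e k t = e k' t' -> k = k' /\ t = t') &
        (forall x, ~ V x <-> exists k t, 0 < t < 1 /\ x = e k t)].

Record ndgraph (R : realType) := NDGraph {
  ndgraph_space :> topologicalType ;
  ndgraph_graph : finite_graph R ndgraph_space ;
  ndgraph_connected : connected [set: ndgraph_space] ;
  ndgraph_nondegenerate : exists x y : ndgraph_space, x <> y }.

Lemma ndgraph_compact (R : realType) (X : ndgraph R) : compact [set: X].
Proof.
have [_ [V [E [e [finV ce _ _ eVC]]]]] := ndgraph_graph X.
have -> : [set: X] = V `|` \big[setU/set0]_(k : E) (e k @` `[0, 1]).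
  apply/seteqP; split => // x _; have [Vx|nVx] := pselect (V x); [by left|right].
  have /eVC[k [t [/andP[t0 t1] ->]]] := nVx.
  by rewrite (bigD1 k)//=; left; exists t => //=; rewrite in_itv/= !ltW.
apply: compactU; first exact: finite_compact.
apply: bigsetU_compact => k _; apply: continuous_compact => //.
exact: segment_compact.
Qed.

(* C*-algebras, not assumed to have a unit. *)
HB.mixin Record isCStarAlgebra (R : realType) T & CompleteNormedModule R[i] T := {
  cmul : T -> T -> T ;
  cstar : T -> T ;
  cmulA : associative cmul ;
  cmulDl : left_distributive cmul +%R ;
  cmulDr : right_distributive cmul +%R ;
  cmulZl : forall (c : R[i]) (x y : T), cmul (c *: x) y = c *: cmul x y ;
  cmulZr : forall (c : R[i]) (x y : T), cmul x (c *: y) = c *: cmul x y ;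
  cstarK : involutive cstar ;
  cstarD : {morph cstar : x y / x + y} ;
  cstarZ : forall (c : R[i]) (x : T), cstar (c *: x) = c^* *: cstar x ;
  cstarM : forall x y, cstar (cmul x y) = cmul (cstar y) (cstar x) ;
  cnormM : forall x y : T, `|cmul x y| <= `|x| * `|y| ;
  cnorm_cstar : forall x : T, `|cmul (cstar x) x| = `|x| ^+ 2 }.

#[short(type="cstarAlgType")]
HB.structure Definition CStarAlgebra (R : realType) :=
  {T of isCStarAlgebra R T & CompleteNormedModule R[i] T}.

Section MatrixFunctions.
Variables (R : realType) (I : finType) (Z : I -> ndgraph R) (r : I -> nat).
Local Notation normc := (@Normc.normc R).

(* The direct sum over i of C(Z i) (x) M_(r i), with C(Z i) (x) M_(r i)
   identified with the continuous functions from Z i to M_(r i). *)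
Record matfun := MatFun {
  mf :> forall i, Z i -> 'M[R[i]]_(r i) ;
  mf_continuous : forall i, continuous (@mf i) }.
Arguments mf : clear implicits.

HB.instance Definition _ := gen_eqMixin matfun.
HB.instance Definition _ := gen_choiceMixin matfun.

Lemma matfunP (a b : matfun) : (forall i z, a i z = b i z) -> a = b.
Proof.
case: a b => [f fc] [g gc] /= fg; have {}fg : f = g.
  by apply: functional_extensionality_dep => i; apply/funext.
by subst g; congr MatFun; exact: Prop_irrelevance.
Qed.

Lemma mx_continuousP (T : topologicalType) m n (f : T -> 'M[R[i]]_(m, n)) :
  continuous f <-> forall k l, continuous (fun z => f z k l : R[i]).
Proof.
split => [cf k l z|H z].
  apply: (@continuous_comp _ _ _ f (fun M => M k l)); first exact: cf.
  move=> A fA; suff : nbhs (f z) [set M : 'M[R[i]]_(m, n) | A (M k l)] by [].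
  exists (fun k' l' => if (k' == k) && (l' == l) then A else setT).
    move=> k' l' /=; case: ifPn => [/andP[/eqP -> /eqP ->]//|_].
    exact: filterT.
  by move=> M /= /(_ k l); rewrite !eqxx.
move=> A [P Pf PA].
suff : \forall w \near z, forall k l, P k l (f w k l).
  by apply: filterS => w; exact: PA.
by apply: filter_forall => k; apply: filter_forall => l; exact: H (Pf k l).
Qed.

Lemma matfun0_cont i : continuous (fun _ : Z i => 0 : 'M[R[i]]_(r i)).
Proof. by move=> z; exact: cvg_cst. Qed.

Definition matfun0 := MatFun (@matfun0_cont).

Lemma matfun1_cont i : continuous (fun _ : Z i => 1%:M : 'M[R[i]]_(r i)).
Proof. by move=> z; exact: cvg_cst. Qed.

Definition matfun1 := MatFun (@matfun1_cont).

Lemma matfunD_cont (a b : matfun) i : continuous (fun z => a i z + b i z).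
Proof. by move=> z; apply: cvgD; exact: mf_continuous. Qed.

Definition matfunD a b := MatFun (@matfunD_cont a b).

Lemma matfunN_cont (a : matfun) i : continuous (fun z => - a i z).
Proof. by move=> z; apply: cvgN; exact: mf_continuous. Qed.

Definition matfunN a := MatFun (@matfunN_cont a).

Lemma matfunZ_cont (c : R[i]) (a : matfun) i : continuous (fun z => c *: a i z).
Proof. by move=> z; apply: cvgZr; exact: mf_continuous. Qed.

Definition matfunZ c a := MatFun (@matfunZ_cont c a).

Lemma matfunM_cont (a b : matfun) i : continuous (fun z => a i z *m b i z).
Proof.
apply/mx_continuousP => k l z.
rewrite /continuous_at; under eq_fun do rewrite mxE.
rewrite mxE; apply: cvg_big => [|j _]; first exact: add_continuous.
by apply: cvgM; apply mx_continuousP; exact: mf_continuous.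
Qed.

Definition matfunM a b := MatFun (@matfunM_cont a b).

Lemma matfunS_cont (a : matfun) i : continuous (fun z => (a i z)^t*).
Proof.
apply/mx_continuousP => k l z.
rewrite /continuous_at; under eq_fun do rewrite !mxE.
rewrite !mxE; apply/cvgcP => e e0.
have /mx_continuousP/(_ l k z)/cvgcP/(_ e e0) := @mf_continuous a i.
apply: filterS => w; rewrite -rmorphB/=.
by congr (_ < e); apply: complexI; rewrite -!normcE norm_conjC.
Qed.

Definition matfunS a := MatFun (@matfunS_cont a).

Fact matfunDA : associative matfunD.
Proof. by move=> a b c; apply: matfunP => i z /=; rewrite addrA. Qed.
Fact matfunDC : commutative matfunD.
Proof. by move=> a b; apply: matfunP => i z /=; rewrite addrC. Qed.
Fact matfun0D : left_id matfun0 matfunD.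
Proof. by move=> a; apply: matfunP => i z /=; rewrite add0r. Qed.
Fact matfunND : left_inverse matfun0 matfunN matfunD.
Proof. by move=> a; apply: matfunP => i z /=; rewrite addNr. Qed.

HB.instance Definition _ :=
  GRing.isZmodule.Build matfun matfunDA matfunDC matfun0D matfunND.

Fact matfunZA c d a : matfunZ c (matfunZ d a) = matfunZ (c * d) a.
Proof. by apply: matfunP => i z /=; rewrite scalerA. Qed.
Fact matfun1Z : left_id 1 matfunZ.
Proof. by move=> a; apply: matfunP => i z /=; rewrite scale1r. Qed.
Fact matfunZDr : right_distributive matfunZ +%R.
Proof. by move=> c a b; apply: matfunP => i z /=; rewrite scalerDr. Qed.
Fact matfunZDl a : {morph matfunZ^~ a : c d / c + d}.
Proof. by move=> c d; apply: matfunP => i z /=; rewrite scalerDl. Qed.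

HB.instance Definition _ := GRing.Zmodule_isLmodule.Build R[i] matfun
  matfunZA matfun1Z matfunZDr matfunZDl.

Definition supnorm (a : matfun) : R :=
  sup [set x | exists i z, x = opnorm (a i z)].

Lemma supnorm_ub (a : matfun) : has_ubound [set x | exists i z, x = opnorm (a i z)].
Proof.
have H i k l : exists K : R, forall z, normc (a i z k l) <= K.
  have cc : continuous (fun z => normc (a i z k l)).
    move=> z; apply/cvgrPdist_lt => e e0.
    have /mx_continuousP/(_ k l z)/cvgcP/(_ e e0) := @mf_continuous a i.
    apply: filterS => w; apply: le_lt_trans; exact: ler_normc_dist.
  have /compact_bounded[M [_ HM]] :
      compact ((fun z => normc (a i z k l)) @` [set: Z i]).
    apply: continuous_compact; last exact: ndgraph_compact.
    exact/continuous_subspaceT.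
  exists (M + 1) => z; have /HM : M < M + 1 by rewrite ltrDl.
  move=> H; rewrite -[leLHS]ger0_norm ?normc_ge0//.
  by apply: H; exists z.
have {}H i k l := cid (H i k l).
exists (\sum_i \sum_k \sum_l `|sval (H i k l)|) => _ [i [z ->]].
rewrite (bigD1 i)//=; apply: ler_wpDr.
  by do 3! apply: sumr_ge0 => ? _.
apply: le_trans (opnorm_le_entsum _) _; do 2! apply: ler_sum => ? _.
by apply: le_trans (ler_norm _); case: (H _ _ _) => /= K; exact.
Qed.

Lemma opnorm_le_supnorm (a : matfun) i z : opnorm (a i z) <= supnorm a.
Proof. by apply: ub_le_sup; [exact: supnorm_ub|exists i, z]. Qed.

Lemma supnorm_le (a : matfun) c : 0 <= c ->
  (forall i z, opnorm (a i z) <= c) -> supnorm a <= c.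
Proof.
move=> c0 H; rewrite /supnorm.
have [->|/set0P ne] := eqVneq [set x | exists i z, x = opnorm (a i z)] set0.
  by rewrite sup0.
by apply: ge_sup => // _ [i [z ->]].
Qed.

Lemma supnorm_ge0 (a : matfun) : 0 <= supnorm a.
Proof.
rewrite /supnorm.
have [->|/set0P[x Sx]] := eqVneq [set x | exists i z, x = opnorm (a i z)] set0.
  by rewrite sup0.
apply: le_trans (ub_le_sup (supnorm_ub a) Sx).
by case: Sx => i [z ->]; exact: opnorm_ge0.
Qed.

Definition matfun_norm (a : matfun) : R[i] := (supnorm a)%:C.

Fact matfun_normD a b : matfun_norm (a + b) <= matfun_norm a + matfun_norm b.
Proof.
rewrite -rmorphD/= lecR; apply: supnorm_le => [|i z].
  by rewrite addr_ge0 ?supnorm_ge0.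
by rewrite (le_trans (opnormD _ _))// lerD ?opnorm_le_supnorm.
Qed.

Lemma supnormZ_le c a : supnorm (c *: a) <= normc c * supnorm a.
Proof.
apply: supnorm_le => [|i z]; first by rewrite mulr_ge0 ?normc_ge0 ?supnorm_ge0.
rewrite (le_trans (opnormZ_le _ _))// ler_wpM2l ?normc_ge0//.
exact: opnorm_le_supnorm.
Qed.

Fact matfun_normZ (c : R[i]) a : matfun_norm (c *: a) = `|c| * matfun_norm a.
Proof.
rewrite normcE -rmorphM/=; congr (_%:C); apply/le_anti.
rewrite supnormZ_le/=; have [->|c0] := eqVneq c 0.
  by rewrite Normc.normc0 mul0r supnorm_ge0.
have cp : 0 < normc c.
  by rewrite lt_neqAle normc_ge0 andbT eq_sym; apply: contra_neq c0; exact: Normc.eq0_normc.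
have := supnormZ_le c^-1 (c *: a).
by rewrite scalerA mulVf// scale1r (Normc.normcV c) ler_pdivlMl.
Qed.

Fact matfun_norm0_eq0 a : matfun_norm a = 0 -> a = 0.
Proof.
move=> /complexI a0; apply: matfunP => i z; apply/matrixP => k l.
rewrite mxE; apply: Normc.eq0_normc; apply/le_anti.
rewrite normc_ge0 andbT -a0.
exact: le_trans (normc_le_opnorm _ _ _) (opnorm_le_supnorm _ _).
Qed.

HB.instance Definition _ := @Lmodule_isNormed.Build R[i] matfun
  matfun_norm matfun_normD matfun_normZ matfun_norm0_eq0.

Lemma matfun_normE (a : matfun) : `|a| = (supnorm a)%:C.
Proof. by []. Qed.

Lemma ball_matfunP (a b : matfun) (e : R) : ball a e%:C b <-> supnorm (a - b) < e.
Proof. by rewrite -ball_normE /ball_/= matfun_normE ltcR. Qed.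

Lemma normc_le_supnorm (a : matfun) i z k l : normc (a i z k l) <= supnorm a.
Proof. exact: le_trans (normc_le_opnorm _ _ _) (opnorm_le_supnorm _ _). Qed.

Lemma matfun_complete (F : set_system matfun) :
  ProperFilter F -> cauchy F -> cvg F.
Proof.
move=> FF /cauchyP Fc.
have {}Fc (e : R) : 0 < e ->
    exists a : matfun, \forall b \near F, supnorm (a - b) < e.
  move=> e0; have /Fc[a Fa] : 0 < e%:C :> R[i] by rewrite ltcR.
  by exists a; apply: filterS Fa => b /ball_matfunP.
pose ent i (z : Z i) k l (b : matfun) : R[i] := b i z k l.
have entc i z k l : cvg (@ent i z k l @ F).
  apply: complex_complete; apply/cauchyP => _ /posc[e e0 ->].
  have [a Fa] := Fc e e0; exists (a i z k l).
  suff : \forall b \near F, ball (a i z k l) e%:C (ent i z k l b) by [].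
  apply: filterS Fa => b ab; rewrite -ball_normE /ball_/= normcE ltcR.
  apply: le_lt_trans ab; have := normc_le_supnorm (a - b) z k l.
  by rewrite !mxE.
pose L i (z : Z i) : 'M[R[i]]_(r i) := \matrix_(k, l) lim (@ent i z k l @ F).
have LE (a : matfun) (e : R) : (\forall b \near F, supnorm (a - b) < e) ->
    forall i z k l, normc (a i z k l - L i z k l) <= e.
  move=> Fa i z k l; apply/ler_addgt0Pr => d d0.
  have /cvgcP/(_ d d0) Fd := entc i z k l.
  have [b [ab bL]] := filter_ex (filterI Fa Fd).
  rewrite mxE -[a i z k l](subrK (b i z k l)) -addrA.
  apply: le_trans (ler_normcD _ _) _; apply: lerD.
    apply: le_trans (ltW ab); have := normc_le_supnorm (a - b) z k l.
    by rewrite !mxE.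
  by rewrite normcBC; exact: ltW.
have Lcont i : continuous (L i).
  apply/mx_continuousP => k l z; apply/cvgcP => e e0.
  have e3 : 0 < e / 3 by rewrite divr_gt0.
  have [a /LE Fa] := Fc _ e3.
  have /mx_continuousP/(_ k l z)/cvgcP/(_ _ e3) := @mf_continuous a i.
  apply: filterS => w azw.
  have -> : L i z k l - L i w k l = (L i z k l - a i z k l) +
      ((a i z k l - a i w k l) + (a i w k l - L i w k l)).
    by ring.
  apply: le_lt_trans (ler_normcD _ _) _.
  have -> : e = e / 3 + (e / 3 + e / 3) by field.
  apply: ler_ltD; first by rewrite normcBC; exact: Fa.
  apply: le_lt_trans (ler_normcD _ _) _; apply: ltr_leD => //; exact: Fa.
pose K : R := \sum_i (r i * r i)%:R.
have K0 : 0 <= K by exact: sumr_ge0.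
have K1 : 0 < K + 1 by rewrite ltr_wpDl.
apply/cvg_ex; exists (MatFun Lcont); apply/cvgrPdist_lt => _ /posc[e e0 ->].
have eK : 0 < e / (K + 1) by rewrite divr_gt0.
have [a Fa] := Fc _ eK; apply: filterS (Fa) => b ab.
rewrite matfun_normE ltcR.
have -> : e = K * (e / (K + 1)) + e / (K + 1) by field; rewrite gt_eqF.
have D : supnorm (MatFun Lcont - b) <=
    supnorm (MatFun Lcont - a) + supnorm (a - b).
  have := matfun_normD (MatFun Lcont - a) (a - b).
  by rewrite addrA subrK -rmorphD/= lecR.
apply: le_lt_trans D _; apply: ler_ltD => //.
have Kr i : ((r i * r i)%:R : R) <= K by rewrite /K (bigD1 i)//= lerDl sumr_ge0.
apply: supnorm_le => [|i z]; first by rewrite mulr_ge0// ltW.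
apply: le_trans (opnorm_le_entsum _) _.
apply: le_trans (ler_wpM2r (ltW eK) (Kr i)).
apply: (@le_trans _ _ (\sum_(k < r i) \sum_(l < r i) (e / (K + 1)))).
  apply: ler_sum => k _; apply: ler_sum => l _.
  by rewrite !mxE -normcN opprB; have := LE _ _ Fa i z k l; rewrite !mxE.
by rewrite !sumr_const !card_ord -mulrnA mulr_natl.
Qed.

HB.instance Definition _ := Uniform_isComplete.Build matfun matfun_complete.

Fact matfunMA : associative matfunM.
Proof. by move=> a b c; apply: matfunP => i z /=; rewrite mulmxA. Qed.
Fact matfunMDl : left_distributive matfunM +%R.
Proof. by move=> a b c; apply: matfunP => i z /=; rewrite mulmxDl. Qed.
Fact matfunMDr : right_distributive matfunM +%R.
Proof. by move=> a b c; apply: matfunP => i z /=; rewrite mulmxDr. Qed.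
Fact matfunMZl (c : R[i]) (a b : matfun) : matfunM (c *: a) b = c *: matfunM a b.
Proof. by apply: matfunP => i z /=; rewrite scalemxAl. Qed.
Fact matfunMZr (c : R[i]) (a b : matfun) : matfunM a (c *: b) = c *: matfunM a b.
Proof. by apply: matfunP => i z /=; rewrite scalemxAr. Qed.
Fact matfunSK : involutive matfunS.
Proof. by move=> a; apply: matfunP => i z /=; rewrite trmxCK. Qed.
Fact matfunSD : {morph matfunS : a b / a + b}.
Proof. by move=> a b; apply: matfunP => i z /=; rewrite linearD map_mxD. Qed.
Fact matfunSZ (c : R[i]) (a : matfun) : matfunS (c *: a) = c^* *: matfunS a.
Proof. by apply: matfunP => i z /=; rewrite linearZ map_mxZ. Qed.
Fact matfunSM a b : matfunS (matfunM a b) = matfunM (matfunS b) (matfunS a).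
Proof. by apply: matfunP => i z /=; rewrite trmx_mul map_mxM. Qed.
Fact matfun_normM (a b : matfun) : `|matfunM a b| <= `|a| * `|b|.
Proof.
rewrite !matfun_normE -rmorphM/= lecR; apply: supnorm_le => [|i z].
  by rewrite mulr_ge0 ?supnorm_ge0.
rewrite (le_trans (opnormM _ _))// ler_pM ?opnorm_ge0 ?opnorm_le_supnorm//.
Qed.
Fact matfun_norm_cstar (a : matfun) : `|matfunM (matfunS a) a| = `|a| ^+ 2.
Proof.
rewrite !matfun_normE -rmorphXn/=; congr (_%:C); apply/le_anti/andP; split.
  apply: supnorm_le => [|i z]; first by rewrite sqr_ge0.
  rewrite (le_trans (opnormM _ _))//= opnorm_adj -expr2.
  by rewrite ler_sqr ?nnegrE ?opnorm_ge0 ?supnorm_ge0 ?opnorm_le_supnorm.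
rewrite -[leRHS]sqr_sqrtr ?supnorm_ge0// ler_sqr ?nnegrE ?sqrtr_ge0 ?supnorm_ge0//.
apply: supnorm_le => [|i z]; first exact: sqrtr_ge0.
rewrite -ler_sqr ?nnegrE ?sqrtr_ge0 ?opnorm_ge0//.
rewrite [Num.sqrt _ ^+ 2]sqr_sqrtr ?supnorm_ge0// (le_trans (opnorm_cstar _))//.
exact: (opnorm_le_supnorm (matfunM (matfunS a) a) z).
Qed.

HB.instance Definition _ := @isCStarAlgebra.Build R matfun
  matfunM matfunS matfunMA matfunMDl matfunMDr matfunMZl matfunMZr
  matfunSK matfunSD matfunSZ matfunSM matfun_normM matfun_norm_cstar.

End MatrixFunctions.

Record star_hom (R : realType) (A B : cstarAlgType R) (f : A -> B) : Prop := {
  star_hom_linear : linear f ;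
  star_homM : {morph f : x y / cmul x y} ;
  star_homS : {morph f : x / cstar x} }.

Definition star_isomorphic (R : realType) (A B : cstarAlgType R) : Prop :=
  exists f : A -> B, star_hom f /\ bijective f.

(* The universal property of the inductive limit in the category of C*-algebras
   and *-homomorphisms. *)
Definition is_inductive_limit (R : realType) (A : nat -> cstarAlgType R)
    (phi : forall n, A n -> A n.+1) (L : cstarAlgType R)
    (mu : forall n, A n -> L) : Prop :=
  [/\ forall n, star_hom (mu n),
      forall n (a : A n), mu n.+1 (phi n a) = mu n a &
      forall (B : cstarAlgType R) (nu : forall n, A n -> B),
        (forall n, star_hom (nu n)) ->
        (forall n (a : A n), nu n.+1 (phi n a) = nu n a) ->
        exists! f : L -> B,
          star_hom f /\ forall n (a : A n), f (mu n a) = nu n a].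

Section GraphAlgebraHomomorphisms.
Variables (R : realType) (I J : finType).
Variables (Z : I -> ndgraph R) (r : I -> nat).
Variables (Y : J -> ndgraph R) (s : J -> nat).

Definition unital (phi : matfun Z r -> matfun Y s) : Prop :=
  phi (matfun1 Z r) = matfun1 Y s.

(* At every point y, evaluation at y after phi is unitarily equivalent, via U,
   to the direct sum of the evaluations at pairwise distinct points x mu. *)
Definition maximally_homogeneous (phi : matfun Z r -> matfun Y s) : Prop :=
  forall (j : J) (y : Y j),
    exists (m : nat) (x : 'I_m -> {i : I & Z i})
           (U : 'M[R[i]]_(s j, \sum_(mu < m) r (tag (x mu)))),
      [/\ injective x, U *m U^t* = 1%:M, U^t* *m U = 1%:M &
          forall a : matfun Z r,
            phi a j y =
            U *m (\mxdiag_(mu < m) a (tag (x mu)) (tagged (x mu))) *m U^t*].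

End GraphAlgebraHomomorphisms.

(* Main.v *)
From HB Require Import structures.
From mathcomp Require Import all_boot all_order all_algebra.
From mathcomp Require Import perm complex ring lra finmap.
From mathcomp Require Import boolp classical_sets functions cardinality reals.
From mathcomp Require Import topology normedtype realfun.
Require Import Defs.

(** If homomorphisms psi n are close to phi n on finite sets that grow with n and
    become dense, the two systems are approximately intertwined and have the same
    inductive limits [inductive_limit_intertwined]; sequences of such finite sets
    exist because the algebras are separable [matfun_separable]. The theorem is
    thus reduced to a statement about one homomorphism [approximate]: if it is
    unital and injective, it can be approximated on a finite set by one that is
    maximally homogeneous as well.

    Evaluation at y after the homomorphism is a representation pi y on a space of
    finite dimension, hence a direct sum of evaluations at points [rep_presented],
    possibly with repetitions. For a single y these disappear when the points are
    moved apart [perturb_multiplicity_free]; the difficulty is to do this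
    continuously in y. The key is a local connectedness [local_joined]: two
    multiplicity-free representations that are close enough to the same pi are
    joined by a path of multiplicity-free representations close to pi. Around each
    point p of pi both of them have equally many points, all in a star, a finite
    union of arcs issuing from p; their systems of matrix units are close, so that
    one frame is carried to the other by unitaries that hardly move these matrix
    units [unitary_path_close]. It remains to carry the points to their new places
    inside the star without collisions [tokens_joined]. A point that finds its way
    blocked lets the blocking point go ahead and takes over the place left by it.
    This only permutes the labels, and a permutation of the points amounts to a
    permutation of the frame, which fixes the matrix units.

    Since edges are intervals, such paths can be concatenated [follows_edge]: over
    each edge one obtains a path of multiplicity-free representations close to pi,
    whose ends are prescribed at the vertices, and these paths fit together
    [graph_approx]. Injectivity means, by compactness, that the points of all the
    pi y cover the domain [spectrum_covers]. The paths are made to sweep out whole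
    stars, so that their points still cover it. *)

Set Implicit Arguments.
Unset Strict Implicit.
Unset Printing Implicit Defensive.

Import Order.TTheory GRing.Theory Num.Theory.
Import numFieldNormedType.Exports.

Local Open Scope classical_set_scope.
Local Open Scope complex_scope.
Local Open Scope ring_scope.
Local Open Scope sesquilinear_scope.

(** * Real norms and boundedness of homomorphisms *)

Section RealNorm.
Variables (R : realType) (V : completeNormedModType R[i]).
Local Notation normc := (@Normc.normc R).
Implicit Types (x y : V) (c : R[i]).

(** The norm takes its values among the complex numbers; its real part makes real
    arithmetic available. *)
Definition rnorm x : R := complex.Re `|x|.

Lemma rnormE x : `|x| = (rnorm x)%:C.
Proof. by rewrite /rnorm RRe_real// normr_real. Qed.

Lemma rnorm_ge0 x : 0 <= rnorm x.
Proof. by rewrite -lecR -rnormE normr_ge0. Qed.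

Lemma rnormD x y : rnorm (x + y) <= rnorm x + rnorm y.
Proof. by rewrite -lecR rmorphD/= -!rnormE ler_normD. Qed.

Lemma rnormN x : rnorm (- x) = rnorm x.
Proof. by rewrite /rnorm normrN. Qed.

Lemma rnormBC x y : rnorm (x - y) = rnorm (y - x).
Proof. by rewrite -opprB rnormN. Qed.

Lemma rnorm0 : rnorm 0 = 0.
Proof. by rewrite /rnorm normr0. Qed.

Lemma rnorm_le0 x : rnorm x <= 0 -> x = 0.
Proof.
move=> x0; apply: normr0_eq0; rewrite rnormE.
by have -> : rnorm x = 0 by apply/le_anti; rewrite x0 rnorm_ge0.
Qed.

Lemma rnormZ c x : rnorm (c *: x) = normc c * rnorm x.
Proof.
by apply: complexI; rewrite rmorphM/= -!rnormE -normcE normrZ.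
Qed.

Lemma rnorm_tri x y z : rnorm (x - z) <= rnorm (x - y) + rnorm (y - z).
Proof. by rewrite -[x - z](subrKA y) rnormD. Qed.

Lemma rnorm_cvgP T (F : set_system T) (f : T -> V) (l : V) : Filter F ->
  (f @ F --> l) <-> (forall e : R, 0 < e -> \forall x \near F, rnorm (l - f x) < e).
Proof.
move=> FF; split => [/cvgrPdist_lt H e e0|H].
  have /H : 0 < e%:C :> R[i] by rewrite ltcR.
  by apply: filterS => x; rewrite rnormE ltcR.
apply/cvgrPdist_lt => _ /posc[d d0 ->]; have := H d d0.
by apply: filterS => x; rewrite rnormE ltcR.
Qed.

Lemma rnorm_cvg_seqP (u : nat -> V) (l : V) :
  (u @ \oo --> l) <->
  (forall e : R, 0 < e -> exists N, forall n, (N <= n)%N -> rnorm (l - u n) < e).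
Proof.
rewrite rnorm_cvgP; split=> H e /H.
  by move=> [N _ HN]; exists N => n Nn; exact: HN.
by move=> [N HN]; exists N => // n /= /HN.
Qed.

Lemma rnorm_cauchy_cvg (u : nat -> V) :
  (forall e : R, 0 < e -> exists N, forall n, (N <= n)%N -> rnorm (u N - u n) < e) ->
  exists l : V, u @ \oo --> l.
Proof.
move=> H; apply/cvg_ex/cauchy_cvgP/cauchyP => _ /posc[e /H [N HN] ->].
exists (u N); exists N => // n /= /HN.
by rewrite -ball_normE /ball_/= rnormE ltcR.
Qed.

Lemma rnorm_cvg_le (u : nat -> V) (l x : V) (c : R) N : u @ \oo --> l ->
  (forall n, (N <= n)%N -> rnorm (x - u n) <= c) -> rnorm (x - l) <= c.
Proof.
move=> /rnorm_cvg_seqP ul H; apply/ler_addgt0Pr => e /ul[M HM].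
apply: le_trans (rnorm_tri _ (u (maxn N M)) _) _; apply: lerD.
  by rewrite H// leq_maxl.
by rewrite rnormBC ltW// HM// leq_maxr.
Qed.

Lemma rnorm_cvg_uniq (u : nat -> V) (l l' : V) :
  u @ \oo --> l -> u @ \oo --> l' -> l = l'.
Proof.
move=> /rnorm_cvg_seqP ul ul'; apply/eqP; rewrite -subr_eq0; apply/eqP.
apply: rnorm_le0; apply/ler_addgt0Pr => e /ul[N HN]; rewrite add0r.
by apply: rnorm_cvg_le ul' _ => n /HN/ltW; exact.
Qed.

Lemma rnorm_cvgS (u : nat -> V) (l : V) :
  u @ \oo --> l -> (fun n => u n.+1) @ \oo --> l.
Proof.
move=> /rnorm_cvg_seqP ul; apply/rnorm_cvg_seqP => e /ul[N HN].
by exists N => n Nn; rewrite HN// leqW.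
Qed.

Lemma rnorm_geo_tele (u : nat -> V) N :
  (forall n, (N <= n)%N -> rnorm (u n.+1 - u n) <= 2^-1 ^+ n) ->
  forall n k, (N <= n)%N -> rnorm (u n - u (n + k)%N) <= 2 * 2^-1 ^+ n.
Proof.
move=> H n k Nn.
suff : rnorm (u n - u (n + k)%N) <= 2 * 2^-1 ^+ n - 2 * 2^-1 ^+ (n + k).
  move/le_trans; apply; rewrite lerBlDr lerDl mulr_ge0//.
  by rewrite exprn_ge0// invr_ge0.
elim: k => [|k IH]; first by rewrite addn0 !subrr rnorm0.
apply: le_trans (rnorm_tri _ (u (n + k)%N) _) _.
have := H (n + k)%N (leq_trans Nn (leq_addr _ _)).
rewrite rnormBC addnS exprS; set a := 2^-1 ^+ (n + k).
by move: IH; rewrite -/a; lra.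
Qed.

Lemma geo_small (e : R) : 0 < e -> exists N, forall n, (N <= n)%N ->
  2 * 2^-1 ^+ n < e.
Proof.
move=> e0; exists (Num.bound (2 / e)) => n /upper_nthrootP H.
by rewrite exprVn ltr_pdivrMr ?exprn_gt0// mulrC -ltr_pdivrMr.
Qed.

Lemma rnorm_geo_cvg (u : nat -> V) N :
  (forall n, (N <= n)%N -> rnorm (u n.+1 - u n) <= 2^-1 ^+ n) ->
  exists2 l : V, u @ \oo --> l &
    forall n, (N <= n)%N -> rnorm (u n - l) <= 2 * 2^-1 ^+ n.
Proof.
move=> /rnorm_geo_tele H.
have [l ul] : exists l : V, u @ \oo --> l.
  apply: rnorm_cauchy_cvg => e /geo_small[M HM]; exists (maxn N M) => n Nn.
  rewrite -(subnKC Nn) (le_lt_trans (H _ _ (leq_maxl _ _)))//.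
  by rewrite HM// leq_maxr.
exists l => // n Nn; apply: (rnorm_cvg_le (N := n)) ul _ => m nm.
by rewrite -(subnKC nm) H.
Qed.

End RealNorm.

Lemma conjCR (R : realType) (c : R) : (c%:C : R[i])^* = c%:C.
Proof. exact: conjc_real. Qed.

Lemma normcR (R : realType) (c : R) : Normc.normc (c%:C : R[i]) = `|c|.
Proof. by rewrite /Normc.normc /= expr0n addr0 sqrtr_sqr. Qed.

Section CStar.
Variables (R : realType) (A : cstarAlgType R).
Implicit Types x y z : A.

Lemma rnormM x y : rnorm (cmul x y) <= rnorm x * rnorm y.
Proof. by rewrite -lecR rmorphM/= -!rnormE cnormM. Qed.

Lemma rnorm_sq x : rnorm (cmul (cstar x) x) = rnorm x ^+ 2.
Proof. by apply: complexI; rewrite rmorphXn/= -!rnormE cnorm_cstar. Qed.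

Lemma cmul0r x : cmul x (0 : A) = 0.
Proof. by apply: (@addIr _ (cmul x 0)); rewrite -cmulDr !add0r. Qed.

Lemma cmulr0 x : cmul (0 : A) x = 0.
Proof. by apply: (@addIr _ (cmul 0 x)); rewrite -cmulDl !add0r. Qed.

Lemma cmulNr x y : cmul x (- y) = - cmul x y.
Proof. by rewrite -scaleN1r cmulZr scaleN1r. Qed.

Lemma cmulrN x y : cmul (- x) y = - cmul x y.
Proof. by rewrite -scaleN1r cmulZl scaleN1r. Qed.

Lemma cstar0 : cstar (0 : A) = 0.
Proof. by apply: (@addIr _ (cstar 0)); rewrite -cstarD !add0r. Qed.

Lemma cstarN x : cstar (- x) = - cstar x.
Proof. by apply: (@addrI _ (cstar x)); rewrite -cstarD !subrr cstar0. Qed.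

Lemma rnorm_star_le x : rnorm x <= rnorm (cstar x).
Proof.
have [x0|x0] := leP (rnorm x) 0; first by rewrite (le_trans x0)// rnorm_ge0.
by rewrite -(ler_pM2r x0) -expr2 -rnorm_sq rnormM.
Qed.

Lemma rnorm_star x : rnorm (cstar x) = rnorm x.
Proof.
by apply/le_anti; rewrite rnorm_star_le andbT -{2}[x]cstarK rnorm_star_le.
Qed.

Lemma cvg_cmul (u v : nat -> A) x y : u @ \oo --> x -> v @ \oo --> y ->
  (fun n => cmul (u n) (v n)) @ \oo --> cmul x y.
Proof.
move=> /rnorm_cvg_seqP ux /rnorm_cvg_seqP vy; apply/rnorm_cvg_seqP => e e0.
pose c := rnorm x + rnorm y + 1.
have x0 := rnorm_ge0 x; have y0 := rnorm_ge0 y.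
have c0 : 0 < c by rewrite /c; lra.
pose d := Num.min 1 (e / (2 * c)).
have d0 : 0 < d by rewrite lt_min ltr01 divr_gt0// mulr_gt0.
have [N HN] := ux d d0; have [M HM] := vy d d0.
exists (maxn N M) => n; rewrite geq_max => /andP[/HN ux' /HM vy'].
have -> : cmul x y - cmul (u n) (v n) =
    cmul x (y - v n) + cmul (x - u n) (v n).
  by rewrite cmulDr cmulNr cmulDl cmulrN addrA subrK.
apply: le_lt_trans (rnormD _ _) _.
have vb : rnorm (v n) <= rnorm y + 1.
  have d1 : d <= 1 by rewrite ge_min lexx.
  have := rnormD (v n - y) y; rewrite subrK rnormBC; move: vy'; lra.
have de : d * c <= e / 2.
  apply: (@le_trans _ _ (e / (2 * c) * c)); last by rewrite invfM mulrA divfK ?gt_eqF.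
  by rewrite ler_pM2r// ge_min lexx orbT.
have h1 : rnorm (cmul x (y - v n)) <= rnorm x * d.
  by rewrite (le_trans (rnormM _ _))// ler_wpM2l// ltW.
have h2 : rnorm (cmul (x - u n) (v n)) <= d * (rnorm y + 1).
  apply: le_trans (rnormM _ _) _; apply: ler_pM; rewrite ?rnorm_ge0//.
  exact: ltW.
rewrite /c in de; nra.
Qed.

Lemma cvg_cstar (u : nat -> A) x : u @ \oo --> x ->
  (fun n => cstar (u n)) @ \oo --> cstar x.
Proof.
move=> /rnorm_cvg_seqP ux; apply/rnorm_cvg_seqP => e /ux[N HN].
by exists N => n /HN; rewrite -cstarN -cstarD rnorm_star.
Qed.

(** The quadratic map y |-> (x + y^2) / 2 contracts the ball of radius 1/4;
    its fixed point y satisfies (1 - y)^2 = 1 - x, so 1 - y plays the role of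
    sqrt (1 - x) in an algebra that may lack a unit. *)
Lemma cstar_sqrt x : cstar x = x -> rnorm x <= 4^-1 ->
  exists y, [/\ cstar y = y, y + y - cmul y y = x &
    forall a, cmul a x = cmul x a -> cmul a y = cmul y a].
Proof.
move=> xs x4; pose h : R[i] := (2^-1)%:C.
have hE : Normc.normc h = 2^-1.
  by rewrite normcR ger0_norm// invr_ge0.
pose F y := h *: (x + cmul y y); pose u n := iter n F 0.
have uS n : u n.+1 = F (u n) by [].
have ub n : rnorm (u n) <= 4^-1.
  elim: n => [|n IH]; first by rewrite /u/= rnorm0 invr_ge0.
  rewrite uS rnormZ hE; have := rnormD x (cmul (u n) (u n)).
  have := rnormM (u n) (u n); have := rnorm_ge0 (u n); nra.
have us n : cstar (u n) = u n.
  elim: n => [|n IH]; first by rewrite /u/= cstar0.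
  by rewrite uS cstarZ cstarD cstarM IH xs conjCR.
have ud n : rnorm (u n.+1 - u n) <= 2^-1 ^+ n.
  elim: n => [|n IH].
    rewrite expr0; apply: le_trans (rnormD _ _) _; rewrite rnormN.
    by have := ub 1%N; have := ub 0%N; lra.
  have -> : u n.+2 - u n.+1 =
      h *: (cmul (u n.+1) (u n.+1 - u n) + cmul (u n.+1 - u n) (u n)).
    rewrite cmulDr cmulNr cmulDl cmulrN addrA subrK scalerBr.
    by rewrite (uS n.+1) [X in F _ - X]uS /F -!scalerBr opprD addrACA subrr add0r.
  rewrite rnormZ hE exprS ler_wpM2l ?invr_ge0//; apply: le_trans (rnormD _ _) _.
  have := rnormM (u n.+1) (u n.+1 - u n); have := rnormM (u n.+1 - u n) (u n).
  have := ub n; have := ub n.+1; have := rnorm_ge0 (u n.+1 - u n).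
  by have := rnorm_ge0 (u n); have := rnorm_ge0 (u n.+1); nra.
have [y uy _] := rnorm_geo_cvg (N := 0) (fun n _ => ud n).
have yF : y = F y.
  apply: (@rnorm_cvg_uniq _ _ (fun n => u n.+1)); first exact: rnorm_cvgS.
  under eq_fun do rewrite uS.
  by apply: cvgZr; apply: cvgD; [exact: cvg_cst|exact: cvg_cmul].
exists y; split.
- apply: (@rnorm_cvg_uniq _ _ u) (uy); have := cvg_cstar uy.
  by under eq_fun do rewrite us.
- rewrite {1 2}yF /F -scalerDl.
  have -> : h + h = 1 by rewrite /h -rmorphD/= (_ : _ + _ = 1)//; lra.
  by rewrite scale1r addrK.
- move=> a ax; have au n : cmul a (u n) = cmul (u n) a.
    elim: n => [|n IH]; first by rewrite /u/= cmul0r cmulr0.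
    by rewrite uS cmulZr cmulDr ax cmulA IH -cmulA IH cmulA -cmulDl cmulZl.
  apply: (@rnorm_cvg_uniq _ _ (fun n => cmul a (u n))).
    by apply: cvg_cmul => //; exact: cvg_cst.
  by under eq_fun do rewrite au; apply: cvg_cmul => //; exact: cvg_cst.
Qed.

End CStar.

Section StarHom.
Variables (R : realType) (A B : cstarAlgType R) (f : A -> B).
Hypothesis fH : star_hom f.

Lemma star_homD x y : f (x + y) = f x + f y.
Proof.
have [fl _ _] := fH; pose f' : {linear A -> B} :=
  HB.pack f (GRing.isLinear.Build _ _ _ _ f fl).
exact: (linearD f').
Qed.

Lemma star_homZ c x : f (c *: x) = c *: f x.
Proof.
have [fl _ _] := fH; pose f' : {linear A -> B} :=
  HB.pack f (GRing.isLinear.Build _ _ _ _ f fl).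
exact: (linearZ_LR f').
Qed.

Lemma star_homN x : f (- x) = - f x.
Proof. by rewrite -scaleN1r star_homZ scaleN1r. Qed.

Lemma star_homB x y : f (x - y) = f x - f y.
Proof. by rewrite star_homD star_homN. Qed.

Lemma star_hom0 : f 0 = 0.
Proof. by rewrite -(scale0r 0) star_homZ scale0r. Qed.

(** If a is self-adjoint and small, then with 1 - y = sqrt (1 - a^2) the
    element a + i (1 - y) is formally unitary, and so is its image; the
    operators z |-> f a z +- i (z - f y z) make this precise without a unit. *)
Lemma star_hom_sa_le1 a : cstar a = a -> rnorm a <= 2^-1 -> rnorm (f a) <= 1.
Proof.
move=> as_ a2; have [fl fM fS] := fH.
have [||y [ys yE yc]] := @cstar_sqrt R A (cmul a a).
- by rewrite cstarM as_.
- by apply: le_trans (rnormM _ _) _; have := rnorm_ge0 a; nra.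
pose b := f a; pose w := f y.
have bs : cstar b = b by rewrite /b -fS as_.
have ws : cstar w = w by rewrite /w -fS ys.
have bb : cmul b b = w + w - cmul w w.
  by rewrite /b /w -!fM -yE star_homB star_homD fM.
have bw : cmul b w = cmul w b by rewrite /b /w -!fM yc// cmulA.
pose T (c : R[i]) z := cmul b z + c *: (z - cmul w z).
have iso (c : R[i]) z : c^* = - c -> c * c = -1 -> rnorm (T c z) = rnorm z.
  move=> cs cc; suff : rnorm (T c z) ^+ 2 = rnorm z ^+ 2.
    by move=> /eqP; rewrite eqrXn2 ?rnorm_ge0// => /eqP.
  rewrite -!rnorm_sq; congr rnorm.
  have -> : cmul (cstar (T c z)) (T c z) =
      cmul (cstar z) (cmul b (cmul b z) + (z - cmul w z) - cmul w (z - cmul w z)).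
    rewrite /T cstarD cstarZ cs cstarD cstarN !cstarM bs ws.
    have -> : cmul (cstar z) b + - c *: (cstar z - cmul (cstar z) w) =
        cmul (cstar z) b - c *: (cstar z - cmul (cstar z) w) by rewrite scaleNr.
    set zs := cstar z; set v := z - cmul w z.
    have E1 : cmul (cmul zs b) (c *: v) = c *: cmul (zs - cmul zs w) (cmul b z).
      rewrite cmulZr; congr (_ *: _); rewrite /v cmulDr cmulNr cmulDl cmulrN.
      by congr (_ - _); rewrite -!cmulA // (cmulA b) bw -cmulA.
    rewrite cmulDl cmulDr cmulrN cmulDr E1 !cmulZl cmulZr opprD addrACA.
    rewrite addrA subrK scalerA cc scaleN1r opprK.
    move: v zs {E1} => v zs.
    by rewrite cmulDl cmulrN -!cmulA 2!cmulDr cmulNr addrA.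
  congr cmul; rewrite cmulA bb cmulDl cmulDl cmulrN -cmulA cmulDr cmulNr.
  set p := cmul w z; set q := cmul w p.
  rewrite opprB -addrA [z - p + _]addrACA -opprD [z + q + _]addrC addrA.
  by rewrite [p + p - q]addrC addrK [z + q]addrC addKr.
have ii : 'i%C * 'i%C = -1 :> R[i] by rewrite -expr2 sqr_i.
have iJ : ('i%C)^* = - 'i%C :> R[i] by rewrite -conjCi.
have bz z : rnorm (cmul b z) <= rnorm z.
  have -> : cmul b z = (2^-1)%:C *: (T 'i%C z + T (- 'i%C) z).
    rewrite /T scaleNr addrACA subrr addr0 scalerDr -scalerDl -rmorphD/=.
    by rewrite (_ : _ + _ = 1) ?scale1r//; lra.
  rewrite rnormZ normcR ger0_norm ?invr_ge0//.
  have := rnormD (T 'i%C z) (T (- 'i%C) z); rewrite !iso//; first lra.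
  - by rewrite rmorphN/= iJ.
  - by rewrite mulrNN.
have := bz b; rewrite -{1}bs rnorm_sq.
by have := rnorm_ge0 b; rewrite -/b; nra.
Qed.

(** Scaling [star_hom_sa_le1] gives the factor 2 for self-adjoint elements, and
    |f a|^2 = |f (a^* a)| carries the bound over to all. *)
Lemma star_hom_bounded a : rnorm (f a) <= 2 * rnorm a.
Proof.
have sa x : cstar x = x -> rnorm (f x) <= 2 * rnorm x.
  move=> xs; have [x0|x0] := eqVneq (rnorm x) 0.
    have -> : x = 0 by apply: rnorm_le0; rewrite x0.
    by rewrite star_hom0 !rnorm0 mulr0.
  have xp : 0 < rnorm x by rewrite lt_neqAle eq_sym x0 rnorm_ge0.
  pose c := ((2 * rnorm x)^-1).
  have c0 : 0 < c by rewrite invr_gt0 mulr_gt0.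
  have cE : c * rnorm x = 2^-1 by rewrite /c invfM -mulrA mulVf// mulr1.
  have := @star_hom_sa_le1 (c%:C *: x).
  rewrite cstarZ xs conjCR star_homZ !rnormZ normcR gtr0_norm// cE lexx.
  move=> /(_ erefl isT); move: cE; have := rnorm_ge0 (f x); nra.
have [_ fM fS] := fH.
have := sa (cmul (cstar a) a); rewrite cstarM cstarK fM fS !rnorm_sq => /(_ erefl).
by have := rnorm_ge0 a; have := rnorm_ge0 (f a); nra.
Qed.

Lemma star_hom_cvg (u : nat -> A) x : u @ \oo --> x ->
  (fun n => f (u n)) @ \oo --> f x.
Proof.
move=> /rnorm_cvg_seqP ux; apply/rnorm_cvg_seqP => e e0.
have [|N HN] := ux (e / 2); first by rewrite divr_gt0.
exists N => n /HN xn; rewrite -star_homB (le_lt_trans (star_hom_bounded _))//.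
by move: xn; lra.
Qed.

End StarHom.

(** * Approximate intertwining *)

(** The induction shifts the whole sequence of algebras; this avoids transport along
    equations between indices. *)
Lemma orbit_exists (R : realType) (A : nat -> cstarAlgType R)
    (phi : forall n, A n -> A n.+1) n (a : A n) : exists x : forall m, A m,
  x n = a /\ forall m, (n <= m)%N -> x m.+1 = phi m (x m).
Proof.
elim: n => [|n IH] in A phi a *.
  by exists (nat_rect (fun m => A m) a phi).
have [x [xn xS]] := IH (fun m => A m.+1) (fun m => phi m.+1) a.
exists (fun m => match m return A m with 0 => 0 | k.+1 => x k end).
by split=> // -[//|m] /xS.
Qed.

Section Orbits.
Variables (R : realType) (A : nat -> cstarAlgType R).
Variable phi : forall n, A n -> A n.+1.

(** The composites of the connecting maps, read off from orbits. *)
Lemma orbit_map_exists : exists o : forall n m, A n -> A m,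
  [/\ forall n a, o n n a = a,
      forall n m a, (n <= m)%N -> o n m.+1 a = phi (o n m a) &
      (forall n, star_hom (@phi n)) -> forall n m, (n <= m)%N -> star_hom (o n m)].
Proof.
have H n (a : A n) := cid (orbit_exists phi a).
exists (fun n m a => sval (H n a) m).
have on n a : sval (H n a) n = a by case: (H n a) => x [].
have oS n m a : (n <= m)%N -> sval (H n a) m.+1 = phi (sval (H n a) m).
  by case: (H n a) => x [] /= _ h /h.
split=> // ph n m /subnKC <-; elim: (m - n)%N => [|k [fl fM fS]].
  rewrite addn0; split=> [c x y|x y|x]; by rewrite !on.
have nk : (n <= n + k)%N by rewrite leq_addr.
have [pl pM pS] := ph (n + k)%N.
rewrite addnS; split=> [c x y|x y|x]; rewrite !oS//.
- by rewrite fl pl.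
- by rewrite fM pM.
- by rewrite fS pS.
Qed.

End Orbits.

Section Intertwining.
Variables (R : realType) (A : nat -> cstarAlgType R).

Definition compatible (phi : forall n, A n -> A n.+1) (B : cstarAlgType R)
    (nu : forall n, A n -> B) :=
  (forall n, star_hom (nu n)) /\ forall n a, nu n.+1 (phi n a) = nu n a.

(** [L n N] holds the elements of the n-th algebra on which the two connecting
    maps are compared from stage N on; the index N is kept along both maps. *)
Definition intertwined (phi psi : forall n, A n -> A n.+1)
    (L : forall n, nat -> set (A n)) :=
  [/\ forall n, star_hom (phi n), forall n, star_hom (psi n),
      forall n N x, L n N x -> L n.+1 N (phi n x) /\ L n.+1 N (psi n x),
      forall n N x, (N <= n)%N -> L n N x ->
        rnorm (phi n x - psi n x) <= 2^-1 ^+ n.+1 &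
      forall n a (e : R), 0 < e -> exists N x, L n N x /\ rnorm (a - x) < e].

Lemma intertwined_sym phi psi L : intertwined phi psi L -> intertwined psi phi L.
Proof.
move=> [h1 h2 h3 h4 h5]; split=> // [n N x /h3[]//|n N x Nn /h4].
by rewrite rnormBC; exact.
Qed.

(** The maps nu m have different domains, so that their limit along psi is taken on
    orbits of psi. *)
Definition transfers (psi : forall n, A n -> A n.+1) (B : cstarAlgType R)
    (nu nu' : forall n, A n -> B) :=
  forall n (x : forall m, A m), (forall m, (n <= m)%N -> x m.+1 = psi m (x m)) ->
    (fun m => nu m (x m)) @ \oo --> nu' n (x n).

Lemma transfers_uniq psi B nu nu1 nu2 :
  @transfers psi B nu nu1 -> transfers psi nu nu2 -> forall n a, nu1 n a = nu2 n a.
Proof.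
move=> h1 h2 n a; have [x [xn xS]] := orbit_exists psi a.
by rewrite -xn; apply: rnorm_cvg_uniq (h1 n x xS) (h2 n x xS).
Qed.

Lemma transfers_comp psi (B C : cstarAlgType R) nu nu' (f : B -> C) :
  star_hom f -> @transfers psi B nu nu' ->
  transfers psi (fun n a => f (nu n a)) (fun n a => f (nu' n a)).
Proof. by move=> fh h n x xS; apply: star_hom_cvg => //; exact: h. Qed.

Section Transfer.
Variables (phi psi : forall n, A n -> A n.+1) (L : forall n, nat -> set (A n)).
Hypothesis pp : intertwined phi psi L.
Variables (B : cstarAlgType R) (nu : forall n, A n -> B).
Hypothesis nuP : compatible phi nu.

Lemma orbit_in (x : forall m, A m) n N : L N (x n) ->
  (forall m, (n <= m)%N -> x m.+1 = psi (x m)) -> forall m, (n <= m)%N -> L N (x m).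
Proof.
have [_ _ LS _ _] := pp; move=> xL xS m /subnKC <-.
elim: (m - n)%N => [|k IH]; first by rewrite addn0.
by rewrite addnS xS ?leq_addr//; case: (LS _ _ _ IH).
Qed.

(** As nu is compatible with phi, the difference is the image under nu of
    psi x - phi x, which is at most 2^-(m+1); nu at most doubles it. *)
Lemma transfer_geo (x : forall m, A m) n N : L N (x n) ->
  (forall m, (n <= m)%N -> x m.+1 = psi (x m)) ->
  forall m, (maxn n N <= m)%N ->
    rnorm (nu (x m.+1) - nu (x m)) <= 2^-1 ^+ m.
Proof.
have [_ _ _ Lc _] := pp; have [nh nc] := nuP.
move=> xL xS m; rewrite geq_max => /andP[nm Nm].
rewrite -(nc m) -star_homB// (le_trans (star_hom_bounded (nh _) _))//.
rewrite xS// rnormBC; have := Lc m N (x m) Nm (orbit_in xL xS nm).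
by rewrite exprS; lra.
Qed.

(** Density of the tracked elements and the uniform bound on homomorphisms turn the
    geometric convergence on the former into convergence everywhere. *)
Lemma transfer_exists : exists nu' : forall n, A n -> B,
  compatible psi nu' /\ transfers psi nu nu'.
Proof.
have [_ ph _ _ Ld] := pp; have [nh nc] := nuP.
have [o [on oS oh]] := orbit_map_exists psi; have {}oh := oh ph.
have ocvg n (a : A n) : exists l : B, (fun m => nu (o n m a)) @ \oo --> l.
  apply: rnorm_cauchy_cvg => e e0.
  have e16 : 0 < e / 16 by rewrite divr_gt0.
  have [N [x [xL ax]]] := Ld n a _ e16.
  have := @transfer_geo (fun m => o n m x) n N; rewrite on => /(_ xL).
  move=> /(_ (fun m => oS n m x)) /rnorm_geo_tele H.
  have [M HM] := @geo_small R (e / 2) (ltac:(by rewrite divr_gt0)).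
  exists (maxn (maxn n N) M) => m Km.
  have nK : (n <= maxn (maxn n N) M)%N by rewrite -maxnA leq_maxl.
  have b k : (n <= k)%N -> rnorm (nu (o n k a) - nu (o n k x)) <= 4 * (e / 16).
    move=> nk; rewrite -star_homB// (le_trans (star_hom_bounded (nh _) _))//.
    rewrite -(star_homB (oh n k nk)); have := star_hom_bounded (oh n k nk) (a - x).
    by move: ax; lra.
  move: (leq_maxl (maxn n N) M) (leq_maxr (maxn n N) M) nK Km.
  move: (maxn _ M) => K nNK MK nK Km.
  have := H K (m - K)%N nNK; rewrite subnKC//.
  have := HM K MK; have := b K nK; have := b m (leq_trans nK Km).
  have := rnorm_tri (nu (o n K a)) (nu (o n K x)) (nu (o n m a)).
  have := rnorm_tri (nu (o n K x)) (nu (o n m x)) (nu (o n m a)).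
  by rewrite (rnormBC (nu (o n m x))); lra.
have {}ocvg n a := cid (ocvg n a).
pose nu' n a := sval (ocvg n a).
have nu'P n a : (fun m => nu (o n m a)) @ \oo --> nu' n a.
  by rewrite /nu'; case: (ocvg n a).
have oU n (x : forall m, A m) : (forall m, (n <= m)%N -> x m.+1 = psi (x m)) ->
    forall m, (n <= m)%N -> x m = o n m (x n).
  move=> xS m /subnKC <-; elim: (m - n)%N => [|k IH]; first by rewrite addn0 on.
  by rewrite addnS xS ?leq_addr// oS ?leq_addr// IH.
have tr : transfers psi nu nu'.
  move=> n x xS; apply/rnorm_cvg_seqP => e.
  have /rnorm_cvg_seqP/[apply] := nu'P n (x n).
  move=> [N HN]; exists (maxn n N) => m; rewrite geq_max => /andP[nm Nm].
  by rewrite (oU n x xS m nm) HN.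
exists nu'; split=> //; split; last first.
  move=> n a; apply: (@rnorm_cvg_uniq _ _ (fun m => nu (o n m a))) => //.
  have := tr n.+1 (fun m => o n m a); rewrite oS// on.
  by apply=> m nm; rewrite oS// ltnW.
(* The limits inherit the operations termwise. *)
have pw n (u v : nat -> B) (l l' : B) : u @ \oo --> l -> v @ \oo --> l' ->
    (forall m, (n <= m)%N -> u m = v m) -> l = l'.
  move=> /rnorm_cvg_seqP ul vl uv; apply: (@rnorm_cvg_uniq _ _ v) => //.
  apply/rnorm_cvg_seqP => e /ul[N HN]; exists (maxn n N) => m.
  by rewrite geq_max => /andP[nm Nm]; rewrite -uv// HN.
move=> n; split=> [c x y|x y|x].
- apply: (pw n _ _ _ _ (nu'P n _)) => [|m nm]; last first.
    by rewrite star_homD ?star_homZ; [|exact: oh..]; rewrite star_homD ?star_homZ.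
  by apply: cvgD; [apply: cvgZr|]; exact: nu'P.
- apply: (pw n _ _ _ _ (nu'P n _)) => [|m nm]; last first.
    by have [_ hM _] := oh n m nm; have [_ hM' _] := nh m; rewrite hM hM'.
  by apply: cvg_cmul; exact: nu'P.
- apply: (pw n _ _ _ _ (nu'P n _)) => [|m nm]; last first.
    by have [_ _ hS] := oh n m nm; have [_ _ hS'] := nh m; rewrite hS hS'.
  by apply: cvg_cstar; exact: nu'P.
Qed.

(** On tracked elements nu' m differs from nu m by at most 2 * 2^-m, and along an
    orbit of phi the values of nu are constant. *)
Lemma transfer_back nu' : compatible psi nu' -> transfers psi nu nu' ->
  transfers phi nu' nu.
Proof.
have [pph ph Lpp _ Ld] := pp; have [nh nc] := nuP.
move=> [nh' nc'] tr n x xS.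
have xnu m : (n <= m)%N -> nu (x m) = nu (x n).
  move=> /subnKC <-; elim: (m - n)%N => [|k IH]; first by rewrite addn0.
  by rewrite addnS xS ?leq_addr// nc.
have [o [on oS oh]] := orbit_map_exists phi; have {}oh := oh pph.
have xo m : (n <= m)%N -> x m = o n m (x n).
  move=> /subnKC <-; elim: (m - n)%N => [|k IH]; first by rewrite addn0 on.
  by rewrite addnS xS ?leq_addr// oS ?leq_addr// IH.
apply/rnorm_cvg_seqP => e e0.
have e16 : 0 < e / 16 by rewrite divr_gt0.
have [N [y [yL ay]]] := Ld n (x n) _ e16.
have [M HM] := @geo_small R (e / 2) (ltac:(by rewrite divr_gt0)).
exists (maxn (maxn n N) M) => m; rewrite !geq_max -andbA => /and3P[nm Nm Mm].
have yLm : L N (o n m y).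
  move: nm {Nm Mm} => /subnKC <-; elim: (m - n)%N => [|k IH].
    by rewrite addn0 on.
  by rewrite addnS oS ?leq_addr//; case: (Lpp _ _ _ IH).
have h1 : rnorm (nu (o n m y) - nu' m (o n m y)) <= 2 * 2^-1 ^+ m.
  have [z [zm zS]] := orbit_exists psi (o n m y).
  have := @transfer_geo z m N; rewrite zm => /(_ yLm zS) H.
  have [l zl Hl] := @rnorm_geo_cvg R B (fun m => nu (z m)) _ H.
  have := tr m z zS; rewrite zm => /(rnorm_cvg_uniq zl) <-.
  by have := Hl m; rewrite zm; apply; rewrite geq_max leqnn.
have b : rnorm (x m - o n m y) <= 2 * (e / 16).
  rewrite (xo m nm) -(star_homB (oh n m nm)) (le_trans (star_hom_bounded (oh n m nm) _))//.
  by rewrite ler_pM2l// ltW.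
rewrite -(xnu m nm).
have := HM m Mm.
have := star_hom_bounded (nh m) (x m - o n m y).
have := star_hom_bounded (nh' m) (x m - o n m y); rewrite !star_homB//.
have := rnorm_tri (nu (x m)) (nu (o n m y)) (nu' m (x m)).
have := rnorm_tri (nu (o n m y)) (nu' m (o n m y)) (nu' m (x m)).
by rewrite (rnormBC (nu' m (o n m y))); lra.
Qed.

End Transfer.

(** Cones over phi and cones over psi correspond to each other by [transfers], in both
    directions and naturally, so the universal property is carried over. *)
Theorem inductive_limit_intertwined phi psi L (X : cstarAlgType R)
    (alpha : forall n, A n -> X) :
  intertwined phi psi L -> is_inductive_limit phi alpha ->
  exists beta : forall n, A n -> X, is_inductive_limit psi beta.
Proof.
move=> pp [ah ac aU]; have qq := intertwined_sym pp.
have [beta [bP btr]] := transfer_exists pp (conj ah ac).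
exists beta; have [bh bc] := bP; split=> // B nu nh nc.
have nuP : compatible psi nu by [].
have [nu' [nuP' tr]] := transfer_exists qq nuP.
have [nh' nc'] := nuP'.
have [f [[fh fa] fU]] := aU B nu' nh' nc'.
have fb n a : f (beta n a) = nu n a.
  apply: (transfers_uniq (transfers_comp fh btr)).
  have -> : (fun n a => f (alpha n a)) = nu'.
    by apply: functional_extensionality_dep => m; apply/funext => x.
  by apply (transfer_back qq nuP nuP' tr).
exists f; split=> // g [gh gb]; apply: fU; split=> // n a.
have tb := transfer_back pp (conj ah ac) bP btr.
apply: (transfers_uniq (transfers_comp gh tb)).
have -> // : (fun n a => g (beta n a)) = nu.
by apply: functional_extensionality_dep => m; apply/funext => x.
Qed.

End Intertwining.

(** * Paths in finite graphs *)

Section Subdivision.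
Variable R : realType.

Lemma min_seq_gt0 (T : eqType) (D : seq T) (f : T -> R) :
  (forall t, t \in D -> 0 < f t) ->
  exists2 m, 0 < m & forall t, t \in D -> m <= f t.
Proof.
elim: D => [|a D IH] fD; first by exists 1.
have [t tD|m m0 mD] := IH; first by apply: fD; rewrite in_cons tD orbT.
exists (Num.min (f a) m); first by rewrite lt_min m0 fD// mem_head.
move=> t; rewrite in_cons => /orP[/eqP ->|/mD mt]; first by rewrite ge_min lexx.
by rewrite ge_min mt orbT.
Qed.

(** Lebesgue's number lemma, for a property of subintervals of [0, 1]. *)
Lemma subdivision (P : R -> R -> Prop) :
  (forall t : R, 0 <= t <= 1 -> exists2 h : R, 0 < h & forall s s' : R, 0 <= s -> s <= s' ->
     s' <= 1 -> `|s - t| < h -> `|s' - t| < h -> P s s') ->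
  exists N : nat, forall j : nat, (j <= N)%N ->
    P (j%:R / N.+1%:R) (j.+1%:R / N.+1%:R).
Proof.
move=> H.
have {}H t : exists h, 0 < h /\ (0 <= t <= 1 -> forall s s', 0 <= s -> s <= s' ->
     s' <= 1 -> `|s - t| < h -> `|s' - t| < h -> P s s').
  have [t01|t01] := boolP (0 <= t <= 1); last by exists 1.
  by have [h h0 hP] := H t t01; exists h.
have {H} [h hP] : exists h : R -> R, forall t, 0 < h t /\ (0 <= t <= 1 ->
    forall s s', 0 <= s -> s <= s' ->
     s' <= 1 -> `|s - t| < h t -> `|s' - t| < h t -> P s s').
  by exists (fun t => sval (cid (H t))) => t; exact: svalP (cid (H t)).
have := @segment_compact R 0 1; rewrite compact_cover.
move=> /(_ R [set` `[0, 1]] (fun t => ball t (h t / 2))).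
case=> [t _|t t01|D D01 cD].
- exact: ball_open.
- by exists t => //; apply: ballxx; rewrite divr_gt0//; case: (hP t).
have [t _|m m0 mD] := @min_seq_gt0 _ (enum_fset D) (fun t => h t / 2).
  by rewrite divr_gt0//; case: (hP t).
exists (Num.bound m^-1) => j jN; set N := (Num.bound m^-1).+1.
have N0 : 0 < N%:R :> R by rewrite ltr0n.
have Nm : N%:R^-1 < m.
  rewrite -[ltRHS]invrK ltf_pV2 ?posrE ?invr_gt0//.
  have := archi_boundP (ltW (_ : 0 < m^-1)); rewrite invr_gt0 => /(_ m0).
  by move=> /lt_trans; apply; rewrite ltr_nat.
have j0 : 0 <= j%:R / N%:R :> R by rewrite divr_ge0.
have j1 : j%:R / N%:R <= 1 :> R by rewrite ler_pdivrMr// mul1r ler_nat leqW.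
have [t /= tD] : cover [set` D] (fun t => ball t (h t / 2)) (j%:R / N%:R).
  by apply: cD; rewrite /= in_itv/= j0.
rewrite -ball_normE /ball_/= => tj.
have t01 : 0 <= t <= 1 by have /D01 := tD; rewrite inE /= in_itv.
have mt : m <= h t / 2 by apply: mD.
have [h0 /(_ t01)] := hP t; apply => //.
- by rewrite ler_pM2r ?invr_gt0// ler_nat.
- by rewrite ler_pdivrMr// mul1r ler_nat.
- by rewrite distrC (lt_le_trans tj)//; move: h0; lra.
- have -> : j.+1%:R / N%:R - t = (j%:R / N%:R - t) + N%:R^-1.
    by rewrite -natr1 mulrDl mul1r addrAC.
  apply: le_lt_trans (ler_normD _ _) _; rewrite distrC.
  rewrite [X in _ + X]ger0_norm ?invr_ge0 ?ler0n//.
  by move: tj mt Nm; lra.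
Qed.

(** The intervals of a [subdivision] are joined one after the other. *)
Lemma interval_chaining (P : R -> R -> Prop) :
  (forall t : R, 0 <= t <= 1 -> exists2 h : R, 0 < h & forall s s' : R, 0 <= s -> s < s' ->
     s' <= 1 -> `|s - t| < h -> `|s' - t| < h -> P s s') ->
  (forall s u t : R, 0 <= s -> s < u -> u < t -> t <= 1 -> P s u -> P u t -> P s t) ->
  P 0 1.
Proof.
move=> Ploc Pcat; have [t t01|N HN] := @subdivision (fun s s' => s < s' -> P s s').
  have [h h0 hP] := Ploc t t01; exists h => // s s' s0 _ s1 st st' ss'.
  exact: hP.
have N0 : 0 < N.+1%:R :> R by rewrite ltr0n.
have lt j : j%:R / N.+1%:R < j.+1%:R / N.+1%:R :> R.
  by rewrite ltr_pM2r ?invr_gt0// ltr_nat.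
suff : forall j, (j <= N)%N -> P 0 (j.+1%:R / N.+1%:R).
  by move=> /(_ N (leqnn N)); rewrite divff ?gt_eqF.
elim=> [_|j IH jN]; first by have := HN 0 isT (lt 0); rewrite mul0r.
apply: (Pcat _ (j.+1%:R / N.+1%:R)) => //.
- by rewrite divr_gt0// ltr0n.
- by rewrite ler_pdivrMr// mul1r ler_nat.
- by apply: IH; exact: ltnW.
- exact: HN.
Qed.

End Subdivision.

Section Clamp.
Variable R : realType.

Definition clamp (t : R) : R := Num.max 0 (Num.min t 1).

Lemma clamp_itv t : 0 <= clamp t <= 1.
Proof. by rewrite /clamp le_max lexx ge_max ler01/= ge_min lexx orbT. Qed.

Lemma clampE t : 0 <= t <= 1 -> clamp t = t.
Proof. by move=> /andP[t0 t1]; rewrite /clamp min_l// max_r. Qed.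

Lemma clamp_lip (s t : R) : `|clamp t - clamp s| <= `|t - s|.
Proof.
have h (u v : R) : u <= v -> clamp u <= clamp v /\ clamp v - clamp u <= v - u.
  move=> uv; rewrite /clamp.
  case: (leP u 1) => ?; case: (leP v 1) => ?;
    rewrite ?(max_r ler01); case: (leP 0 u) => ?; case: (leP 0 v) => ?; split; lra.
have [/h[]|/ltW/h[]] := leP s t => h1 h2.
  by rewrite !ger0_norm// subr_ge0// -subr_ge0 (le_trans _ h2)// subr_ge0.
rewrite distrC [leRHS]distrC !ger0_norm// subr_ge0//.
by rewrite -subr_ge0 (le_trans _ h2)// subr_ge0.
Qed.

Lemma clamp_continuous : continuous clamp.
Proof.
move=> t; apply/cvgrPdist_lt => h h0; apply/nbhs_ballP; exists h => //= s.
by apply: le_lt_trans; exact: clamp_lip.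
Qed.

Lemma continuous_clamp (X : topologicalType) (e : R -> X) :
  {within `[0, 1], continuous e} -> continuous (e \o clamp).
Proof.
move=> /subspace_continuousP ce t A.
have /ce ect : [set` `[0, 1 : R]] (clamp t) by rewrite /= in_itv/= clamp_itv.
move=> /ect; rewrite nbhs_simpl /within /= => /clamp_continuous.
move=> H; have {}H : \forall s \near t, clamp s \in `[0, 1] -> A (e (clamp s)) := H.
suff : \forall s \near t, A (e (clamp s)) by [].
by apply: filterS H => s; apply; rewrite in_itv/= clamp_itv.
Qed.

End Clamp.

Section Graph.
Variables (R : realType) (X : ndgraph R).

Lemma graph_hausdorff : hausdorff_space X.
Proof. by case: (ndgraph_graph X). Qed.

Lemma graph_closed1 (x : X) : closed [set x].
Proof. exact/accessible_closed_set1/hausdorff_accessible/graph_hausdorff. Qed.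

(** The characteristic maps of the 1-cells, extended to the real line by
    constants so that they are continuous in the ordinary sense. *)
Record cells (V : set X) (E : finType) (e : E -> R -> X) : Prop := {
  cells_fin : finite_set V ;
  cells_continuous : forall k, continuous (e k) ;
  cells_end : forall k, V (e k 0) /\ V (e k 1) ;
  cells_inj : forall k k' (t t' : R), 0 < t < 1 -> 0 < t' < 1 ->
    e k t = e k' t' -> k = k' /\ t = t' ;
  cells_interior : forall k (t : R), 0 < t < 1 -> ~ V (e k t) ;
  cells_surj : forall x, exists k (t : R), 0 <= t <= 1 /\ x = e k t }.

Lemma compact_edge (e : R -> X) (A : set R) :
  continuous e -> closed A -> compact (e @` (`[0, 1] `&` A)).
Proof.
move=> ce cA; apply: continuous_compact; first exact: continuous_subspaceT.
by apply: compact_closedI => //; exact: segment_compact.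
Qed.

(** A vertex outside all closed edges would be isolated, against connectedness. *)
Lemma graph_cells : exists V E e, @cells V E e.
Proof.
have [_ [V [E [e [finV ce eV einj eVC]]]]] := ndgraph_graph X.
pose e' k := e k \o @clamp R.
have e'E k t : 0 <= t <= 1 -> e' k t = e k t by move=> t01; rewrite /e'/= clampE.
have i01 (t : R) : 0 < t < 1 -> 0 <= t <= 1 by move=> /andP[/ltW-> /ltW->].
have e'c k : continuous (e' k) by exact: continuous_clamp.
exists V, E, e'; split=> //.
- by move=> k; rewrite !e'E ?lexx ?ler01.
- by move=> k k' t t' t1 t'1; rewrite !e'E; [exact: einj|exact: i01..].
- by move=> k t t1; rewrite e'E ?i01//; apply/eVC; exists k, t.
move=> x; apply: contrapT => xe.
have nV y : ~ V y -> exists k t, 0 <= t <= 1 /\ y = e' k t.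
  by move=> /eVC[k [t [t1 ->]]]; exists k, t; rewrite e'E ?i01.
pose W := (V `\ x) `|` \big[setU/set0]_(k : E) (e' k @` (`[0, 1] `&` setT)).
have cW : closed W.
  apply: compact_closed; first exact: graph_hausdorff.
  apply: compactU; first exact/finite_compact/finite_setD.
  by apply: bigsetU_compact => k _; apply: compact_edge => //; exact: closedT.
have WE : W = ~` [set x].
  apply/seteqP; split=> [y [[_ //]|]|y yx].
    rewrite -bigcup_seq => -[k _ [t [t01 _] <-]] /= yx; apply: xe.
    by exists k, t; split => //; move: t01; rewrite /= in_itv.
  have [Vy|/nV[k [t [t01 yE]]]] := pselect (V y); first by left.
  right; rewrite -bigcup_seq; exists k; first by rewrite /= mem_index_enum.
  by exists t; rewrite /= ?in_itv.
have : [set x] = [set: X].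
  apply: (@ndgraph_connected R X); first by exists x.
    by exists (~` W); [exact: closed_openC|rewrite WE setCK setTI].
  by exists [set x]; [exact: graph_closed1|rewrite setTI].
have [y [z yz]] := ndgraph_nondegenerate X.
move=> xT; apply: yz; transitivity x.
  by have : [set: X] y by []; rewrite -xT.
by have : [set: X] z by []; rewrite -xT.
Qed.

Section Cells.
Variables (V : set X) (E : finType) (e : E -> R -> X).
Hypothesis eP : cells V e.

Lemma cells_vertex k (t : R) : 0 <= t <= 1 -> V (e k t) -> t = 0 \/ t = 1.
Proof.
move=> /andP[t0 t1] Vt; have [->|tn0] := eqVneq t 0; first by left.
have [->|tn1] := eqVneq t 1; first by right.
by case: (cells_interior eP (k := k) (t := t)) => //; rewrite !lt_neqAle eq_sym tn0 tn1 t0.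
Qed.

(** An edge may be a loop, hence is injective only away from one of its ends. *)
Lemma cells_half_inj k (t t' : R) : 0 <= t <= 1 -> 0 <= t' <= 1 ->
  (t < 1 /\ t' < 1) \/ (0 < t /\ 0 < t') -> e k t = e k t' -> t = t'.
Proof.
move=> t01 t'01 h ee.
have [V0 V1] := cells_end eP k.
have aux (s : R) : 0 <= s <= 1 -> ~ V (e k s) -> 0 < s < 1.
  move=> /andP[s0 s1] nV; rewrite !lt_neqAle s0 s1 !andbT.
  by apply/andP; split; apply/eqP => sE; apply: nV; [rewrite -sE|rewrite sE].
have [Vt|nVt] := pselect (V (e k t)); last first.
  have nVt' : ~ V (e k t') by rewrite -ee.
  by have [] := cells_inj eP (aux _ t01 nVt) (aux _ t'01 nVt') ee.
have Vt' : V (e k t') by rewrite -ee.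
have [] := cells_vertex t01 Vt; have [] := cells_vertex t'01 Vt'.
all: by case: h => -[? ?] ? ?; lra.
Qed.

(** Finitely many compact edges cover the graph, so that it carries their quotient
    topology. *)
Lemma cells_continuousP (T : topologicalType) (f : X -> T) :
  (forall k, {within `[0, 1], continuous (f \o e k)}) -> continuous f.
Proof.
move=> fe; apply/continuous_closedP => A cA.
suff -> : f @^-1` A = \big[setU/set0]_(k : E)
    (e k @` (`[0, 1] `&` ((f \o e k \o @clamp R) @^-1` A))).
  apply: compact_closed; first exact: graph_hausdorff.
  apply: bigsetU_compact => k _; apply: compact_edge; first exact: cells_continuous eP k.
  by have /continuous_closedP := continuous_clamp (fe k); apply.
apply/seteqP; split=> [x Ax|x].
  have [k [t [t01 xE]]] := cells_surj eP x.
  rewrite -bigcup_seq; exists k; first by rewrite /= mem_index_enum.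
  by exists t => //; split; rewrite /= ?in_itv// clampE// -xE.
rewrite -bigcup_seq => -[k _ [t [/= t01]]].
have {}t01 : 0 <= t <= 1 by move: t01; rewrite in_itv.
by rewrite clampE// => Ax <-.
Qed.

End Cells.

(** Different arcs may overlap. *)
Record star (p : X) (L : finType) (a : L -> R -> X) : Prop := {
  star_continuous : forall l, continuous (a l) ;
  star_inj : forall l (t t' : R), 0 <= t <= 1 -> 0 <= t' <= 1 -> a l t = a l t' -> t = t' ;
  star_center : forall l, a l 0 = p ;
  star_arc : inhabited L }.

Definition star_set (L : finType) (a : L -> R -> X) : set X :=
  [set x | exists l (t : R), 0 <= t <= 1 /\ x = a l t].

Lemma star_compact p (L : finType) (a : L -> R -> X) :
  star p a -> compact (star_set a).
Proof.
move=> aP; have -> : star_set a =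
    \big[setU/set0]_(l : L) (a l @` (`[0, 1] `&` setT)).
  rewrite -bigcup_seq; apply/seteqP; split=> [x [l [t [t01 ->]]]|x [l _ [t [t01 _] <-]]].
    by exists l; [rewrite /= mem_index_enum|exists t => //; rewrite /= in_itv].
  by exists l, t; split=> //; move: t01; rewrite /= in_itv.
apply: bigsetU_compact => l _; apply: compact_edge; last exact: closedT.
exact: star_continuous aP l.
Qed.

(** The arcs are the germs of edges at p: each edge passing through p contributes one
    arc for each direction in which it can be continued inside [0, 1]. A common
    length d keeps them inside N; the points of the graph that are farther than d
    from p along every edge form a compact set without p. *)
Lemma graph_star (p : X) (N : set X) : nbhs p N ->
  exists (L : finType) (a : L -> R -> X),
    [/\ star p a, star_set a `<=` N & nbhs p (star_set a)].
Proof.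
move=> Np; have [V [E [e eP]]] := graph_cells.
(* The boolean is the direction, true for increasing parameters. *)
pose germ (l : E * bool) := exists t : R,
  [/\ 0 <= t <= 1, e l.1 t = p & if l.2 then t < 1 else 0 < t].
pose L : finType := {l : E * bool | `[< germ l >]}.
pose mkL l (gl : `[< germ l >]) : L := exist (fun l => `[< germ l >]) l gl.
have tau0 (l : L) : exists t : R,
    [/\ 0 <= t <= 1, e (val l).1 t = p & if (val l).2 then t < 1 else 0 < t].
  by case: l => l gl; move/asboolP : (gl).
pose tau l := sval (cid (tau0 l)).
have tauP l : [/\ 0 <= tau l <= 1, e (val l).1 (tau l) = p &
  if (val l).2 then tau l < 1 else 0 < tau l] by exact: (svalP (cid (tau0 l))).
have [d d0 dP] : exists2 d : R, 0 < d & forall l : L,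
    (forall t, `|tau l - t| <= d -> N (e (val l).1 t)) /\
    if (val l).2 then tau l + d < 1 else 0 < tau l - d.
  have H (l : L) : exists d : R, 0 < d /\
      ((forall t, `|tau l - t| < d -> N (e (val l).1 t)) /\
       if (val l).2 then tau l + d <= 1 else 0 <= tau l - d).
    have [t01 tE tD] := tauP l.
    have : \forall t \near tau l, N (e (val l).1 t).
      have ec := cells_continuous eP (k := (val l).1) (x := tau l).
      by apply: (ec N); rewrite tE.
    move=> /nbhs_ballP[h /= h0 hN].
    exists (Num.min h (if (val l).2 then 1 - tau l else tau l)); split.
      by rewrite lt_min h0/=; case: ((val l).2) tD => //; rewrite subr_gt0.
    split=> [t|]; first by rewrite lt_min => /andP[th _]; apply: hN; rewrite -ball_normE.
    case: ((val l).2) tD => _; last by rewrite subr_ge0 ge_min lexx orbT.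
    by rewrite -lerBrDl ge_min lexx orbT.
  have {}H l := cid (H l).
  have [l _|m m0 mP] := @min_seq_gt0 R _ (enum L) (fun l => sval (H l)).
    by case: (H l) => d [].
  exists (m / 2); first by rewrite divr_gt0.
  move=> l; have := mP l (mem_enum L l); case: (H l) => d /= [d0 [dN dd]] md.
  split=> [t tm|]; first by apply: dN; move: tm m0 md; lra.
  by case: ((val l).2) dd; move: m0 md; lra.
pose dir (l : L) : R := if (val l).2 then d else - d.
pose a (l : L) (t : R) := e (val l).1 (tau l + dir l * t).
have itv l t : 0 <= t <= 1 -> [/\ 0 <= tau l + dir l * t <= 1,
    `|tau l - (tau l + dir l * t)| <= d &
    if (val l).2 then tau l + dir l * t < 1 else 0 < tau l + dir l * t].
  move=> /andP[t0 t1]; have [/andP[a0 a1] _ _] := tauP l; have [_] := dP l.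
  rewrite opprD addrA subrr add0r normrN normrM (ger0_norm t0) /dir.
  case: ((val l).2) => hd; rewrite ?normrN (gtr0_norm d0);
    by split; first (apply/andP; split); nra.
have Lne : inhabited L.
  have [k [t [t01 pE]]] := cells_surj eP p.
  have [t1|t1] := ltP t 1.
    have gl : `[< germ (k, true) >] by apply/asboolP; exists t.
    exact: (inhabits (mkL _ gl)).
  have gl : `[< germ (k, false) >] by apply/asboolP; exists t; split=> //=; move: t1; lra.
  exact: (inhabits (mkL _ gl)).
have aP : star p a.
  split=> //.
  - move=> l t; apply: (@continuous_comp _ _ _ (fun t => tau l + dir l * t) (e (val l).1)).
      by apply: cvgD; [exact: cvg_cst|apply: cvgMr; exact: cvg_id].
    exact: cells_continuous eP _ _.
  - move=> l t t' t01 t'01 /(cells_half_inj eP) H.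
    have [h1 _ h1'] := itv l t t01; have [h2 _ h2'] := itv l t' t'01.
    have : tau l + dir l * t = tau l + dir l * t'.
      by apply: H => //; case: ((val l).2) h1' h2'; [left|right].
    move=> /addrI; apply: mulfI; rewrite /dir.
    by case: ((val l).2); rewrite ?oppr_eq0 gt_eqF.
  - by move=> l; rewrite /a mulr0 addr0; case: (tauP l).
exists L, a; split=> //.
  by move=> x [l [t [/itv-/(_ l)[_ h _] ->]]]; case: (dP l) => + _; apply.
pose far k : set R := [set t | forall t' : R, 0 <= t' <= 1 -> e k t' = p -> d <= `|t' - t|].
pose W := (V `\ p) `|` \big[setU/set0]_(k : E) (e k @` (`[0, 1] `&` far k)).
have cfar k : closed (far k).
  have -> : far k = \bigcap_(t' in [set t' | 0 <= t' <= 1 /\ e k t' = p])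
      ~` (ball t' d).
    apply/seteqP; split=> [t ft t' [h1 h2]|t ft t' h1 h2].
      by rewrite /= -ball_normE /ball_/= => /lt_geF; rewrite ft.
    have /= := ft t' (conj h1 h2); rewrite -ball_normE /ball_/=.
    by move/negP; rewrite -leNgt.
  by apply: closed_bigI => t' _; apply: open_closedC; exact: ball_open.
have cW : closed W.
  apply: compact_closed; first exact: graph_hausdorff.
  apply: compactU; first exact/finite_compact/finite_setD/(cells_fin eP).
  apply: bigsetU_compact => k _; apply: compact_edge => //.
  exact: cells_continuous eP k.
have pW : ~ W p.
  move=> [[_ /(_ erefl)]//|]; rewrite -bigcup_seq => -[k _ [t [t01 ft] tp]].
  have {}t01 : 0 <= t <= 1 by move: t01; rewrite /= in_itv.
  by have := ft t t01 tp; rewrite subrr normr0 leNgt d0.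
have : nbhs p (~` W) by apply: open_nbhs_nbhs; split=> //; exact: closed_openC.
apply: filterS => x Wx.
have [xp|xp] := pselect (x = p).
  have [l] := Lne; exists l, 0; rewrite lexx ler01; split=> //.
  by rewrite (star_center aP).
have [k [t [t01 xE]]] := cells_surj eP x.
have nft : ~ far k t.
  move=> ft; apply: Wx; right; rewrite -bigcup_seq.
  by exists k; [rewrite /= mem_index_enum|exists t => //; split=> //; rewrite /= in_itv].
have [t' [t'01 t'p tt']] : exists t', [/\ 0 <= t' <= 1, e k t' = p & `|t' - t| < d].
  apply: contrapT => H; apply: nft => t' t'01 t'p; rewrite leNgt; apply/negP => tt'.
  by apply: H; exists t'.
have tnt' : t' != t by apply/eqP => tE; apply: xp; rewrite xE -tE.
pose sg := t' < t.
have gl : `[< germ (k, sg) >].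
  apply/asboolP; exists t'; split=> //=; rewrite /sg.
  by case: ltgtP tnt' t01 t'01 => // h _; [|]; lra.
pose l := mkL _ gl.
have tauE : tau l = t'.
  have [h1 h2 h3] := tauP l; apply: (cells_half_inj eP (k := k)) => //.
    rewrite /= in h3; move/asboolP : (gl) => [t2 [h4 h5 h6]].
    have : if sg then t' < 1 else 0 < t'.
      by rewrite /sg; case: ltgtP tnt' t01 t'01 => // h _; [|]; lra.
    by case: (sg) h3; [left|right].
  by rewrite h2.
exists l, (`|t' - t| / d); split.
  by rewrite divr_ge0 ?(ltW d0)//= ler_pdivrMr// mul1r ltW.
rewrite /a tauE xE /dir /= /sg; congr (e k _).
case: (ltP t' t) => h; rewrite ?mulNr mulrC divfK ?gt_eqF//.
  by rewrite ltr0_norm ?subr_lt0// opprB addrC subrK.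
by rewrite ger0_norm ?subr_ge0// subKr.
Qed.

End Graph.

(** * Matrix-valued functions on graphs *)

Section MatFun.
Variables (R : realType) (I : finType) (Z : I -> ndgraph R) (r : I -> nat).
Local Notation normc := (@Normc.normc R).
Local Notation A := (matfun Z r).

Lemma rnorm_matfun (a : A) : rnorm a = supnorm a.
Proof. by []. Qed.

Definition ev (a : A) (x : {i : I & Z i}) : 'M[R[i]]_(r (tag x)) :=
  a (tag x) (tagged x).

Lemma real_complex_continuous (T : topologicalType) (f : T -> R) :
  continuous f -> continuous (fun z => (f z)%:C : R[i]).
Proof.
move=> cf z; apply/cvgcP => e e0; have /cvgrPdist_lt/(_ e e0) := cf z.
by apply: filterS => w; rewrite -(rmorphB (@real_complex R)) normcR.
Qed.

Lemma scalar_cont (f : forall i, Z i -> R) (B : forall i, 'M[R[i]]_(r i)) :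
  (forall i, continuous (f i)) ->
  forall i, continuous (fun z => (f i z)%:C *: B i).
Proof.
move=> cf i; apply/mx_continuousP => k l z; rewrite /continuous_at.
under eq_fun do rewrite mxE; rewrite mxE.
by apply: cvgM; [exact: real_complex_continuous|exact: cvg_cst].
Qed.

Definition scalar_fun f B (cf : forall i, continuous (f i)) : A :=
  MatFun (@scalar_cont f B cf).

Lemma opnorm_le_entries m n (M : 'M[R[i]]_(m, n)) (c : R) :
  (forall k l, normc (M k l) <= c) -> opnorm M <= (m * n)%:R * c.
Proof.
move=> H; apply: le_trans (opnorm_le_entsum _) _.
apply: (@le_trans _ _ (\sum_(k < m) \sum_(l < n) c)).
  by apply: ler_sum => k _; apply: ler_sum => l _.
by rewrite !sumr_const !card_ord -mulrnA mulr_natl mulnC.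
Qed.

Definition rounding (M : nat) (z : R[i]) : int * int :=
  (Num.floor (complex.Re z * M.+1%:R), Num.floor (complex.Im z * M.+1%:R)).

Lemma rounding_close M z w : rounding M z = rounding M w ->
  normc (z - w) <= 2 * M.+1%:R^-1.
Proof.
have M0 : 0 < M.+1%:R :> R by rewrite ltr0n.
have H (a b : R) : Num.floor (a * M.+1%:R) = Num.floor (b * M.+1%:R) ->
    `|a - b| <= M.+1%:R^-1.
  move=> ab; rewrite -(ler_pM2r M0) mulVf ?gt_eqF// -{1}(gtr0_norm M0) -normrM.
  rewrite mulrBl; have := floor_itv (a * M.+1%:R); have := floor_itv (b * M.+1%:R).
  rewrite ab intrD => /andP[h1 h2] /andP[h3 h4]; rewrite ler_norml.
  by apply/andP; split; lra.
move=> [/H h1 /H h2]; apply: le_trans (normc_le_ReIm _) _.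
by rewrite !raddfB/= mulr_natl mulr2n lerD.
Qed.

(** Functions with the same rounded values on a fine enough net of the edges
    are uniformly close, so choosing one function for each table of rounded
    values gives a dense sequence. *)
Theorem matfun_separable : exists d : nat -> A,
  forall a (e : R), 0 < e -> exists k, supnorm (a - d k) < e.
Proof.
have cells_i i : exists E : finType, exists e : E -> R -> Z i,
    (forall k, continuous (e k)) /\ forall x, exists k (t : R), 0 <= t <= 1 /\ x = e k t.
  have [V [E [e eP]]] := graph_cells (Z i); exists E, e.
  by split; [exact: cells_continuous eP|exact: cells_surj eP].
pose E i := sval (cid (cells_i i)).
have H i := cid (svalP (cid (cells_i i))).
pose e i : E i -> R -> Z i := sval (H i).
have ec i k : continuous (@e i k) by case: (svalP (H i)) => + _; exact.
have es i x : exists k (t : R), 0 <= t <= 1 /\ x = @e i k t.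
  by case: (svalP (H i)) => _; exact.
pose T N : finType := {k : {i : I & E i} & ('I_N.+1 * ('I_(r (tag k)) * 'I_(r (tag k))))%type}.
pose code : countType := {N : nat & {ffun T N -> int * int}}.
(* A code consists of the fineness N of a net on the edges and a table of rounded
   values at its nodes; a good function has this table and oscillates little
   between neighbouring nodes. *)
pose osc (a : A) N (c : R) := forall i (k : E i) (j : nat), (j <= N)%N ->
  forall t : R, j%:R / N.+1%:R <= t <= j.+1%:R / N.+1%:R -> forall p q,
  normc (a i (e i k (j%:R / N.+1%:R)) p q - a i (e i k t) p q) <= c.
pose table (a : A) M N : {ffun T N -> int * int} := [ffun x : T N =>
  rounding M (a _ (e _ (tagged (tag x)) ((nat_of_ord (tagged x).1)%:R / N.+1%:R))
    (tagged x).2.1 (tagged x).2.2)].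
pose good (M : nat) (c : code) (a : A) :=
  osc a (tag c) M.+1%:R^-1 /\ table a M (tag c) = tagged c.
have osc_ex a M : exists N, osc a N M.+1%:R^-1.
  have [|N HN] := @subdivision R (fun s s' => forall t, s <= t <= s' ->
      forall i (k : E i) p q, normc (a i (e i k s) p q - a i (e i k t) p q) <= M.+1%:R^-1).
    move=> t t01; have M2 : 0 < M.+1%:R^-1 / 2 :> R by rewrite divr_gt0// invr_gt0.
    have H1 i (k : E i) p q : \forall s \near t,
        normc (a i (e i k t) p q - a i (e i k s) p q) < M.+1%:R^-1 / 2.
      have /mx_continuousP/(_ p q) ca := @mf_continuous _ _ _ _ a i.
      have /cvgcP/(_ _ M2) := @continuous_comp _ _ _ (e i k) _ t (@ec i k t) (ca _).
      exact.
    pose S : finType := {k : {i : I & E i} & ('I_(r (tag k)) * 'I_(r (tag k)))%type}.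
    have /nbhs_ballP[h /= h0 hP'] : \forall s \near t, forall x : S,
        normc (a _ (e _ (tagged (tag x)) t) (tagged x).1 (tagged x).2 -
               a _ (e _ (tagged (tag x)) s) (tagged x).1 (tagged x).2) < M.+1%:R^-1 / 2.
      by apply: (@filter_forall _ S _ (nbhs t)) => x; exact: H1.
    have hP s : ball t h s -> forall i (k : E i) p q,
        normc (a i (e i k t) p q - a i (e i k s) p q) < M.+1%:R^-1 / 2.
      by move=> /hP' th i k p q; exact: (th (existT _ (existT _ i k) (p, q))).
    exists h => // s s' s0 ss' s1 st s't u /andP[su us'] i k p q.
    have ht : normc (a i (e i k t) p q - a i (e i k s) p q) < M.+1%:R^-1 / 2.
      by apply: hP; rewrite -ball_normE /ball_/= distrC.
    have hu : normc (a i (e i k t) p q - a i (e i k u) p q) < M.+1%:R^-1 / 2.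
      apply: hP; rewrite -ball_normE /ball_/=.
      by move: st s't; rewrite !ltr_norml => /andP[? ?] /andP[? ?]; apply/andP; split; lra.
    have -> : a i (e i k s) p q - a i (e i k u) p q =
      (a i (e i k t) p q - a i (e i k u) p q) - (a i (e i k t) p q - a i (e i k s) p q).
      by ring.
    apply: le_trans (ler_normcD _ _) _; rewrite normcN.
    by rewrite [leRHS]splitr lerD ?ltW.
  by exists N => i k j jN t tj p q; exact: HN.
have [d dP] : exists d : nat * code -> A, forall M c,
    (exists a, good M c a) -> good M c (d (M, c)).
  have D (x : nat * code) : exists b : A, (exists a, good x.1 x.2 a) -> good x.1 x.2 b.
    by have [[a ga]|nex] := pselect (exists a, good x.1 x.2 a); [exists a|exists 0].
  by exists (fun x => sval (cid (D x))) => M c; exact: (svalP (cid (D (M, c)))).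
exists (fun n : nat => odflt 0 (omap d (choice.unpickle n))) => a c c0.
pose K : R := \sum_i (r i * r i)%:R.
have K0 : 0 <= K by exact: sumr_ge0.
have Kr i : ((r i * r i)%:R : R) <= K by rewrite /K (bigD1 i)//= lerDl sumr_ge0.
have [M HM] : exists M, K * (4 * M.+1%:R^-1) < c.
  have c4 : 0 <= 4 * K / c by rewrite divr_ge0 ?mulr_ge0// ltW.
  exists (Num.bound (4 * K / c)); have := archi_boundP c4.
  set M := Num.bound _ => h; rewrite mulrA [K * _]mulrC ltr_pdivrMr ?ltr0n//.
  by move: h; rewrite ltr_pdivrMr// => /lt_trans; apply; rewrite mulrC ltr_pM2l// ltr_nat.
have [N aN] := osc_ex a M.
pose cd : code := existT _ N (table a M N).
have /(dP M cd) : exists a, good M cd a by exists a.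
set b := d (M, cd) => -[bN bT].
exists (choice.pickle (M, cd)); rewrite choice.pickleK/= -/b.
apply: le_lt_trans HM; apply: supnorm_le => [|i z].
  by rewrite mulr_ge0// mulr_ge0// invr_ge0.
apply: le_trans (ler_wpM2r _ (Kr i)); last by rewrite mulr_ge0// invr_ge0.
apply: opnorm_le_entries => p q.
have [k [t [/andP[t0 t1] ->]]] := es i z.
have N0 : 0 < N.+1%:R :> R by rewrite ltr0n.
have [j jN tj] : exists2 j, (j <= N)%N & j%:R / N.+1%:R <= t <= j.+1%:R / N.+1%:R.
  have [->|tn1] := eqVneq t 1.
    by exists N => //; rewrite divff ?gt_eqF// lexx andbT ler_pdivrMr// mul1r ler_nat.
  have tN : 0 <= t * N.+1%:R by rewrite mulr_ge0.
  have := floor_itv (t * N.+1%:R); have := floor_ge0 (t * N.+1%:R); rewrite tN.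
  case: (Num.floor _) => // j _ /andP[h1 h2].
  exists j.
    rewrite -ltnS -(ltr_nat R); apply: le_lt_trans h1 _.
    by rewrite gtr_pMl// lt_neqAle tn1.
  rewrite ler_pdivrMr// ler_pdivlMr// h1/= ltW// (lt_le_trans h2)//.
  by rewrite -natr1 intrD.
have h1 := aN i k j jN t tj p q; have h2 := bN i k j jN t tj p q.
have jN' : (j < N.+1)%N by [].
pose x0 : T N := existT _ (existT _ i k) (Ordinal jN', (p, q)).
have := congr1 (fun f : {ffun T N -> int * int} => f x0) (esym bT).
rewrite !ffunE /=.
move=> /rounding_close; rewrite !mxE.
set x := a i _ p q in h1 *; set y := b i _ p q in h2 *.
move=> h3.
have -> : a i (e i k t) p q - b i (e i k t) p q =
  (x - y) - ((x - a i (e i k t) p q) - (y - b i (e i k t) p q)) by ring.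
apply: le_trans (ler_normcD _ _) _; rewrite normcN.
have -> : 4 * M.+1%:R^-1 = 2 * M.+1%:R^-1 + (M.+1%:R^-1 + M.+1%:R^-1) :> R by ring.
apply: lerD => //; apply: le_trans (ler_normcD _ _) _.
by rewrite normcN; apply: lerD.
Qed.

End MatFun.

(** * Paths of unitary matrices *)

Section MatrixAlgebra.
Variable C : numClosedFieldType.

Lemma adjM m n p (M : 'M[C]_(m, n)) (N : 'M[C]_(n, p)) :
  (M *m N)^t* = N^t* *m M^t*.
Proof. by rewrite trmx_mul map_mxM. Qed.

Lemma adjD m n (M N : 'M[C]_(m, n)) : (M + N)^t* = M^t* + N^t*.
Proof. by rewrite linearD map_mxD. Qed.

Lemma adjB m n (M N : 'M[C]_(m, n)) : (M - N)^t* = M^t* - N^t*.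
Proof. by rewrite linearB map_mxB. Qed.

Lemma adj0 m n : (0 : 'M[C]_(m, n))^t* = 0.
Proof. by rewrite trmx0 map_mx0. Qed.

Lemma adj1 n : (1%:M : 'M[C]_n)^t* = 1%:M.
Proof. by rewrite trmx1 map_mx1. Qed.

Lemma adjZ m n (c : C) (M : 'M[C]_(m, n)) : (c *: M)^t* = c^* *: M^t*.
Proof. by rewrite linearZ map_mxZ. Qed.

Lemma adj_sum m n (J : Type) (s : seq J) (P : pred J) (F : J -> 'M[C]_(m, n)) :
  (\sum_(j <- s | P j) F j)^t* = \sum_(j <- s | P j) (F j)^t*.
Proof. by apply: (big_morph (fun M : 'M[C]_(m, n) => M^t*)); [exact: adjD|exact: adj0]. Qed.

Lemma adj_delta m n (k : 'I_m) (l : 'I_n) :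
  (delta_mx k l : 'M[C]_(m, n))^t* = delta_mx l k.
Proof.
apply/matrixP => p q; rewrite !mxE andbC.
by case: (_ && _); rewrite ?conjC1 ?conjC0.
Qed.

(** Functional calculus: [fcal f] is f (H), for an arbitrary f, since only its values
    at the eigenvalues d enter. *)
Section Calculus.
Variables (n : nat) (H Q : 'M[C]_n) (d : 'rV[C]_n).
Hypothesis Qu : Q \is unitarymx.
Hypothesis HE : H = Q^t* *m diag_mx d *m Q.

Definition fcal (f : C -> C) : 'M[C]_n :=
  Q^t* *m diag_mx (\row_k f (d 0 k)) *m Q.

Lemma spectralQ : Q *m Q^t* = 1%:M.
Proof. exact/unitarymxP. Qed.

Lemma spectralQ' : Q^t* *m Q = 1%:M.
Proof. exact: mulmx1C spectralQ. Qed.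

Lemma eq_fcal f g : (forall k, f (d 0 k) = g (d 0 k)) -> fcal f = fcal g.
Proof.
move=> fg; rewrite /fcal; have E : \row_k f (d 0 k) = \row_k g (d 0 k).
  by apply/rowP => k; rewrite !mxE.
by rewrite E.
Qed.

Lemma fcal_id : fcal id = H.
Proof.
have E : \row_k id (d 0 k) = d by apply/rowP => k; rewrite !mxE.
by rewrite /fcal HE E.
Qed.

Lemma fcal_one : fcal (fun=> 1) = 1%:M.
Proof.
rewrite /fcal; have -> : \row_(k < n) (1 : C) = const_mx 1.
  by apply/rowP => k; rewrite !mxE.
by rewrite diag_const_mx mulmx1 spectralQ'.
Qed.

Lemma fcalM f g : fcal f *m fcal g = fcal (fun z => f z * g z).
Proof.
have E : \row_j ((\row_k f (d 0 k)) 0 j * (\row_k g (d 0 k)) 0 j) =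
    \row_k (f (d 0 k) * g (d 0 k)) by apply/rowP => k; rewrite !mxE.
by rewrite /fcal !mulmxA (mulmxtVK _ Qu) -(mulmxA (Q^t*) (diag_mx _) (diag_mx _)) mulmx_diag E.
Qed.

Lemma fcalB f g : fcal f - fcal g = fcal (fun z => f z - g z).
Proof.
rewrite /fcal -mulmxBl -mulmxBr -raddfB.
have E : \row_k f (d 0 k) - \row_k g (d 0 k) = \row_k (f (d 0 k) - g (d 0 k)).
  by apply/rowP => k; rewrite !mxE.
by rewrite E.
Qed.

Lemma adj_fcal f : (fcal f)^t* = fcal (fun z => (f z)^*).
Proof.
rewrite /fcal !adjM trmxCK mulmxA tr_diag_mx map_diag_mx.
have E : map_mx Num.conj (\row_k f (d 0 k)) = \row_k (f (d 0 k))^*.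
  by apply/rowP => k; rewrite !mxE.
by rewrite E.
Qed.

Lemma fcal_entry f k : f (d 0 k) = (Q *m fcal f *m Q^t*) k k.
Proof.
rewrite /fcal -!mulmxA spectralQ mulmx1 mulmxA spectralQ mul1mx.
by rewrite [RHS]mxE eqxx mulr1n mxE.
Qed.

Lemma spectrum_unitary k : H *m H^t* = 1%:M -> d 0 k * (d 0 k)^* = 1.
Proof.
rewrite -fcal_id adj_fcal fcalM -fcal_one => E.
by rewrite (fcal_entry (fun z => z * z^*)) E -fcal_entry.
Qed.

(** In a basis of eigenvectors of H, a matrix that commutes with H has nonzero entries
    only between equal eigenvalues. *)
Lemma fcal_comm f (M : 'M[C]_n) : M *m H = H *m M -> M *m fcal f = fcal f *m M.
Proof.
move=> MH; have NE (N : 'M[C]_n) (g : C -> C) : M = Q^t* *m N *m Q ->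
    N *m diag_mx (\row_k g (d 0 k)) = diag_mx (\row_k g (d 0 k)) *m N ->
    M *m fcal g = fcal g *m M.
  move=> -> Ng; rewrite /fcal !mulmxA (mulmxtVK _ Qu).
  by rewrite (mulmxtVK _ Qu) -(mulmxA (Q^t*) N) Ng mulmxA.
apply: (NE (Q *m M *m Q^t*)).
  by rewrite !mulmxA spectralQ' mul1mx -mulmxA spectralQ' mulmx1.
have dE : diag_mx d = Q *m H *m Q^t*.
  by rewrite HE !mulmxA spectralQ mul1mx -mulmxA spectralQ mulmx1.
have Nd : Q *m M *m Q^t* *m diag_mx d = diag_mx d *m (Q *m M *m Q^t*).
  rewrite dE !mulmxA -(mulmxA (Q *m M)) spectralQ' mulmx1 -(mulmxA Q M) MH.
  by rewrite -(mulmxA (Q *m H)) spectralQ' mulmx1 !mulmxA.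
move: (Q *m M *m Q^t*) Nd => N Nd.
apply/matrixP => k l; have /matrixP/(_ k l) := Nd.
rewrite mul_mx_diag mul_diag_mx mxE [RHS]mxE.
rewrite mul_mx_diag mul_diag_mx !mxE => /eqP.
rewrite mulrC -subr_eq0 -mulrBl mulf_eq0 subr_eq0 => /orP[/eqP ->|/eqP ->].
  by rewrite mulrC.
by rewrite mul0r mulr0.
Qed.

End Calculus.

Lemma spectral_decomposition n (H : 'M[C]_n) : H \is normalmx ->
  exists (Q : 'M[C]_n) (d : 'rV[C]_n), Q \is unitarymx /\ H = Q^t* *m diag_mx d *m Q.
Proof.
move=> Hn; exists (spectralmx H), (spectral_diag H).
rewrite -invmx_unitary ?spectral_unitarymx//; split=> //.
exact/orthomx_spectralP.
Qed.

End MatrixAlgebra.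

Section MatrixTools.
Variable R : realType.
Local Notation normc := (@Normc.normc R).
Local Notation C := (R[i]).

Lemma enorm_isometry m n (U : 'M[C]_(m, n)) v : U^t* *m U = 1%:M ->
  enorm (U *m v) = enorm v.
Proof.
move=> UU; apply/eqP; rewrite -(eqrXn2 (ltn0Sn 1)) ?enorm_ge0//.
by apply/eqP/complexI; rewrite !enorm_sqr adjM -mulmxA (mulmxA _ U) UU mul1mx.
Qed.

Lemma opnorm_isometry m n (U : 'M[C]_(m, n)) : U^t* *m U = 1%:M -> opnorm U <= 1.
Proof. by move=> UU; apply: opnorm_le => // v; rewrite mul1r enorm_isometry. Qed.

Lemma opnorm_conj_isometry m n (U : 'M[C]_(m, n)) (M : 'M[C]_n) :
  U^t* *m U = 1%:M -> opnorm (U *m M *m U^t*) <= opnorm M.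
Proof.
move=> /opnorm_isometry U1; apply: le_trans (opnormM _ _) _.
rewrite opnorm_adj -[leRHS]mulr1; apply: ler_pM; rewrite ?opnorm_ge0//.
apply: le_trans (opnormM _ _) _; rewrite -[leRHS]mul1r.
by apply: ler_pM; rewrite ?opnorm_ge0.
Qed.

Lemma opnorm0 m n : opnorm (0 : 'M[C]_(m, n)) = 0.
Proof.
apply/le_anti; rewrite opnorm_ge0 andbT.
by apply: opnorm_le => // v; rewrite mul0mx enorm0 mul0r.
Qed.

Lemma opnormN m n (M : 'M[C]_(m, n)) : opnorm (- M) = opnorm M.
Proof.
have h (N : 'M[C]_(m, n)) : opnorm (- N) <= opnorm N.
  rewrite -scaleN1r (le_trans (opnormZ_le _ _))// -(rmorphN1 (@real_complex R)).
  by rewrite normcR normrN1 mul1r.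
apply/le_anti/andP; split; first exact: h.
by have := h (- M); rewrite opprK.
Qed.

Lemma opnormBC m n (M N : 'M[C]_(m, n)) : opnorm (M - N) = opnorm (N - M).
Proof. by rewrite -opprB opnormN. Qed.

Lemma opnorm_tri m n (M N P : 'M[C]_(m, n)) :
  opnorm (M - P) <= opnorm (M - N) + opnorm (N - P).
Proof. by rewrite -[M - P](subrKA N) opnormD. Qed.

Lemma opnorm_sum m n (J : Type) (s : seq J) (P : pred J) (F : J -> 'M[C]_(m, n)) :
  opnorm (\sum_(j <- s | P j) F j) <= \sum_(j <- s | P j) opnorm (F j).
Proof.
elim/big_ind2 : _ => [|x a y b xa yb|//]; first by rewrite opnorm0.
exact: le_trans (opnormD _ _) (lerD xa yb).
Qed.

Lemma opnorm_diag n (d : 'rV[C]_n) (c : R) : 0 <= c ->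
  (forall k, normc (d 0 k) <= c) -> opnorm (diag_mx d) <= c.
Proof.
move=> c0 H; apply: opnorm_le => // v.
rewrite -[c in leRHS](ger0_norm c0) -sqrtr_sqr /enorm -sqrtrM ?sqr_ge0//.
apply: ler_wsqrtr; rewrite mulr_sumr; apply: ler_sum => k _.
rewrite mul_diag_mx !mxE Normc.normcM exprMn ler_wpM2r ?sqr_ge0//.
by rewrite ler_sqr ?nnegrE ?normc_ge0.
Qed.

Section Continuity.
Variable T : topologicalType.

Lemma continuous_mulmx m n p (f : T -> 'M[C]_(m, n)) (g : T -> 'M[C]_(n, p)) :
  continuous f -> continuous g -> continuous (fun z => f z *m g z).
Proof.
move=> cf cg; apply/mx_continuousP => k l z.
rewrite /continuous_at; under eq_fun do rewrite mxE.
rewrite mxE; apply: cvg_big => [|j _]; first exact: add_continuous.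
by apply: cvgM; apply mx_continuousP.
Qed.

Lemma continuous_adj m n (f : T -> 'M[C]_(m, n)) :
  continuous f -> continuous (fun z => (f z)^t*).
Proof.
move=> cf; apply/mx_continuousP => k l z.
rewrite /continuous_at; under eq_fun do rewrite !mxE.
rewrite !mxE; apply/cvgcP => e e0.
have /mx_continuousP/(_ l k z)/cvgcP/(_ e e0) := cf.
apply: filterS => w; rewrite -rmorphB/=.
by congr (_ < e); apply: complexI; rewrite -!normcE norm_conjC.
Qed.

Lemma continuous_cst_mx m n (M : 'M[C]_(m, n)) : continuous (fun _ : T => M).
Proof. by move=> z; exact: cvg_cst. Qed.

Lemma continuous_sum_mx m n (J : Type) (s : seq J) (P : pred J)
    (F : J -> T -> 'M[C]_(m, n)) : (forall j, continuous (F j)) ->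
  continuous (fun z => \sum_(j <- s | P j) F j z).
Proof.
move=> cF z; apply: cvg_big => [|j _]; first exact: add_continuous.
exact: cF.
Qed.

End Continuity.

Section CalculusNorm.
Variables (n : nat) (Q : 'M[C]_n) (d : 'rV[C]_n).
Hypothesis Qu : Q \is unitarymx.
Local Notation fcalQ := (fcal Q d).

Lemma opnorm_fcal f (c : R) : 0 <= c -> (forall k, normc (f (d 0 k)) <= c) ->
  opnorm (fcalQ f) <= c.
Proof.
move=> c0 H'; rewrite /fcal -{2}[Q]trmxCK.
apply: le_trans (opnorm_conj_isometry _ _) _; first by rewrite trmxCK (spectralQ Qu).
by apply: opnorm_diag => // k; rewrite mxE.
Qed.

Lemma spectral_le f k : normc (f (d 0 k)) <= opnorm (fcalQ f).
Proof.
rewrite (fcal_entry d Qu f).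
apply: le_trans (normc_le_opnorm _ _ _) _; apply: opnorm_conj_isometry.
exact: spectralQ' Qu.
Qed.

End CalculusNorm.

(** The short arc from 1 to z on the unit circle, parametrized by its real part:
    its points are no farther from 1 than z. *)
Definition arc (t : R) (z : C) : C :=
  let c := 1 - clamp t * (1 - complex.Re z) in
  c +i* ((if 0 <= complex.Im z then 1 else -1) * Num.sqrt (1 - c ^+ 2)).

Section Arc.
Variable z : C.
Hypothesis z1 : normc z = 1.
Let a := complex.Re z.
Let b := complex.Im z.

Lemma unit_circle : a ^+ 2 + b ^+ 2 = 1.
Proof.
have := z1; rewrite /a /b; case: (z) => x y /= /(congr1 (fun w => w ^+ 2)).
by rewrite sqr_sqrtr ?expr1n// addr_ge0 ?sqr_ge0.
Qed.

Lemma arc_re t : -1 <= complex.Re (arc t z) <= 1 /\ a <= complex.Re (arc t z).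
Proof.
have := unit_circle; rewrite /arc /= -/a => ab.
have := clamp_itv t => /andP[t0 t1]; have : -1 <= a <= 1 by apply/andP; split; nra.
by move=> /andP[? ?]; split; [apply/andP; split|]; nra.
Qed.

Lemma arc_im_sqr t : complex.Im (arc t z) ^+ 2 = 1 - complex.Re (arc t z) ^+ 2.
Proof.
have [/andP[h1 h2] _] := arc_re t; rewrite {1}/arc /= exprMn.
rewrite sqr_sqrtr.
  by case: ifP => _; rewrite ?sqrrN expr1n mul1r.
by move: h1 h2; rewrite /arc /=; nra.
Qed.

Lemma arc0 : arc 0 z = 1.
Proof.
by rewrite /arc clampE ?lexx ?ler01// mul0r subr0 expr1n subrr sqrtr0 mulr0.
Qed.

Lemma arc1 : arc 1 z = z.
Proof.
rewrite /arc clampE ?lexx ?ler01// mul1r subKr.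
have -> : 1 - complex.Re z ^+ 2 = complex.Im z ^+ 2.
  by have := unit_circle; rewrite /a /b => <-; rewrite addrC addKr.
rewrite sqrtr_sqr; case: z => x y /=; case: ifP => y0; first by rewrite mul1r ger0_norm.
by rewrite mulN1r ltr0_norm ?opprK// ltNge y0.
Qed.

Lemma arc_unit t : (arc t z)^* * arc t z = 1.
Proof.
have := arc_im_sqr t; case: (arc t z) => x y /= xy; apply/eqP.
rewrite eq_complex /= mulNr opprK -!expr2 xy addrC subrK eqxx/=.
by rewrite mulNr mulrC addrN.
Qed.

Lemma arc_dist t : normc (arc t z - 1) <= normc (z - 1).
Proof.
have := arc_im_sqr t; have [_] := arc_re t; have := unit_circle.
rewrite /a /b; case: (arc t z) => x y; case: (z) => x' y' /= h1 h2 h3.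
by apply: ler_wsqrtr; rewrite !subr0; nra.
Qed.

End Arc.

Lemma arc_continuous (z : C) : continuous (arc ^~ z).
Proof.
have cre : continuous (fun t : R => 1 - clamp t * (1 - complex.Re z)).
  move=> t; apply: cvgB; first exact: cvg_cst.
  by apply: cvgMl; exact: clamp_continuous.
have cim : continuous (fun t : R => complex.Im (arc t z)).
  move=> t; rewrite /arc /=; apply: cvgMr.
  apply: (@continuous_comp _ _ _ (fun t => 1 - (1 - clamp t * (1 - complex.Re z)) ^+ 2)).
    apply: cvgB; first exact: cvg_cst.
    rewrite expr2; under eq_fun do rewrite expr2.
    by apply: cvgM; exact: cre.
  exact: sqrt_continuous.
move=> t; apply/cvgcP => e e0; have e2 : 0 < e / 2 by rewrite divr_gt0.
have /cvgrPdist_lt/(_ _ e2) h1 := cre t; have /cvgrPdist_lt/(_ _ e2) h2 := cim t.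
near=> s; apply: le_lt_trans (normc_le_ReIm _) _; rewrite (splitr e).
apply: ltrD; rewrite raddfB/=; near: s; [exact: h1|exact: h2].
Unshelve. all: by end_near.
Qed.

(** Every eigenvalue is moved along its [arc]. The matrices on the way are functions of
    T, so that distances are read off from the eigenvalues, and what commutes with T
    commutes with them. *)
Lemma unitary_path n (T : 'M[C]_n) : T \is unitarymx ->
  exists W : R -> 'M[C]_n,
    [/\ continuous W, forall t, W t \is unitarymx, W 0 = 1%:M /\ W 1 = T,
        forall t, opnorm (W t - 1%:M) <= opnorm (T - 1%:M) &
        forall t M, M *m T = T *m M -> M *m W t = W t *m M].
Proof.
move=> /unitarymxP TT; have TT' := mulmx1C TT.
have [|Q [d [Qu TE]]] := @spectral_decomposition _ _ T.
  by apply/normalmxP; rewrite TT TT'.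
have d1 k : normc (d 0 k) = 1.
  have /eqP := spectrum_unitary Qu TE k TT.
  rewrite -normCK -[X in _ == X](expr1n _ 2) eqrXn2// => /eqP.
  by rewrite normcE => /complexI.
exists (fun t => fcal Q d (arc t)); split.
- apply: continuous_mulmx; last exact: continuous_cst_mx.
  apply: continuous_mulmx; first exact: continuous_cst_mx.
  apply/mx_continuousP => k l t; rewrite /continuous_at.
  under eq_fun do rewrite !mxE; rewrite !mxE.
  by apply: cvgMn; exact: arc_continuous.
- move=> t; apply/unitarymxP; apply: mulmx1C.
  rewrite adj_fcal (fcalM d Qu) -[RHS](fcal_one d Qu).
  by apply: eq_fcal => k; rewrite arc_unit.
- split; first by rewrite -(fcal_one d Qu); apply: eq_fcal => k; rewrite arc0.
  by rewrite -[RHS](fcal_id TE); apply: eq_fcal => k; rewrite arc1.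
- move=> t; have := spectral_le d Qu (fun z => z - 1).
  rewrite -fcalB (fcal_id TE) (fcal_one d Qu) => dle.
  rewrite -{1}(fcal_one d Qu) fcalB; apply: opnorm_fcal => //.
    exact: opnorm_ge0.
  by move=> k; apply: le_trans (arc_dist (d1 k) t) _.
- by move=> t M; exact: (fcal_comm Qu TE).
Qed.

End MatrixTools.

(** * Systems of matrix units *)

Section MatrixUnits.
Variables (C : numClosedFieldType) (J : finType) (rr : J -> nat).
Hypothesis rr_gt0 : forall c, (0 < rr c)%N.
Variable n : nat.
Implicit Types E : forall c, 'I_(rr c) -> 'I_(rr c) -> 'M[C]_n.

Definition munits E := [/\
  forall c k l l' m, E c k l *m E c l' m = (l == l')%:R *: E c k m,
  forall c c' k l k' l', c != c' -> E c k l *m E c' k' l' = 0,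
  forall c k l, (E c k l)^t* = E c l k &
  \sum_c \sum_k E c k k = 1%:M].

Definition idx0 c : 'I_(rr c) := Ordinal (rr_gt0 c).

(** The canonical intertwiner from E to E'. It is near 1 when E' is near E. *)
Definition intertwiner E E' : 'M[C]_n :=
  \sum_c \sum_k E' c k (idx0 c) *m E c (idx0 c) k.

Lemma intertwinerM E E' c k l : munits E -> munits E' ->
  intertwiner E E' *m E c k l = E' c k l *m intertwiner E E'.
Proof.
move=> [EM Eo _ _] [EM' Eo' _ _]; transitivity (E' c k (idx0 c) *m E c (idx0 c) l).
  rewrite /intertwiner mulmx_suml (bigD1 c)//= [X in _ + X]big1 ?addr0 => [|c' c'c].
    rewrite mulmx_suml (bigD1 k)//= [X in _ + X]big1 ?addr0 => [|k' k'k].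
      by rewrite -mulmxA EM eqxx scale1r.
    by rewrite -mulmxA EM (negbTE k'k) scale0r mulmx0.
  by rewrite mulmx_suml big1// => k' _; rewrite -mulmxA Eo// mulmx0.
rewrite /intertwiner mulmx_sumr (bigD1 c)//= [X in _ + X]big1 ?addr0 => [|c' c'c].
  rewrite mulmx_sumr (bigD1 l)//= [X in _ + X]big1 ?addr0 => [|k' k'k].
    by rewrite mulmxA EM' eqxx scale1r.
  by rewrite mulmxA EM' eq_sym (negbTE k'k) scale0r mul0mx.
by rewrite mulmx_sumr big1// => k' _; rewrite mulmxA Eo' 1?eq_sym// mul0mx.
Qed.

Lemma intertwiner_refl E : munits E -> intertwiner E E = 1%:M.
Proof.
move=> [EM _ _ <-]; apply: eq_bigr => c _; apply: eq_bigr => k _.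
by rewrite EM eqxx scale1r.
Qed.

Lemma munits_conj E (W : 'M[C]_n) : W \is unitarymx -> munits E ->
  munits (fun c k l => W *m E c k l *m W^t*).
Proof.
move=> Wu [EM Eo Es E1]; have WW' := mulmx1C (unitarymxP Wu).
have mul (M N : 'M[C]_n) : W *m M *m W^t* *m (W *m N *m W^t*) = W *m (M *m N) *m W^t*.
  by rewrite !mulmxA -(mulmxA (W *m M)) WW' mulmx1.
split=> [c k l l' m|c c' k l k' l' cc'|c k l|].
- by rewrite mul EM -scalemxAr -scalemxAl.
- by rewrite mul Eo// mulmx0 mul0mx.
- by rewrite !adjM trmxCK Es mulmxA.
- under eq_bigr do rewrite -mulmx_suml -mulmx_sumr.
  by rewrite -mulmx_suml -mulmx_sumr E1 mulmx1; exact/unitarymxP.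
Qed.

End MatrixUnits.

Section Intertwining.
Variables (C : numClosedFieldType) (n : nat).
Implicit Types E F M S V W : 'M[C]_n.

Lemma intertwine_adj M E F : M *m E^t* = F^t* *m M -> E *m M^t* = M^t* *m F.
Proof. by move=> /(congr1 (fun N => N^t*)); rewrite /= !adjM !trmxCK. Qed.

Lemma intertwine_gram M E F : M *m E = F *m M -> M *m E^t* = F^t* *m M ->
  E *m (M^t* *m M) = M^t* *m M *m E.
Proof. by move=> ME /intertwine_adj EM; rewrite mulmxA EM -!mulmxA ME. Qed.

Lemma intertwine_mulr M E F S : M *m E = F *m M -> E *m S = S *m E ->
  M *m S *m E = F *m (M *m S).
Proof. by move=> ME ES; rewrite -mulmxA -ES !mulmxA ME. Qed.

Lemma unitary_ratio V W : V \is unitarymx -> W \is unitarymx ->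
  V^t* *m W \is unitarymx /\ V *m (V^t* *m W) = W.
Proof.
move=> Vu Wu; split; first by rewrite mul_unitarymx// trmxC_unitary.
by rewrite mulmxA (unitarymxP Vu) mul1mx.
Qed.

Lemma intertwine_ratio V W E : W \is unitarymx ->
  V *m E^t* = (W *m E *m W^t*)^t* *m V -> E *m (V^t* *m W) = V^t* *m W *m E.
Proof.
move=> /unitarymxP/mulmx1C WW' /intertwine_adj EV.
by rewrite mulmxA EV -!mulmxA WW' mulmx1.
Qed.

Lemma conj_mul_comm V W E : W \is unitarymx -> E *m W = W *m E ->
  V *m W *m E *m (V *m W)^t* = V *m E *m V^t*.
Proof.
move=> /unitarymxP WW EW; rewrite adjM -(mulmxA V) -EW !mulmxA.
by rewrite -(mulmxA _ W) WW mulmx1.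
Qed.

End Intertwining.

Section UnitaryPaths.
Variable R : realType.
Local Notation normc := (@Normc.normc R).
Local Notation C := (R[i]).

Lemma opnorm_adjB n (M : 'M[C]_n) : opnorm (M^t* - 1%:M) = opnorm (M - 1%:M).
Proof. by rewrite -{1}(adj1 C n) -adjB opnorm_adj. Qed.

Lemma opnorm1_le n : opnorm (1%:M : 'M[C]_n) <= 1.
Proof. by apply: opnorm_isometry; rewrite mulmx1 adj1. Qed.

Lemma opnorm_unitary n (W : 'M[C]_n) : W \is unitarymx -> opnorm W <= 1.
Proof. by move=> Wu; apply: opnorm_isometry; exact: mulmx1C (unitarymxP Wu). Qed.

Lemma near1_bound1 (k a b c : R) : 0 <= k -> k <= 8^-1 -> 0 <= a -> 0 <= b ->
  a <= 1 + k -> b <= k -> c <= a * b -> c + b <= 3 * k.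
Proof.
move=> k0 k8 a0 b0 ak bk cab; have : a * b <= (1 + k) * k by apply: ler_pM.
nra.
Qed.

Lemma near1_bound2 (k a b c e : R) : 0 <= k -> k <= 8^-1 -> 0 <= a -> 0 <= b ->
  a <= 1 + k -> b <= 4 * k -> c <= a * b -> e <= k -> c + e <= 9 * k.
Proof.
move=> k0 k8 a0 b0 ak bk cab ek.
have : a * b <= (1 + k) * (4 * k) by apply: ler_pM.
nra.
Qed.

Lemma opnormM_le m n p (M : 'M[C]_(m, n)) (N : 'M[C]_(n, p)) (a b : R) :
  opnorm M <= a -> opnorm N <= b -> opnorm (M *m N) <= a * b.
Proof.
move=> Ma Nb; apply: le_trans (opnormM M N) _.
by apply: ler_pM Ma Nb; exact: opnorm_ge0.
Qed.

Lemma conj_near1 n (V E : 'M[C]_n) (k : R) : V \is unitarymx -> opnorm E <= 1 ->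
  opnorm (V - 1%:M) <= k -> opnorm (V *m E *m V^t* - E) <= k + k.
Proof.
move=> Vu E1 Vk; have -> : V *m E *m V^t* - E =
    (V - 1%:M) *m E *m V^t* + E *m (V^t* - 1%:M).
  by rewrite mulmxBl mul1mx mulmxBl mulmxBr mulmx1 addrA subrK.
have V1 : opnorm (V^t*) <= 1 by rewrite opnorm_adj; exact: opnorm_unitary.
have Vk' : opnorm (V^t* - 1%:M) <= k by rewrite opnorm_adjB.
apply: le_trans (opnormD _ _) _; apply: lerD.
  by have := opnormM_le (opnormM_le Vk E1) V1; rewrite !mulr1.
by have := opnormM_le E1 Vk'; rewrite mul1r.
Qed.

Lemma inv_sqrt_near1 (x k : R) : `|x - 1| <= 3 * k -> k <= 8^-1 ->
  (Num.sqrt x)^-1 * x * (Num.sqrt x)^-1 = 1 /\ `|(Num.sqrt x)^-1 - 1| <= 4 * k.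
Proof.
move=> xk k8; have [x4 x2] : 4^-1 <= x /\ x <= 2.
  by move: xk; rewrite ler_norml => /andP[? ?]; split; lra.
have x0 : 0 < x by lra.
set y := Num.sqrt x; have y0 : 0 < y by rewrite sqrtr_gt0.
have yx : y * y = x by rewrite -expr2 sqr_sqrtr// ltW.
have y2 : 2^-1 <= y by nra.
split; first by rewrite -yx mulKf ?gt_eqF// mulfV// gt_eqF.
have -> : y^-1 - 1 = (1 - x) / (y * (1 + y)).
  by rewrite -yx; field; rewrite !gt_eqF//; lra.
have yy : 0 < y * (1 + y) by nra.
rewrite normrM normfV (gtr0_norm yy) ler_pdivrMr// distrC.
have yy2 : 3 / 4 <= y * (1 + y) by nra.
have k0 : 0 <= k by have := normr_ge0 (x - 1); lra.
apply: le_trans xk _; move: yy2; set p := y * _ => yy2; nra.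
Qed.

(** S is the inverse square root of the Gram matrix of M, so that M S is the unitary
    part in the polar decomposition of M. *)
Lemma polar_near1 n (M : 'M[C]_n) (k : R) : opnorm (M - 1%:M) <= k -> k <= 8^-1 ->
  exists S : 'M[C]_n, [/\ M *m S \is unitarymx, opnorm (M *m S - 1%:M) <= 9 * k &
    forall N, N *m (M^t* *m M) = M^t* *m M *m N -> N *m S = S *m N].
Proof.
move=> Mk k8; pose H := M^t* *m M.
have k0 : 0 <= k by exact: le_trans (opnorm_ge0 _) Mk.
have Hs : H^t* = H by rewrite /H adjM trmxCK.
have M2 : opnorm M <= 1 + k.
  rewrite -[M](subrK 1%:M) (le_trans (opnormD _ _))//.
  by rewrite addrC lerD// opnorm1_le.
have H3 : opnorm (H - 1%:M) <= 3 * k.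
  have -> : H - 1%:M = M^t* *m (M - 1%:M) + (M^t* - 1%:M).
    by rewrite mulmxBr mulmx1 addrA subrK.
  apply: le_trans (opnormD _ _) _; rewrite opnorm_adjB.
  have := opnormM (M^t*) (M - 1%:M); rewrite opnorm_adj => h.
  by apply: (near1_bound1 k0 k8) h; rewrite ?opnorm_ge0.
have [|Q [d [Qu HE]]] := @spectral_decomposition _ _ H.
  by apply/normalmxP; rewrite Hs.
have dR j : exists2 x : R, d 0 j = x%:C & `|x - 1| <= 3 * k.
  have dE : (d 0 j)^* = d 0 j.
    have := adj_fcal Q d id; rewrite (fcal_id HE) Hs -{1}(fcal_id HE) => E.
    by rewrite [LHS](fcal_entry d Qu (fun z => z^*)) -E -(fcal_entry d Qu id).
  exists (complex.Re (d 0 j)); first by rewrite RRe_real// CrealE dE.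
  have := spectral_le d Qu (fun z => z - 1) j.
  rewrite -fcalB (fcal_id HE) (fcal_one d Qu) => /le_trans/(_ H3).
  by apply: le_trans; have := Re_le_normc (d 0 j - 1); rewrite raddfB.
pose g (z : C) : C := ((Num.sqrt (complex.Re z))^-1)%:C.
have gR z : (g z)^* = g z by rewrite /g conjCR.
have SE : (M *m fcal Q d g)^t* *m (M *m fcal Q d g) = 1%:M.
  rewrite adjM mulmxA -(mulmxA _ (M^t*)) -/H adj_fcal.
  rewrite -{1}(fcal_id HE) (fcalM d Qu) (fcalM d Qu) -(fcal_one d Qu).
  apply: eq_fcal => j; rewrite gR /g; have [x -> /= xk] := dR j.
  by rewrite -!rmorphM/=; have [-> _] := inv_sqrt_near1 xk k8.
exists (fcal Q d g); split.
- exact/unitarymxP/mulmx1C.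
- have S4 : opnorm (fcal Q d g - 1%:M) <= 4 * k.
    rewrite -{1}(fcal_one d Qu) fcalB; apply: opnorm_fcal => //.
      by rewrite mulr_ge0.
    move=> j; rewrite /g; have [x -> /= xk] := dR j.
    have [_] := inv_sqrt_near1 xk k8.
    by rewrite subrr expr0n addr0 sqrtr_sqr.
  set S := fcal Q d g in S4 *.
  have -> : M *m S - 1%:M = M *m (S - 1%:M) + (M - 1%:M).
    by rewrite mulmxBr mulmx1 addrA subrK.
  apply: le_trans (opnormD _ _) _.
  by apply: (near1_bound2 k0 k8) (opnormM M (S - 1%:M)) Mk; rewrite ?opnorm_ge0.
- by move=> N; exact: (fcal_comm Qu HE).
Qed.

Variables (J : finType) (rr : J -> nat).
Hypothesis rr_gt0 : forall c, (0 < rr c)%N.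

Lemma munits_norm n E c k l : @munits C J rr n E -> opnorm (E c k l) <= 1.
Proof.
move=> [EM _ Es _].
have aux (a : R) : a ^+ 2 <= a -> a <= 1 by move=> *; nra.
have p1 : opnorm (E c l l) <= 1.
  have := opnorm_cstar (E c l l); rewrite Es EM eqxx scale1r.
  exact: aux.
have := opnorm_cstar (E c k l); rewrite Es EM eqxx scale1r => /le_trans/(_ p1).
by rewrite -[X in _ <= X](expr1n _ 2) ler_sqr ?nnegrE ?opnorm_ge0.
Qed.

(** W is the product of a unitary close to 1, obtained from the polar decomposition of
    the canonical intertwiner, and of a unitary commuting with the system E. Both
    factors are joined to 1 separately: the first path stays close to 1, and the second
    one fixes E. *)
Lemma unitary_path_close (eta : R) : 0 < eta -> exists2 delta : R, 0 < delta &
  forall n E (W : 'M[C]_n), munits E -> W \is unitarymx ->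
  (forall c k l, opnorm (W *m E c k l *m W^t* - E c k l) <= delta) ->
  exists Wt : R -> 'M[C]_n,
    [/\ continuous Wt, forall t, Wt t \is unitarymx, Wt 0 = 1%:M /\ Wt 1 = W &
        forall t (c : J) (k l : 'I_(rr c)),
          opnorm (Wt t *m E c k l *m (Wt t)^t* - E c k l) <= eta].
Proof.
move=> eta0; pose K : R := (\sum_c rr c)%:R + 1.
have K0 : 0 < K by rewrite ltr_wpDl.
pose kap : R := Num.min 8^-1 (eta / 18).
have kap0 : 0 < kap by rewrite lt_min invr_gt0 ltr0n divr_gt0.
have k18 : 9 * kap + 9 * kap <= eta.
  have : kap <= eta / 18 by rewrite ge_min lexx orbT.
  lra.
exists (kap / K); first by rewrite divr_gt0.
move=> n E W Eu Wu Wd; have E'u := munits_conj Wu Eu.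
set E' := fun c k l => W *m E c k l *m W^t* in E'u.
have [EM Eo Es E1] := Eu; have [_ _ Es' _] := E'u.
pose M := intertwiner rr_gt0 E E'.
have Mk : opnorm (M - 1%:M) <= kap.
  rewrite -(intertwiner_refl rr_gt0 Eu) /M /intertwiner -sumrB.
  apply: le_trans (opnorm_sum _ _ _) _.
  apply: (@le_trans _ _ (\sum_c \sum_(k < rr c) kap / K)).
    apply: ler_sum => c _; rewrite -sumrB; apply: le_trans (opnorm_sum _ _ _) _.
    apply: ler_sum => k _; rewrite -mulmxBl; apply: le_trans (opnormM _ _) _.
    rewrite -[leRHS]mulr1; apply: ler_pM; rewrite ?opnorm_ge0//; first exact: Wd.
    exact: munits_norm.
  under eq_bigr do rewrite sumr_const card_ord.
  rewrite sumrMnr -mulr_natl mulrA ler_pdivrMr// mulrC ler_pM2l//.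
  by rewrite /K lerDl.
have [|S [Vu V9 SH]] := polar_near1 Mk; first by rewrite ge_min lexx.
have ME c k l : M *m E c k l = E' c k l *m M by exact: intertwinerM.
have MEs c k l : M *m (E c k l)^t* = (E' c k l)^t* *m M by rewrite Es Es' ME.
have SE c k l : E c k l *m S = S *m E c k l.
  by apply: SH; exact: intertwine_gram (ME c k l) (MEs c k l).
have VE c k l : M *m S *m E c k l = E' c k l *m (M *m S).
  exact: intertwine_mulr (ME c k l) (SE c k l).
move: (M *m S) Vu V9 VE => V Vu V9 VE.
have [Tu WT] := unitary_ratio Vu Wu.
have TE c k l : E c k l *m (V^t* *m W) = V^t* *m W *m E c k l.
  apply: (intertwine_ratio Wu); rewrite -/(E' c k l) Es Es'; exact: VE.
move: (V^t* *m W) Tu TE WT => T Tu TE WT.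
have [Vt [Vc Vtu [V0 V1] Vd _]] := unitary_path Vu.
have [Tt [Tc Ttu [T0 T1] _ Tcomm]] := unitary_path Tu.
exists (fun t => Vt t *m Tt t); split.
- exact (continuous_mulmx Vc Tc).
- by move=> t; exact (mul_unitarymx (Vtu t) (Ttu t)).
- by rewrite V0 T0 V1 T1 mulmx1; split.
move=> t c k l; have ETt : E c k l *m Tt t = Tt t *m E c k l by exact: Tcomm.
rewrite (conj_mul_comm (Vt t) (Ttu t) ETt).
have Vt9 : opnorm (Vt t - 1%:M) <= 9 * kap by apply: le_trans (Vd t) _.
apply: (fun h => le_trans h k18).
exact (conj_near1 (Vtu t) (munits_norm k l Eu) Vt9).
Qed.

End UnitaryPaths.

(** * Finite-dimensional representations *)

Section MinimalInvariant.
Variables (C : numClosedFieldType) (s : nat) (F : 'M[C]_s -> Prop).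

Definition invariant (W : 'M[C]_s) := forall M, F M -> stablemx W M.

Lemma minimal_invariant (P : 'M[C]_s) : P != 0 -> invariant P ->
  exists W, [/\ W != 0, (W <= P)%MS, invariant W &
    forall W' : 'M_s, W' != 0 -> (W' <= W)%MS -> invariant W' -> (W <= W')%MS].
Proof.
move=> P0 FP; pose good k := `[< exists W : 'M[C]_s,
  [/\ W != 0, (W <= P)%MS, invariant W & \rank W = k] >].
have ex : exists k, good k by exists (\rank P); apply/asboolP; exists P.
case: (ex_minnP ex) => k /asboolP[W [W0 WP FW Wk]] kmin.
exists W; split=> // W' W'0 W'W FW'.
have : good (\rank W').
  by apply/asboolP; exists W'; split=> //; exact: submx_trans W'W WP.
move=> /kmin; rewrite -Wk => rk.
by have [_ /esym->] := mxrank_leqif_sup W'W; rewrite eqn_leq rk mxrankS.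
Qed.

(** Schur: an element of a commuting family is scalar on a minimal invariant
    subspace, because its eigenspaces are invariant. *)
Lemma scalar_on_minimal (W N : 'M[C]_s) : W != 0 -> invariant W ->
  (forall W' : 'M_s, W' != 0 -> (W' <= W)%MS -> invariant W' -> (W <= W')%MS) ->
  F N -> (forall M, F M -> M *m N = N *m M) ->
  exists a, W *m N = a *: W.
Proof.
move=> W0 FW Wmin FN Ncomm; pose B := row_base W.
have BN : (B *m N <= B)%MS by rewrite (eqmxMr _ (eq_row_base W)) eq_row_base FW.
have rk0 : (0 < \rank W)%N by rewrite lt0n mxrank_eq0.
have [a /eigenvalueP[v vN v0]] := eigenvalue_closed (B *m N *m pinvmx B) rk0.
have BE : B *m N *m pinvmx B *m B = B *m N by exact: mulmxKpV.
exists a; apply/eigenspaceP; pose W' := (W :&: eigenspace N a)%MS.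
have : (W <= W')%MS; last by rewrite sub_capmx => /andP[].
apply: Wmin; rewrite ?capmxSl//.
- apply/rowV0Pn; exists (v *m B).
    rewrite sub_capmx -(eq_row_base W) submxMl/=; apply/eigenspaceP.
    by rewrite -mulmxA -BE mulmxA vN scalemxAl.
  apply: contra_neq v0 => vB0; apply: (row_free_inj (row_base_free W)).
  by rewrite -/B vB0 mul0mx.
- move=> M FM; rewrite /W' sub_capmx.
  rewrite (submx_trans (submxMr M (capmxSl _ _)) (FW M FM))/=.
  have /eigenspaceP E := capmxSr W (eigenspace N a).
  by apply/eigenspaceP; rewrite -mulmxA Ncomm// mulmxA E scalemxAl.
Qed.

End MinimalInvariant.

(** Subspaces are row spaces, hence the transposes. *)
Lemma common_eigencolumn (C : numClosedFieldType) s (G : 'M[C]_s -> Prop) (P : 'M[C]_s) :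
  P != 0 -> (forall M, G M -> M *m P = P *m M) ->
  (forall M N, G M -> G N -> M *m N = N *m M) ->
  exists v : 'cV[C]_s, [/\ v != 0, exists w, v = P *m w &
    forall M, G M -> exists a, M *m v = a *: v].
Proof.
move=> P0 GP GG; pose F (M : 'M[C]_s) := G M^T.
have PT0 : P^T != 0 by rewrite trmx_eq0.
have [M FM|W [W0 WP FW Wmin]] := @minimal_invariant _ _ F P^T PT0.
  by rewrite -[M]trmxK -trmx_mul GP// trmx_mul submxMl.
have [D nzE] := submxP (nz_row_sub W).
exists (nz_row W)^T; split.
- by rewrite trmx_eq0 nz_row_eq0.
- have [D' E'] := submxP (submx_trans (nz_row_sub W) WP).
  by exists D'^T; rewrite E' trmx_mul trmxK.
- move=> M GM; have FM : F M^T by rewrite /F trmxK.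
  have [N FN|a aE] := scalar_on_minimal W0 FW Wmin FM.
    by rewrite -[N]trmxK -!trmx_mul; congr trmx; apply: GG.
  by exists a; rewrite -[M]trmxK -trmx_mul nzE -mulmxA aE -scalemxAr linearZ.
Qed.

Section Frames.
Variables (C : numClosedFieldType) (s : nat).

(** An orthogonal decomposition of the space; each summand is given by an isometry
    onto it, so that summands of different dimensions form one family. *)
Definition frame (T : finType) (d : T -> nat) (U : forall m, 'M[C]_(s, d m)) :=
  [/\ forall m, (U m)^t* *m U m = 1%:M,
      forall m m', m != m' -> (U m)^t* *m U m' = 0 &
      \sum_m U m *m (U m)^t* = 1%:M].

Section Sums.
Variables (T : finType) (d : T -> nat) (U : forall m, 'M[C]_(s, d m)).
Hypothesis U1 : forall m, (U m)^t* *m U m = 1%:M.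
Hypothesis U0 : forall m m', m != m' -> (U m)^t* *m U m' = 0.

Lemma frame_mul (M N : forall m, 'M[C]_(d m)) :
  (\sum_m U m *m M m *m (U m)^t*) *m (\sum_m U m *m N m *m (U m)^t*) =
  \sum_m U m *m (M m *m N m) *m (U m)^t*.
Proof.
rewrite mulmx_suml; apply: eq_bigr => m _.
rewrite mulmx_sumr (bigD1 m)//= [X in _ + X]big1 ?addr0 => [|m' m'm].
  by rewrite -!mulmxA (mulmxA ((U m)^t*) (U m)) U1 mul1mx.
by rewrite -!mulmxA (mulmxA ((U m)^t*) (U m')) U0 1?eq_sym// mul0mx !mulmx0.
Qed.

Lemma frame_compress (M : forall m, 'M[C]_(d m)) m :
  (U m)^t* *m (\sum_m U m *m M m *m (U m)^t*) *m U m = M m.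
Proof.
rewrite mulmx_sumr mulmx_suml (bigD1 m)//= [X in _ + X]big1 ?addr0 => [|m' m'm].
  by rewrite -!mulmxA U1 mulmx1 mulmxA U1 mul1mx.
by rewrite -!mulmxA U0// !mulmx0.
Qed.

Lemma frame_adj (M : forall m, 'M[C]_(d m)) :
  (\sum_m U m *m M m *m (U m)^t*)^t* = \sum_m U m *m (M m)^t* *m (U m)^t*.
Proof.
by rewrite adj_sum; apply: eq_bigr => m _; rewrite !adjM trmxCK mulmxA.
Qed.

(** The projection onto the complement of the ranges has nonnegative trace. *)
Lemma frame_dim : (\sum_m d m <= s)%N.
Proof.
pose P : 'M[C]_s := 1%:M - \sum_m U m *m (U m)^t*.
have Ps : P^t* = P.
  rewrite /P adjB adj1 adj_sum; congr (_ - _); apply: eq_bigr => m _.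
  by rewrite adjM trmxCK.
have PP : P *m P = P.
  have := frame_mul (fun m => 1%:M) (fun m => 1%:M).
  under eq_bigr do rewrite mulmx1; under [RHS]eq_bigr do rewrite !mulmx1.
  move=> E; have E' : (\sum_m U m *m (U m)^t*) *m (\sum_m U m *m (U m)^t*) =
    \sum_m U m *m (U m)^t* by rewrite -[RHS]E; congr (_ *m _); apply: eq_bigr => m _; rewrite mulmx1.
  by rewrite /P mulmxBl mul1mx mulmxBr mulmx1 E' subrr subr0.
have : 0 <= \tr P.
  rewrite -PP -{1}Ps; rewrite /mxtrace; apply: sumr_ge0 => k _.
  rewrite mxE; apply: sumr_ge0 => l _; rewrite !mxE mulrC.
  exact: mul_conjC_ge0.
have -> : \tr P = s%:R - (\sum_m d m)%:R.
  rewrite /P -scaleN1r mxtraceD mxtraceZ mulN1r mxtrace1; congr (_ - _).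
  rewrite (big_morph (@mxtrace C s) (@mxtraceD C s) (mxtrace0 C s)).
  rewrite natr_sum; apply: eq_bigr => m _.
  by rewrite mxtrace_mulC U1 mxtrace1.
by rewrite subr_ge0 ler_nat.
Qed.

End Sums.
End Frames.

(** Compactness as an induction principle for properties of sets that pass to
    subsets and to unions. *)
Lemma compact_ind (T : topologicalType) (P : set T -> Prop) :
  compact [set: T] -> P set0 -> (forall D E, P D -> P E -> P (D `|` E)) ->
  (forall D E, D `<=` E -> P E -> P D) ->
  (forall x : T, exists2 N : set T, nbhs x N & P N) -> P setT.
Proof.
move=> cT P0 PU PS Ploc; apply: contrapT => nPT.
pose F : set_system T := [set D | P (~` D)].
have FF : ProperFilter F.
  split; last split.
  - by rewrite /F /= setC0.
  - by rewrite /F /= setCT.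
  - by move=> D E PD PE; rewrite /F /= setCI; exact: PU.
  - by move=> D E DE PD; apply: PS PD; exact: subsetC.
have [|x [_ xF]] := cT F FF; first by rewrite /F /= setCT.
have [N Nx PN] := Ploc x.
have FN : F (~` N) by rewrite /F /= setCK.
by have [y []] := xF _ _ FN Nx.
Qed.

Lemma mulmx_col_entry (K : pzSemiRingType) m n p (M : 'M[K]_(m, n)) (N : 'M_(n, p)) i j :
  (M *m N) i j = (M *m col j N) i 0.
Proof. by rewrite !mxE; apply: eq_bigr => k _; rewrite mxE. Qed.

Lemma sum_option (T : finType) (F : option T -> nat) :
  (\sum_o F o = F None + \sum_m F (Some m))%N.
Proof.
rewrite (bigD1 None)//=; congr (_ + _)%N.
rewrite (reindex_omap Some id) => [|[]]//=.
by apply: eq_bigl => m; rewrite eqxx.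
Qed.

Section Representations.
Variables (R : realType) (I : finType) (Z : I -> ndgraph R) (r : I -> nat).
Hypothesis r_gt0 : forall i, (0 < r i)%N.
Variable s : nat.
Local Notation C := (R[i]).
Local Notation A := (matfun Z r).
Local Notation X := ({i : I & Z i}).
Implicit Types rho : A -> 'M[C]_s.

(** U collects the blocks of a unitary equivalence of rho with the direct sum of the
    evaluations at the points x m, which need not be distinct. *)
Definition presents (T : finType) (x : T -> X)
    (U : forall m, 'M[C]_(s, r (tag (x m)))) rho :=
  frame U /\ forall a, rho a = \sum_m U m *m ev a (x m) *m (U m)^t*.

Record star_rep rho : Prop := {
  star_rep_linear : forall c a b, rho (c *: a + b) = c *: rho a + rho b ;
  star_repM : forall a b, rho (matfunM a b) = rho a *m rho b ;
  star_repS : forall a, rho (matfunS a) = (rho a)^t* ;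
  star_rep1 : rho (matfun1 Z r) = 1%:M }.

(** The matrix unit in position (k, l) of the i-th summand; the positions are
    natural numbers so that one formula serves for all summands. *)
Definition unit_family (i : I) (k l : nat) (i' : I) : 'M[C]_(r i') :=
  \matrix_(p, q) ((i' == i) && (p == k :> nat) && (q == l :> nat))%:R.

Lemma unit_familyE i (k l : 'I_(r i)) : unit_family i k l i = delta_mx k l.
Proof. by apply/matrixP => p q; rewrite !mxE eqxx. Qed.

Lemma unit_family_neq i i' k l : i' != i -> unit_family i k l i' = 0.
Proof. by move=> ii; apply/matrixP => p q; rewrite !mxE (negbTE ii). Qed.

Lemma sum_graph_compact : compact [set: X].
Proof.
by apply: sigT_compact; [exact: finite_finset|move=> i; exact: ndgraph_compact].
Qed.

Section OneRep.
Variable rho : A -> 'M[C]_s.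
Hypothesis rhoP : star_rep rho.

Lemma repD a b : rho (a + b) = rho a + rho b.
Proof. by have := star_rep_linear rhoP 1 a b; rewrite !scale1r. Qed.

Lemma rep0 : rho 0 = 0.
Proof. by apply: (@addIr _ (rho 0)); rewrite -repD !add0r. Qed.

Lemma repZ c a : rho (c *: a) = c *: rho a.
Proof. by have := star_rep_linear rhoP c a 0; rewrite rep0 !addr0. Qed.

Lemma rep_sum (J : Type) (q : seq J) (P : pred J) (F : J -> A) :
  rho (\sum_(j <- q | P j) F j) = \sum_(j <- q | P j) rho (F j).
Proof. exact: (big_morph rho repD rep0). Qed.

End OneRep.

Lemma matfun_sumE (J : Type) (q : seq J) (P : pred J) (F : J -> A) i z :
  (\sum_(j <- q | P j) F j : A) i z = \sum_(j <- q | P j) F j i z.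
Proof. exact: (big_morph (fun a : A => a i z)). Qed.

Definition central (a : A) (f : forall i, Z i -> R) :=
  (forall i, continuous (f i)) /\ forall i z, a i z = ((f i z)%:C)%:M.

Lemma central_exists f : (forall i, continuous (f i)) -> exists a, central a f.
Proof.
move=> cf; exists (scalar_fun (fun i => 1%:M) cf); split=> // i z /=.
by rewrite scalemx1.
Qed.

Lemma central_comm a f b : central a f -> matfunM a b = matfunM b a.
Proof.
by move=> [_ aE]; apply: matfunP => i z /=; rewrite aE scalar_mxC.
Qed.

Definition at_pt (f : forall i, Z i -> R) (x : X) : R := f (tag x) (tagged x).

Lemma at_pt_continuous f : (forall i, continuous (f i)) -> continuous (at_pt f).
Proof. exact: sigT_continuous. Qed.

(** A joint eigenvector of the centre is attached to a point: otherwise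
    compactness gives a strictly positive central element that kills it. *)
Lemma eigen_point rho (v : 'cV[C]_s) : star_rep rho -> v != 0 ->
  (forall a f, central a f -> exists l, rho a *m v = l *: v) ->
  exists x, forall a f, central a f -> rho a *m v = (at_pt f x)%:C *: v.
Proof.
move=> rhoP v0 veig; apply: contrapT => nx.
pose P (N : set X) := exists a f, [/\ central a f, forall y, 0 <= at_pt f y,
  forall y, N y -> 0 < at_pt f y & rho a *m v = 0].
have : P setT.
  apply: compact_ind; first exact: sum_graph_compact.
  - exists 0, (fun _ _ => 0); split=> //; last by rewrite (rep0 rhoP) mul0mx.
    split=> [i z|i z]; first exact: cvg_cst.
    by rewrite /= raddf0.
  - move=> D E [a [f [[cf aE] f0 fD av]]] [b [g [[cg bE] g0 gE bv]]].
    exists (a + b), (fun i z => f i z + g i z); split.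
    + split=> [i z|i z]; first by apply: cvgD; [exact: cf|exact: cg].
      by rewrite /= aE bE rmorphD/= raddfD.
    + by move=> y; exact: addr_ge0 (f0 y) (g0 y).
    + move=> y [/fD fy|/gE gy]; first exact: ltr_wpDr (g0 y) fy.
      exact: ltr_wpDl (f0 y) gy.
    + by rewrite (repD rhoP) mulmxDl av bv addr0.
  - move=> D E DE [a [f [aP f0 fD av]]]; exists a, f; split=> // y /DE; exact: fD.
  - move=> x; have [a [f [fP av]]] : exists a f, central a f /\
        rho a *m v <> (at_pt f x)%:C *: v.
      apply: contrapT => H; apply: nx; exists x => a f fP.
      by apply: contrapT => av; apply: H; exists a, f.
    have [l lE] := veig a f fP; have [cf aE] := fP.
    (* The eigenvalue l = u + i w is a root of (X - u)^2 + w^2, whose value at f x is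
       positive because f x differs from l. *)
    pose u := complex.Re l; pose w := complex.Im l.
    pose g i z := (f i z - u) ^+ 2 + w ^+ 2.
    have cg i : continuous (g i).
      move=> z; rewrite /g; apply: cvgD; last exact: cvg_cst.
      rewrite expr2; under eq_fun do rewrite expr2.
      by apply: cvgM; (apply: cvgB; [exact: cf|exact: cvg_cst]).
    have g0 y : 0 <= at_pt g y by rewrite addr_ge0// sqr_ge0.
    have gx : 0 < at_pt g x.
      rewrite lt_neqAle g0 andbT eq_sym; apply/eqP => gx0; apply: av.
      have /andP[h1 h2] : (at_pt f x - u == 0) && (w == 0).
        have := gx0; rewrite /at_pt /g => /eqP.
        by rewrite paddr_eq0 ?sqr_ge0// !sqrf_eq0.
      rewrite lE; congr (_ *: _); rewrite [l]complexE.
      move: h1 h2; rewrite subr_eq0 -/u -/w => /eqP -> /eqP ->.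
      by rewrite mulr0 addr0.
    exists [set y | 0 < at_pt g y].
      by have := at_pt_continuous cg; move=> /(_ x) /cvgr_gt; apply.
    have l2 : l * l - (u *+ 2)%:C * l + (u ^+ 2 + w ^+ 2)%:C = 0.
      rewrite [l]complexE -/u -/w; have := sqr_i R.
      rewrite !(rmorphD, rmorphXn, rmorphMn)/=; move: (u%:C) (w%:C) => p q i2.
      by ring: i2.
    pose b := matfunM a a - (u *+ 2)%:C *: a + (u ^+ 2 + w ^+ 2)%:C *: matfun1 Z r.
    exists b, g; split=> //.
    + split=> // i z; rewrite /b /= aE -scalar_mxM !scale_scalar_mx mulr1.
      rewrite -raddfN -!raddfD /g; congr (_%:M).
      rewrite -!rmorphM -rmorphN -!rmorphD; congr (_%:C).
      by rewrite /=; ring.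
    + rewrite /b !(repD rhoP) -scaleNr !(repZ rhoP) (star_repM rhoP) (star_rep1 rhoP).
      rewrite !mulmxDl -!scalemxAl -mulmxA lE -scalemxAr lE mul1mx !scalerA -!(scalerDl v).
      by rewrite mulNr l2 scale0r.
move=> [a [f [[cf aE] f0 fpos av]]].
have [b [cb bE]] : exists b, central b (fun i z => (f i z)^-1).
  apply: central_exists => i z; apply: cvgV; last exact: cf.
  by have := fpos (existT _ i z) Logic.I; rewrite /at_pt/= => /gt_eqF ->.
have ba : matfunM b a = matfun1 Z r.
  apply: matfunP => i z /=; rewrite aE bE -scalar_mxM -rmorphM/= mulVf//.
  by have := fpos (existT _ i z) Logic.I; rewrite /at_pt/= => /gt_eqF ->.
have /eqP[] := v0; rewrite -[v]mul1mx -(star_rep1 rhoP) -ba (star_repM rhoP).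
by rewrite -mulmxA av mulmx0.
Qed.

Definition unit_fun (i : I) (k l : nat) : A :=
  @scalar_fun R I Z r (fun _ _ => 1) (unit_family i k l) (fun _ _ => cvg_cst _).

Lemma unit_funE i k l i' z : unit_fun i k l i' z = unit_family i k l i'.
Proof. by rewrite /= scale1r. Qed.

Lemma unit_fun_mul i (k l l' m : 'I_(r i)) :
  matfunM (unit_fun i k l) (unit_fun i l' m) = (l == l')%:R *: unit_fun i k m.
Proof.
apply: matfunP => i' z; rewrite [LHS]/= [RHS]/= !scale1r.
have [->|ii'] := eqVneq i' i.
  rewrite !unit_familyE; have [->|ll'] := eqVneq l l'.
    by rewrite mul_delta_mx scale1r.
  by rewrite mul_delta_mx_0// scale0r.
by rewrite !unit_family_neq// mulmx0 scaler0.
Qed.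

Lemma unit_fun_star i (k l : 'I_(r i)) : matfunS (unit_fun i k l) = unit_fun i l k.
Proof.
apply: matfunP => i' z; rewrite [LHS]/= [RHS]/= !scale1r.
have [->|ii'] := eqVneq i' i; first by rewrite !unit_familyE adj_delta.
by rewrite !unit_family_neq// adj0.
Qed.

(** Positions out of range give 0, so that an entry can be followed across summands
    of different sizes. *)
Definition nat_entry n (M : 'M[C]_n) (k l : nat) : C :=
  \sum_(p < n | p == k :> nat) \sum_(q < n | q == l :> nat) M p q.

Lemma nat_entryE n (M : 'M[C]_n) (k l : 'I_n) : nat_entry M k l = M k l.
Proof. by rewrite /nat_entry (big_pred1 k)// (big_pred1 l). Qed.

Lemma nat_entry_continuous (a : A) k l i :
  continuous (fun z => nat_entry (a i z) k l).
Proof.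
move=> z; rewrite /nat_entry; apply: cvg_big => [|p _]; first exact: add_continuous.
apply: cvg_big => [|q _]; first exact: add_continuous.
by have /mx_continuousP := @mf_continuous _ _ _ _ a i; exact.
Qed.

Lemma ReIm_continuous (T : topologicalType) (f : T -> C) : continuous f ->
  continuous (fun z => complex.Re (f z)) /\ continuous (fun z => complex.Im (f z)).
Proof.
move=> cf; split=> z; apply/cvgrPdist_lt => e e0; have /cvgcP/(_ e e0) := cf z;
  apply: filterS => w; apply: le_lt_trans; rewrite -raddfB.
  exact: Re_le_normc.
exact: Im_le_normc.
Qed.

(** From a vector on which the centre acts by evaluation at x one gets an
    isometry intertwining the representation with the evaluation at x: its columns
    are images of one vector under matrix units. *)
Lemma eigen_isometry rho (v : 'cV[C]_s) x : star_rep rho -> v != 0 ->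
  (forall a f, central a f -> rho a *m v = (at_pt f x)%:C *: v) ->
  exists (V : 'M[C]_(s, r (tag x))) (M : 'I_(r (tag x)) -> A),
    [/\ V^t* *m V = 1%:M, forall a, rho a *m V = V *m ev a x &
        exists c : C, forall k, col k V = c *: (rho (M k) *m v)].
Proof.
case: x => i0 z0 /= rhoP v0 vE.
pose k0 : 'I_(r i0) := Ordinal (r_gt0 i0).
have [a0 [ca0 a0E]] : exists a, central a (fun i _ => (i == i0)%:R).
  by apply: central_exists => i z; exact: cvg_cst.
have a0sum : a0 = \sum_(k < r i0) unit_fun i0 k k.
  apply: matfunP => i z; rewrite a0E matfun_sumE.
  under eq_bigr do rewrite unit_funE.
  have [->|ii0] := eqVneq i i0.
    under eq_bigr do rewrite unit_familyE.
    by apply/matrixP => p q; rewrite summxE (bigD1 p)//= big1 => [|k kp];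
      rewrite !mxE ?eqxx ?addr0 1?eq_sym ?(negbTE kp)// eq_sym.
  by rewrite big1 ?raddf0// => k _; rewrite unit_family_neq.
have [k uk0] : exists k : 'I_(r i0), rho (unit_fun i0 k0 k) *m v != 0.
  apply: contrapT => H; have /eqP[] := v0.
  have := vE a0 _ (conj ca0 a0E); rewrite /at_pt/= eqxx scale1r => <-.
  rewrite a0sum (rep_sum rhoP) mulmx_suml big1// => k _.
  have -> : unit_fun i0 k k = matfunM (unit_fun i0 k k0) (unit_fun i0 k0 k).
    by rewrite unit_fun_mul eqxx scale1r.
  rewrite (star_repM rhoP) -mulmxA.
  have [->|nz] := eqVneq (rho (unit_fun i0 k0 k) *m v) 0; first by rewrite mulmx0.
  by case: H; exists k.
set u := rho _ *m v in uk0.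
have en0 : enorm u != 0.
  apply: contra_neq uk0 => en0; apply/colP => p; rewrite [RHS]mxE.
  by apply: Normc.eq0_normc; apply/le_anti; rewrite normc_ge0 andbT -en0 normc_le_enorm.
pose c : C := ((enorm u)^-1)%:C; pose w := c *: u.
have wE a f : central a f -> rho a *m w = (at_pt f (existT _ i0 z0))%:C *: w.
  move=> af; rewrite /w -scalemxAr /u mulmxA -(star_repM rhoP) (central_comm _ af).
  by rewrite (star_repM rhoP) -mulmxA (vE a f af) -scalemxAr !scalerA [c * _]mulrC.
have ww : w^t* *m w = 1%:M.
  rewrite /w adjZ -scalemxAl -scalemxAr scalerA [_^t* *m _]mx11_scalar -enorm_sqr.
  rewrite scale_scalar_mx /c conjCR -!rmorphM/= -expr2 -exprMn mulVf//.
  by rewrite expr1n rmorph1.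
have w0 : rho (unit_fun i0 k0 k0) *m w = w.
  rewrite /w -scalemxAr /u mulmxA -(star_repM rhoP) unit_fun_mul eqxx scale1r.
  by [].
pose V : 'M[C]_(s, r i0) := \matrix_(p, k) (rho (unit_fun i0 k k0) *m w) p 0.
have colV k1 : col k1 V = rho (unit_fun i0 k1 k0) *m w.
  by apply/colP => p; rewrite !mxE.
have colE (B : 'M[C]_(s, r i0)) k1 p : B p k1 = col k1 B p 0 by rewrite mxE.
exists V, (fun k1 => matfunM (unit_fun i0 k1 k0) (unit_fun i0 k0 k)); split.
- apply/matrixP => p q.
  have -> : (V^t* *m V) p q = ((col p V)^t* *m col q V) 0 0.
    by rewrite !mxE; apply: eq_bigr => j _; rewrite !mxE.
  rewrite !colV adjM -mulmxA (mulmxA ((rho _)^t*)) -(star_repS rhoP) unit_fun_star.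
  rewrite -(star_repM rhoP) unit_fun_mul (repZ rhoP) -scalemxAl w0 -scalemxAr ww.
  by rewrite !mxE eqxx mulr1.
- move=> a; apply/matrixP => p q; rewrite colE colE; congr (_ p 0).
  have -> : col q (rho a *m V) = rho a *m col q V by apply/colP => j; rewrite !mxE; apply: eq_bigr => ? _; rewrite !mxE.
  have -> : col q (V *m a i0 z0) = \sum_(k1 < r i0) a i0 z0 k1 q *: col k1 V.
    by apply/colP => j; rewrite summxE !mxE; apply: eq_bigr => ? _; rewrite !mxE mulrC.
  have cX k1 i := ReIm_continuous (@nat_entry_continuous a k1 q i).
  pose re (k1 : 'I_(r i0)) := sval (cid (central_exists (fun i => proj1 (cX k1 i)))).
  pose im (k1 : 'I_(r i0)) := sval (cid (central_exists (fun i => proj2 (cX k1 i)))).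
  have reP k1 : central (re k1) (fun i z => complex.Re (nat_entry (a i z) k1 q)).
    exact: svalP (cid (central_exists (fun i => proj1 (cX k1 i)))).
  have imP k1 : central (im k1) (fun i z => complex.Im (nat_entry (a i z) k1 q)).
    exact: svalP (cid (central_exists (fun i => proj2 (cX k1 i)))).
  move: re im reP imP => re im reP imP.
  have aE : matfunM a (unit_fun i0 q k0) =
      \sum_(k1 < r i0) matfunM (unit_fun i0 k1 k0) (re k1 + 'i%C *: im k1).
    apply: matfunP => i z; rewrite matfun_sumE.
    have E k1 : (re k1 + 'i%C *: im k1) i z = (nat_entry (a i z) k1 q)%:M.
      have [_ reE] := reP k1; have [_ imE] := imP k1.
      rewrite [LHS]/= reE imE scale_scalar_mx.
      by rewrite [nat_entry _ _ _ in RHS]complexE raddfD.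
    transitivity (a i z *m unit_family i0 q k0 i).
      by rewrite [LHS]/= scale1r.
    transitivity (\sum_(k1 < r i0) unit_family i0 k1 k0 i *m (nat_entry (a i z) k1 q)%:M).
      have [ii0|ii0] := eqVneq i i0; last first.
        rewrite unit_family_neq// mulmx0 big1// => k1 _.
        by rewrite unit_family_neq// mul0mx.
      move: z E; rewrite ii0 => z E; rewrite unit_familyE.
      apply/matrixP => j l; rewrite summxE mxE (bigD1 q)//= big1 ?addr0 => [|j' j'q].
        rewrite mxE eqxx (bigD1 j)//= [X in _ + X]big1 ?addr0 => [|j' j'j].
          by rewrite nat_entryE mul_mx_scalar !mxE !eqxx mulrC.
        by rewrite mul_mx_scalar !mxE eqxx [_ == nat_of_ord j']eq_sym (negbTE (_ : nat_of_ord j' != j))// mulr0.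
      by rewrite mxE (negbTE j'q) mulr0.
    apply: eq_bigr => k1 _; rewrite -E.
    by rewrite [RHS]/= scale1r.
  have T (k1 : 'I_(r i0)) : rho (matfunM (unit_fun i0 k1 k0) (re k1 + 'i%C *: im k1)) *m w =
      a i0 z0 k1 q *: col k1 V.
    rewrite (star_repM rhoP) (repD rhoP) (repZ rhoP).
    rewrite -mulmxA mulmxDl -scalemxAl (wE _ _ (reP k1)) (wE _ _ (imP k1)).
    rewrite scalerA -scalerDl -scalemxAr -colV.
    by rewrite /at_pt /= -complexE nat_entryE.
  rewrite colV mulmxA -(star_repM rhoP) aE (rep_sum rhoP) mulmx_suml.
  by rewrite (eq_bigr _ (fun k1 _ => T k1)).
- exists c => k1; rewrite colV /w -scalemxAr /u mulmxA -(star_repM rhoP).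
  by [].
Qed.

Definition partial_frame rho (T : finType) (x : T -> X)
    (U : forall m, 'M[C]_(s, r (tag (x m)))) := [/\
  forall m, (U m)^t* *m U m = 1%:M,
  forall m m', m != m' -> (U m)^t* *m U m' = 0 &
  forall a m, rho a *m U m = U m *m ev a (x m)].

(** Irreducible blocks are split off one at a time: the complement of the blocks
    found so far is invariant, and contains a further block unless it is zero. *)
Lemma split_block rho T x U : star_rep rho -> @partial_frame rho T x U ->
  @presents T x U rho \/ exists T' x' U', @partial_frame rho T' x' U' /\
    (\sum_m r (tag (x m)) < \sum_m r (tag (x' m)))%N.
Proof.
move=> rhoP [U1 U0 Uint]; pose P : 'M[C]_s := 1%:M - \sum_m U m *m (U m)^t*.
have Uint' a m : (U m)^t* *m rho a = ev a (x m) *m (U m)^t*.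
  have := congr1 (fun M => M^t*) (Uint (matfunS a) m).
  rewrite /= !adjM (star_repS rhoP) trmxCK => ->.
  by rewrite /ev /= trmxCK.
have [P0|Pn0] := eqVneq P 0.
  have S1 : \sum_m U m *m (U m)^t* = 1%:M by apply/esym/eqP; rewrite -subr_eq0 -/P P0.
  left; split=> // a; rewrite -[LHS]mulmx1 -S1 mulmx_sumr.
  by apply: eq_bigr => m _; rewrite mulmxA Uint.
have PC a : rho a *m P = P *m rho a.
  rewrite /P mulmxBr mulmxBl mulmx1 mul1mx mulmx_sumr mulmx_suml.
  congr (_ - _); apply: eq_bigr => m _.
  by rewrite mulmxA Uint -!mulmxA Uint'.
have UP m : (U m)^t* *m P = 0.
  rewrite /P mulmxBr mulmx1 mulmx_sumr (bigD1 m)//= big1 ?addr0 => [|m' m'm].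
    by rewrite mulmxA U1 mul1mx subrr.
  by rewrite mulmxA U0 1?eq_sym// mul0mx.
have [||v [v0 [w vw] veig]] := @common_eigencolumn _ _
    (fun M => exists a f, central a f /\ M = rho a) P Pn0.
- by move=> M [a [f [_ ->]]].
- move=> M N [a [f [af ->]]] [b [g [bg ->]]].
  by rewrite -!(star_repM rhoP) (central_comm _ af).
have [x0 x0P] : exists x, forall a f, central a f -> rho a *m v = (at_pt f x)%:C *: v.
  apply: eigen_point => // a f af.
  by have [l lE] := veig (rho a) (ex_intro _ a (ex_intro _ f (conj af erefl))); exists l.
have [V [M [V1 Vint [c Vcol]]]] := eigen_isometry rhoP v0 x0P.
have UV m : (U m)^t* *m V = 0.
  apply/matrixP => p q; rewrite mulmx_col_entry Vcol -scalemxAr mulmxA Uint' vw -mulmxA.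
  by rewrite (mulmxA ((U m)^t*)) UP mul0mx mulmx0 scaler0 !mxE.
have VU m : V^t* *m U m = 0.
  by rewrite -[LHS]trmxCK adjM trmxCK UV adj0.
right; exists (option T), (fun o => if o is Some m then x m else x0).
exists (fun o => match o return 'M[C]_(s, r (tag (if o is Some m then x m else x0)))
  with Some m => U m | None => V end).
split; last by rewrite [X in (_ < X)%N]sum_option /= -[X in (X < _)%N]add0n ltn_add2r r_gt0.
split.
- by case.
- by case=> [m|] [m'|] //; exact: U0.
- by move=> a [m|]; [exact: Uint|exact: Vint].
Qed.

(** Splitting off blocks stops, as their total size is bounded by [frame_dim]. *)
Theorem rep_presented rho : star_rep rho ->
  exists (T : finType) (x : T -> X) U, @presents T x U rho.
Proof.
move=> rhoP; suff H k (T : finType) (x : T -> X) U : @partial_frame rho T x U ->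
    (s - \sum_m r (tag (x m)) < k)%N ->
    exists (T : finType) (x : T -> X) U, @presents T x U rho.
  apply: (H s.+1 void (fun v => match v with end) (fun v => match v with end)).
    by split; [case|case|move=> a []].
  by rewrite ltnS leq_subr.
elim: k T x U => // k IH T x U UP sk.
have [UP'|[T' [x' [U' [UP' lt]]]]] := split_block rhoP UP; first by exists T, x, U.
apply: (IH T' x' U') => //; have [U1 U0 _] := UP'.
have := frame_dim U1 U0; move: sk lt.
move: (\sum_m _) (\sum_m _) => p q; rewrite ltnS => sk pq qs.
apply: leq_trans sk; exact: ltn_sub2l (leq_trans pq qs) pq.
Qed.

End Representations.

(** * Moving distinct points in a star *)

(** Distinct representatives of infinite sets are chosen greedily. *)
Lemma inj_choice (X : eqType) (T : finType) (N : T -> set X) (B : seq X) :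
  (forall m (D : seq X), exists x, N m x /\ x \notin D) ->
  exists w : T -> X, injective w /\ forall m, N m (w m) /\ w m \notin B.
Proof.
move=> Ninf.
suff [w [winj wN]] : exists w : T -> X, {in enum T &, injective w} /\
    forall m, N m (w m) /\ w m \notin B.
  by exists w; split=> // m m'; apply: winj; rewrite mem_enum.
have [w0 w0N] := choice (fun m => Ninf m B).
elim: (enum T) => [|b q [w [winj wN]]]; first by exists w0; split=> // ? ? /[!in_nil].
have [x [Nx xD]] := Ninf b (B ++ map w q).
move: xD; rewrite mem_cat negb_or => /andP[xB xq].
have [bq|bq] := boolP (b \in q).
  exists w; split=> // m m'; rewrite !inE.
  by move=> /orP[/eqP ->|mq] /orP[/eqP ->|mq'] //; exact: winj.
exists (fun m => if m == b then x else w m); split=> [m m'|m]; last by case: eqP => [->|].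
have xw m1 : m1 \in q -> x <> w m1.
  by move=> mq xE; move: xq; rewrite xE map_f.
have nb m1 : m1 \in q -> (m1 == b) = false.
  by move=> mq; apply/eqP => mb; move: bq; rewrite -mb mq.
rewrite !inE => /predU1P[->|mq] /predU1P[->|mq'] //; rewrite ?eqxx ?nb//.
- by move=> /xw; case.
- by move=> /esym /xw; case.
- exact: winj.
Qed.

Section Tokens.
Variables (R : realType) (X : ndgraph R) (T : finType).
Variables (p : X) (L : finType) (a : L -> R -> X).
Hypothesis aP : star p a.
Local Notation S := (star_set a).

Definition config (y : T -> X) := injective y /\ forall m, S (y m).

Definition place (y : T -> X) b q : T -> X := fun m => if m == b then q else y m.

Lemma config_place y b q : config y -> S q -> (forall m, y m <> q) ->
  config (place y b q).
Proof.
move=> [yinj yS] Sq yq; split=> [m m'|m]; rewrite /place; last by case: eqP.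
case: eqP => [->|_]; case: eqP => [->|_] //; last exact: yinj.
- by move=> /esym /yq.
- by move=> /yq.
Qed.

Lemma star_arm l t : 0 <= t <= 1 -> S (a l t).
Proof. by move=> t01; exists l, t. Qed.

Lemma arm_infinite (l : L) (D : seq X) : exists x, S x /\ x \notin D.
Proof.
apply: contrapT => H.
pose P := [seq a l (k%:R / (size D)%:R) | k <- iota 0 (size D).+1].
have D0 : (0 < size D)%N.
  case: D H @P => [H _|//]; case: H; exists (a l 0); split=> //.
  by apply: star_arm; rewrite lexx ler01.
have t01 k : (k < (size D).+1)%N -> 0 <= (k%:R / (size D)%:R : R) <= 1.
  rewrite ltnS => kD; apply/andP; split; first by rewrite divr_ge0 ?ler0n.
  by rewrite ler_pdivrMr ?ltr0n// mul1r ler_nat.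
have : (size P <= size D)%N.
  apply: uniq_leq_size.
    rewrite map_inj_in_uniq ?iota_uniq// => k k'; rewrite !mem_iota /= !add0n => kD kD'.
    move=> /(star_inj aP (t01 _ kD) (t01 _ kD')) /(divIf _) h.
    by apply/eqP; rewrite -(eqr_nat R) h// pnatr_eq0 -lt0n.
  move=> x /mapP[k]; rewrite mem_iota add0n => kD ->; apply: contrapT => nD.
  apply: H; exists (a l (k%:R / (size D)%:R)).
  by split; [apply: star_arm; exact: t01|apply/negP].
by rewrite size_map size_iota ltnn.
Qed.

(** A relation between configurations of distinct points of the star, together
    with a set of points visited on the way. It is generated by moving one point
    while the others rest and by permuting the labels. *)
Variable J : (T -> X) -> (T -> X) -> set X -> Prop.
Hypothesis Jsym : forall y y' K, config y -> config y' -> J y y' K -> J y' y K.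
Hypothesis Jtrans : forall y y' y'' K K', config y -> config y' -> config y'' ->
  J y y' K -> J y' y'' K' -> J y y'' (K `|` K').
Hypothesis Jsub : forall y y' K K', K' `<=` K -> J y y' K -> J y y' K'.
Hypothesis Jperm : forall y (g : {perm T}), config y -> J y (y \o g) set0.
Hypothesis Jmove : forall y b (g : R -> X), config y -> continuous g ->
  (forall t, S (g t)) -> g 0 = y b ->
  (forall t m, m != b -> g t <> y m) ->
  J y (place y b (g 1)) [set g t | t in [set t | 0 <= t <= 1]].

Definition between (s t u : R) := (s <= u <= t) || (t <= u <= s).

Lemma config_perm y (g : {perm T}) : config y -> config (y \o g).
Proof.
by move=> [yinj yS]; split=> [m m' /yinj /perm_inj|m]; [|exact: yS].
Qed.

(** A point can take any free place on its arm: a point in between takes that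
    place first and leaves its own. *)
Lemma exchange y b l s t : config y -> 0 <= s <= 1 -> 0 <= t <= 1 ->
  y b = a l s -> (forall m, y m <> a l t) ->
  J y (place y b (a l t)) [set a l u | u in [set u | between s t u]].
Proof.
pose obst (y : T -> X) (b : T) (s t : R) := [pred m : T | (m != b) && `[< exists u, between s t u /\ y m = a l u >]].
have [n] := ubnP #|obst y b s t|.
elim: n y b s t => // n IH y b s t; rewrite ltnS => on yc s01 t01 yb yt.
have bt01 u v w : 0 <= u <= 1 -> 0 <= v <= 1 -> between u v w -> 0 <= w <= 1.
  by rewrite /between; lra.
have st : s != t by apply/eqP => st; apply: (yt b); rewrite yb st.
have [[b' /andP[b'b /asboolP[u [ub yb']]]]|free] := pselect (exists m, obst y b s t m).
  have u01 := bt01 _ _ _ s01 t01 ub.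
  have ut : u != t by apply/eqP => ut; apply: (yt b'); rewrite yb' ut.
  have us : u != s.
    by apply/eqP => us; move/eqP: b'b; apply; apply: yc.1; rewrite yb yb' us.
  pose y1 := place y b' (a l t).
  have y1c : config y1 by apply: config_place => //; exact: star_arm.
  have J1 : J y y1 [set a l v | v in [set v | between u t v]].
    apply: IH => //; apply: leq_trans on; apply: proper_card; apply/properP; split.
      apply/fintype.subsetP => m /andP[mb' /asboolP[v [uv yv]]]; rewrite !inE.
      have v01 := bt01 _ _ _ u01 t01 uv.
      apply/andP; split; last first.
        by apply/asboolP; exists v; split=> //; move: ub uv; rewrite /between; lra.
      apply/eqP => mb; move: yv; rewrite mb yb => /(star_inj aP s01 v01) sv.
      by move: us; rewrite eq_sym sv; move: uv ub ut; rewrite -sv /between; lra.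
    exists b'; rewrite !inE ?eqxx// b'b/=; apply/asboolP; by exists u.
  have y1b : y1 b = a l s by rewrite /y1 /place eq_sym (negbTE b'b).
  have y1u m : y1 m <> a l u.
    rewrite /y1 /place; case: eqP => [_|mb'].
      by move=> /(star_inj aP t01 u01) tu; move: ut; rewrite tu eqxx.
    by rewrite -yb' => /yc.1.
  pose y2 := place y1 b (a l u).
  have y2c : config y2 by apply: config_place => //; exact: star_arm.
  have J2 : J y1 y2 [set a l v | v in [set v | between s u v]].
    apply: IH => //; apply: leq_trans on; apply: proper_card; apply/properP; split.
      apply/fintype.subsetP => m /andP[mb /asboolP[v [uv yv]]]; rewrite !inE mb /=.
      have v01 := bt01 _ _ _ s01 u01 uv.
      apply/asboolP; exists v; split; first by move: ub uv; rewrite /between; lra.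
      move: yv; rewrite /y1 /place; case: eqP => // _ /(star_inj aP t01 v01) tv.
      by exfalso; move: uv ub ut st; rewrite -tv /between; lra.
    exists b'; first by rewrite !inE b'b /=; apply/asboolP; exists u.
    rewrite !inE b'b /=; apply/asboolP => -[v [uv]].
    have v01 := bt01 _ _ _ s01 u01 uv.
    rewrite /y1 /place eqxx => /(star_inj aP t01 v01) tv.
    by move: uv ub ut st; rewrite -tv /between; lra.
  have y3c : config (place y b (a l t)) by apply: config_place => //; exact: star_arm.
  have J3 : J y2 (place y b (a l t)) set0.
    have -> : place y b (a l t) = y2 \o tperm b b'; last exact: Jperm.
    apply/funext => m; rewrite /y2 /y1 /place /=.
    case: tpermP => [->|->|/eqP /negbTE -> /eqP /negbTE ->]; rewrite ?eqxx//.
    - by rewrite (negbTE b'b).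
    - by rewrite (negbTE b'b) yb'.
  apply: Jsub (Jtrans yc y2c y3c (Jtrans yc y1c y2c J1 J2) J3).
  move=> _ [v /= sv <-]; left.
  have [uv|uv] := pselect (between u t v); first by left; exists v.
  by right; exists v => //=; move: ub sv uv; rewrite /between; lra.
pose g tau := a l (s + clamp tau * (t - s)).
have g1 : g 1 = a l t by rewrite /g clampE ?ler01 ?lexx// mul1r addrC subrK.
have gb tau : between s t (s + clamp tau * (t - s)).
  by have /andP[] := clamp_itv tau; rewrite /between; move: (clamp tau) => c c0 c1; nra.
rewrite -g1; apply: Jsub (Jmove yc _ _ _ _); first last.
- move=> tau m mb gm; apply: free; exists m; rewrite inE mb /=; apply/asboolP.
  by exists (s + clamp tau * (t - s)).
- by rewrite /g clampE ?ler01 ?lexx// mul0r addr0 yb.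
- move=> tau; apply: star_arm; exact: bt01 (gb tau).
- move=> tau; apply: continuous_comp; last exact: (star_continuous aP).
  apply: cvgD; first exact: cvg_cst.
  by apply: cvgM; [exact: clamp_continuous|exact: cvg_cst].
- move=> _ [v /= sv <-]; have frac : 0 <= (v - s) / (t - s) <= 1.
    have [ts|ts] := ltP s t.
      rewrite ler_pdivlMr ?subr_gt0// ler_pdivrMr ?subr_gt0//.
      by move: sv; rewrite /between; lra.
    have {}ts : t < s by rewrite lt_neqAle eq_sym st.
    have -> : (v - s) / (t - s) = (s - v) / (s - t).
      by rewrite -[v - s]opprB -[t - s]opprB invrN mulrNN.
    rewrite ler_pdivlMr ?subr_gt0// ler_pdivrMr ?subr_gt0//.
    by move: sv; rewrite /between; lra.
  exists ((v - s) / (t - s)) => //.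
  by rewrite /g clampE// divfK ?subr_eq0 1?eq_sym// addrC subrK.
Qed.

(** Between different arms the centre is crossed; if it is occupied, its
    occupant goes on instead. *)
Lemma relocate y b q : config y -> S q -> (forall m, y m <> q) ->
  J y (place y b q) set0.
Proof.
move=> yc Sq yq; have [l [s [s01 yb]]] := yc.2 b; have [l' [t [t01 qE]]] := Sq.
have z01 : 0 <= (0 : R) <= 1 by rewrite lexx ler01.
have pE k : p = a k 0 by rewrite (star_center aP).
have Sp : S p by rewrite (pE l); exact: star_arm.
have [pb|pb] := pselect (y b = p).
  by apply: Jsub (_ : J y (place y b q) _); [exact: sub0set|];
    rewrite qE; apply: exchange z01 t01 _ _; rewrite -?qE -?pE.
have [[b' b'p]|np] := pselect (exists b', y b' = p); last first.
  have yp m : y m <> p by move=> ymp; apply: np; exists m.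
  pose y1 := place y b p.
  have y1c : config y1 by exact: config_place.
  have [qp|qp] := pselect (q = p).
    apply: Jsub (_ : J y (place y b q) _); first exact: sub0set.
    by rewrite qp (pE l); apply: exchange s01 z01 _ _; rewrite -?pE.
  have y1q m : y1 m <> q by rewrite /y1 /place; case: eqP => // _ /esym.
  have -> : place y b q = place y1 b q.
    by apply/funext => m; rewrite /y1 /place; case: eqP.
  have J1 : J y y1 set0.
    apply: Jsub (_ : J y (place y b p) _); first exact: sub0set.
    by rewrite (pE l); apply: exchange s01 z01 _ _; rewrite -?pE.
  apply: Jsub (Jtrans yc y1c _ J1 _); [exact: sub0set|exact: config_place|].
  by rewrite qE; apply: exchange z01 t01 _ _; rewrite -?qE -?pE// /y1 /place eqxx.
have bb' : b' != b by apply/eqP => bb'; apply: pb; rewrite -bb'.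
have qp : q <> p by move=> qp; apply: (yq b'); rewrite b'p.
pose y1 := place y b' q.
have y1c : config y1 by exact: config_place.
have J1 : J y y1 [set a l' u | u in [set u | between 0 t u]].
  by rewrite /y1 qE; apply: exchange z01 t01 _ _; rewrite -?qE -?pE.
have y1p m : y1 m <> p.
  by rewrite /y1 /place; case: eqP => // mb' ym; apply: mb'; apply: yc.1; rewrite ym.
pose y2 := place y1 b p.
have y2c : config y2 by exact: config_place.
have J2 : J y1 y2 [set a l u | u in [set u | between s 0 u]].
  rewrite /y2 (pE l); apply: exchange s01 z01 _ _; rewrite -?pE//.
  by rewrite /y1 /place eq_sym (negbTE bb').
have -> : place y b q = y2 \o tperm b b'.
  apply/funext => m; rewrite /y2 /y1 /place /=.
  case: tpermP => [->|->|/eqP /negbTE -> /eqP /negbTE ->]; rewrite ?eqxx ?(negbTE bb')//.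
apply: Jsub (Jtrans yc y2c _ (Jtrans yc y1c y2c J1 J2) (Jperm _ y2c)); first exact: sub0set.
exact: config_perm.
Qed.

(** All new places are free, so they can be taken one at a time. *)
Lemma disjoint_joined y w : config y -> config w -> (forall m m', y m <> w m') ->
  J y w set0.
Proof.
move=> yc wc yw; pose h (q : seq T) m := if m \in q then w m else y m.
have hc q : config (h q).
  split=> [m m'|m]; rewrite /h; last by case: ifP => _; [exact: wc.2|exact: yc.2].
  case: ifP => _; case: ifP => _; [exact: wc.1| | |exact: yc.1].
    by move=> /esym /yw.
  by move=> /yw.
have -> : w = h (enum T) by apply/funext => m; rewrite /h mem_enum.
elim: (enum T) => [|b q IH].
  by have := Jperm 1 yc; congr (J _ _ _); apply/funext => m /=; rewrite perm1.
have [bq|bq] := boolP (b \in q).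
  have -> // : h (b :: q) = h q.
  by apply/funext => m; rewrite /h inE; case: eqP => //= ->; rewrite bq.
have -> : h (b :: q) = place (h q) b (w b).
  by apply/funext => m; rewrite /h /place inE; case: eqP => //= ->.
have hb m : h q m <> w b.
  by rewrite /h; case: ifP => [mq /wc.1 mb|_]; [move: bq; rewrite -mb mq|exact: yw].
apply: Jsub (Jtrans yc (hc q) _ IH (relocate b (hc q) (wc.2 b) hb)).
  exact: sub0set.
by apply: config_place => //; exact: wc.2.
Qed.

Lemma fresh_config (B : seq X) : exists w, config w /\ forall m, w m \notin B.
Proof.
have [l] := star_arc aP.
have [w [winj wP]] := @inj_choice X T (fun _ => S) B (fun _ => arm_infinite l).
by exists w; split=> [|m]; [split=> // m; exact: (wP m).1|exact: (wP m).2].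
Qed.

(** The detour through a configuration that avoids both makes all new places free. *)
Lemma config_joined y y' : config y -> config y' -> J y y' set0.
Proof.
move=> yc yc'; have [w [wc wB]] := fresh_config (codom y ++ codom y').
have yw m m' : y m <> w m'.
  by move=> E; have := wB m'; rewrite -E mem_cat codom_f.
have yw' m m' : y' m <> w m'.
  by move=> E; have := wB m'; rewrite -E mem_cat codom_f orbT.
apply: Jsub (Jtrans yc wc yc' (disjoint_joined yc wc yw) _); first exact: sub0set.
by apply: Jsym => //; exact: disjoint_joined.
Qed.

(** A point placed at the centre while the others avoid both ends of an arm can be
    moved to the tip of that arm. *)
Lemma config_sweep y (b : T) : config y -> J y y S.
Proof.
move=> yc.
have arm l : J y y [set a l u | u in [set u | 0 <= u <= 1]].
  have [w [wc wB]] := fresh_config [:: a l 0; a l 1].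
  have z01 : 0 <= (0 : R) <= 1 by rewrite lexx ler01.
  have o01 : 0 <= (1 : R) <= 1 by rewrite lexx ler01.
  have w0 m : w m <> a l 0 by move=> E; have := wB m; rewrite E inE eqxx.
  have w1 m : w m <> a l 1 by move=> E; have := wB m; rewrite E !inE eqxx orbT.
  pose v := place w b (a l 0).
  have vc : config v by apply: config_place => //; exact: star_arm.
  have v1 m : v m <> a l 1.
    rewrite /v /place; case: eqP => // _ /(star_inj aP z01 o01) /eqP.
    by rewrite eq_sym oner_eq0.
  have vc' : config (place v b (a l 1)) by apply: config_place => //; exact: star_arm.
  have vb : v b = a l 0 by rewrite /v /place eqxx.
  have Jv := exchange vc z01 o01 vb v1.
  apply: Jsub (Jtrans yc vc yc (config_joined yc vc)
    (Jtrans vc vc' yc Jv (config_joined vc' yc))).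
  by move=> _ [u /= u01 <-]; right; left; exists u => //=; rewrite /between u01.
apply: (@Jsub _ _ [set x | exists l u, [/\ l \in enum L, 0 <= u <= 1 & x = a l u]]).
  by move=> x [l [u [u01 ->]]]; exists l, u; rewrite mem_enum.
elim: (enum L) => [|l q IH].
  by apply: Jsub (config_joined yc yc) => x [l [u []]].
apply: Jsub (Jtrans yc yc yc (arm l) IH) => x [l' [u []]].
by rewrite inE => /predU1P[->|lq] u01 ->; [left; exists u|right; exists l', u].
Qed.

Theorem tokens_joined y y' : config y -> config y' -> J y y' [set x | S x /\ inhabited T].
Proof.
move=> yc yc'; have [[b]|nT] := pselect (inhabited T).
  apply: Jsub (Jtrans yc yc yc' (config_sweep b yc) (config_joined yc yc')).
  by move=> x [Sx _]; left.
by apply: Jsub (config_joined yc yc') => x [_ /nT].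
Qed.

End Tokens.

(** * Representations grouped into clusters *)

Section ClusterFrames.
Variables (C : numClosedFieldType) (s : nat) (J : finType) (rr : J -> nat).
Variable m : J -> nat.
Implicit Types V : forall c, 'I_(m c) -> 'M[C]_(s, rr c).

(** A frame whose pieces are grouped into clusters c, with m c pieces of the same
    dimension in each. *)
Record cframe V : Prop := {
  cframe1 : forall c j, (V c j)^t* *m V c j = 1%:M ;
  cframe_neq : forall c j j', j != j' -> (V c j)^t* *m V c j' = 0 ;
  cframe_out : forall c c' j j', c != c' -> (V c j)^t* *m V c' j' = 0 ;
  cframe_sum : \sum_c \sum_j V c j *m (V c j)^t* = 1%:M }.

Definition csum V (M : forall c, 'I_(m c) -> 'M[C]_(rr c)) : 'M[C]_s :=
  \sum_c \sum_j V c j *m M c j *m (V c j)^t*.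

(** These matrix units belong to the frame alone; their traces count the pieces of a
    cluster. *)
Definition cunit V c (k l : 'I_(rr c)) : 'M[C]_s :=
  \sum_j V c j *m delta_mx k l *m (V c j)^t*.

Lemma cframe_frame V : cframe V ->
  frame (fun t : {c : J & 'I_(m c)} => V (tag t) (tagged t)).
Proof.
case=> V1 Vn Vo VS; split; last first.
- by rewrite -[RHS]VS (sig_big_dep _ _ (fun c j => V c j *m (V c j)^t*)).
- case=> c j [c' j'] /=; have [cc'|cc' _] := eqVneq c c'; last exact: Vo.
  by move: j'; case: _ / cc' => j'; rewrite eq_Tagged; exact: Vn.
- by move=> t; exact: V1.
Qed.

Lemma csum_sig V M :
  csum V M = \sum_(t : {c : J & 'I_(m c)})
    V (tag t) (tagged t) *m M (tag t) (tagged t) *m (V (tag t) (tagged t))^t*.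
Proof. exact: (sig_big_dep _ _ (fun c j => V c j *m M c j *m (V c j)^t*)). Qed.

Lemma munits_cunit V : cframe V -> munits (cunit V).
Proof.
case=> V1 Vn Vo VS; split.
- move=> c k l l' p; rewrite /cunit mulmx_suml scaler_sumr; apply: eq_bigr => j _.
  rewrite mulmx_sumr (bigD1 j)//= [X in _ + X]big1 ?addr0 => [|j' j'j].
    rewrite -!mulmxA (mulmxA ((V c j)^t*)) V1 mul1mx (mulmxA (delta_mx k l)).
    have [->|ll'] := eqVneq l l'; first by rewrite mul_delta_mx scale1r.
    by rewrite mul_delta_mx_0// mul0mx mulmx0 scale0r.
  by rewrite -!mulmxA (mulmxA ((V c j)^t*)) Vn 1?eq_sym// mul0mx !mulmx0.
- move=> c c' k l k' l' cc'; rewrite /cunit mulmx_suml big1// => j _.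
  rewrite mulmx_sumr big1// => j' _.
  by rewrite -!mulmxA (mulmxA ((V c j)^t*)) Vo// mul0mx !mulmx0.
- move=> c k l; rewrite /cunit adj_sum; apply: eq_bigr => j _.
  by rewrite !adjM trmxCK adj_delta mulmxA.
- rewrite -[RHS]VS; apply: eq_bigr => c _; rewrite exchange_big /=.
  apply: eq_bigr => j _; rewrite -mulmx_suml -mulmx_sumr.
  have -> : \sum_k delta_mx k k = 1%:M :> 'M[C]_(rr c).
    apply/matrixP => p q; rewrite summxE (bigD1 p)//= big1 => [|k kp];
    by rewrite !mxE ?eqxx ?addr0 1?eq_sym ?(negbTE kp)// eq_sym.
  by rewrite mulmx1.
Qed.

Lemma csum_const V (B : forall c, 'M[C]_(rr c)) :
  csum V (fun c _ => B c) = \sum_c \sum_k \sum_l B c k l *: cunit V k l.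
Proof.
apply: eq_bigr => c _; rewrite /cunit.
under [RHS]eq_bigr do under eq_bigr do rewrite scaler_sumr.
under [RHS]eq_bigr do rewrite exchange_big.
rewrite exchange_big /=; apply: eq_bigr => j _.
rewrite {1}[B c]matrix_sum_delta mulmx_sumr mulmx_suml; apply: eq_bigr => k _.
rewrite mulmx_sumr mulmx_suml; apply: eq_bigr => l _.
by rewrite -scalemxAr -scalemxAl.
Qed.

Lemma cunit_trace V c (k : 'I_(rr c)) : cframe V -> \tr (cunit V k k : 'M_s) = (m c)%:R.
Proof.
case=> V1 _ _ _; rewrite /cunit (big_morph _ (@mxtraceD C s) (mxtrace0 C s)).
rewrite -[in RHS](card_ord (m c)) -sum1_card natr_sum; apply: eq_bigr => j _.
rewrite mxtrace_mulC mulmxA V1 mul1mx /mxtrace (bigD1 k)//= big1 ?addr0 => [|p pk];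
  by rewrite mxE ?eqxx// (negbTE pk).
Qed.

Section Conjugation.
Variables (W : 'M[C]_s) (V : forall c, 'I_(m c) -> 'M[C]_(s, rr c)).
Arguments V : clear implicits.

Lemma csum_conj M : W *m csum V M *m W^t* = csum (fun c j => W *m V c j) M.
Proof.
rewrite /csum mulmx_sumr mulmx_suml; apply: eq_bigr => c _.
rewrite mulmx_sumr mulmx_suml; apply: eq_bigr => j _.
by rewrite adjM !mulmxA.
Qed.

Lemma cunit_conj c k l : W *m @cunit V c k l *m W^t* = cunit (fun c j => W *m V c j) k l.
Proof.
rewrite /cunit mulmx_sumr mulmx_suml; apply: eq_bigr => j _.
by rewrite adjM !mulmxA.
Qed.

Lemma cframe_conj : W \is unitarymx -> cframe V -> cframe (fun c j => W *m V c j).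
Proof.
move=> /unitarymxP WW [V1 Vn Vo VS].
have WW' : W^t* *m W = 1%:M by exact: mulmx1C.
have K c c' j j' : (W *m V c j)^t* *m (W *m V c' j') = (V c j)^t* *m V c' j'.
  by rewrite adjM -mulmxA (mulmxA (W^t*)) WW' mul1mx.
split=> [c j|c j j' jj'|c c' j j' cc'|]; rewrite ?K ?V1 ?Vn ?Vo//.
under eq_bigr do under eq_bigr do rewrite adjM -mulmxA (mulmxA _ _ (W^t*)).
under eq_bigr do rewrite -mulmx_sumr -mulmx_suml.
by rewrite -mulmx_sumr -mulmx_suml VS mul1mx.
Qed.

End Conjugation.

Definition ctransport V V' : 'M[C]_s := \sum_c \sum_j V' c j *m (V c j)^t*.

Lemma ctransportE V V' c j : cframe V -> ctransport V V' *m V c j = V' c j.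
Proof.
case=> V1 Vn Vo _; rewrite /ctransport mulmx_suml (bigD1 c)//= [X in _ + X]big1 ?addr0.
  rewrite mulmx_suml (bigD1 j)//= [X in _ + X]big1 ?addr0 => [|j' j'j].
    by rewrite -mulmxA V1 mulmx1.
  by rewrite -mulmxA Vn// mulmx0.
move=> c' c'c; rewrite mulmx_suml big1// => j' _.
by rewrite -mulmxA Vo// mulmx0.
Qed.

Lemma ctransport_unitary V V' : cframe V -> cframe V' -> ctransport V V' \is unitarymx.
Proof.
move=> Vf V'f; apply/unitarymxP.
have E : (ctransport V V')^t* = ctransport V' V.
  rewrite /ctransport adj_sum; apply: eq_bigr => c _; rewrite adj_sum.
  by apply: eq_bigr => j _; rewrite adjM trmxCK.
rewrite E -[RHS](cframe_sum V'f) {2}/ctransport mulmx_sumr; apply: eq_bigr => c _.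
rewrite mulmx_sumr; apply: eq_bigr => j _.
by rewrite mulmxA ctransportE.
Qed.

Section Permutation.
Variables (V : forall c, 'I_(m c) -> 'M[C]_(s, rr c)) (g : forall c, {perm 'I_(m c)}).
Arguments V : clear implicits.

Lemma cunit_perm c k l : cunit (fun c j => V c (g c j)) k l = @cunit V c k l.
Proof.
by rewrite /cunit [RHS](reindex_inj (@perm_inj _ (g c))).
Qed.

(** The order of the points is immaterial: permuting it amounts to permuting the
    frame. *)
Lemma csum_perm M : csum (fun c j => V c (g c j)) (fun c j => M c (g c j)) = csum V M.
Proof.
by apply: eq_bigr => c _; rewrite [RHS](reindex_inj (@perm_inj _ (g c))).
Qed.

Lemma cframe_perm : cframe V -> cframe (fun c j => V c (g c j)).
Proof.
case=> V1 Vn Vo VS; split=> [c j|c j j' jj'|c c' j j' cc'|].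
- exact: V1.
- by apply: Vn; rewrite (inj_eq perm_inj).
- exact: Vo.
rewrite -[RHS]VS; apply: eq_bigr => c _.
by rewrite [RHS](reindex_inj (@perm_inj _ (g c))).
Qed.

End Permutation.

End ClusterFrames.

Section FrameNorms.
Variables (R : realType) (s : nat) (T : finType) (d : T -> nat).
Local Notation C := (R[i]).
Variable U : forall m, 'M[C]_(s, d m).
Hypothesis Uf : frame U.

Lemma opnorm_frame_le (M : forall m, 'M[C]_(d m)) (e : R) : 0 <= e ->
  (forall m, opnorm (M m) <= e) -> opnorm (\sum_m U m *m M m *m (U m)^t*) <= e.
Proof.
move=> e0 Me; have [U1 U0 US] := Uf; apply: opnorm_le => // v.
have ve : enorm v ^+ 2 = \sum_m enorm ((U m)^t* *m v) ^+ 2.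
  apply: (@complexI R); rewrite enorm_sqr rmorph_sum /=.
  rewrite -[X in _ *m X]mul1mx -US mulmx_suml mulmx_sumr summxE.
  apply: eq_bigr => m _; rewrite enorm_sqr.
  by rewrite adjM trmxCK !mulmxA.
have De : enorm ((\sum_m U m *m M m *m (U m)^t*) *m v) ^+ 2 =
    \sum_m enorm (M m *m ((U m)^t* *m v)) ^+ 2.
  apply: (@complexI R); rewrite enorm_sqr rmorph_sum /=.
  rewrite adjM frame_adj -mulmxA (mulmxA (\sum_m _)) frame_mul//.
  rewrite mulmx_suml mulmx_sumr summxE.
  apply: eq_bigr => m _; rewrite enorm_sqr.
  by rewrite !adjM trmxCK !mulmxA.
rewrite -ler_sqr ?nnegrE ?mulr_ge0 ?enorm_ge0// De exprMn ve mulr_sumr.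
apply: ler_sum => m _; rewrite -exprMn ler_sqr ?nnegrE ?mulr_ge0 ?enorm_ge0//.
apply: le_trans (enorm_mul _ _) _.
by apply: ler_wpM2r; [exact: enorm_ge0|exact: Me].
Qed.

Lemma opnorm_frame_ge (M : forall m, 'M[C]_(d m)) m :
  opnorm (M m) <= opnorm (\sum_m U m *m M m *m (U m)^t*).
Proof.
have [U1 U0 _] := Uf; rewrite -(frame_compress U1 U0 M m).
have U1' : opnorm (U m) <= 1 by exact: opnorm_isometry (U1 m).
have Ua : opnorm ((U m)^t*) <= 1 by rewrite opnorm_adj.
move: (\sum_m _) => D.
have h : opnorm ((U m)^t* *m D) <= 1 * opnorm D := opnormM_le Ua (lexx _).
by have := opnormM_le h U1'; rewrite mul1r mulr1.
Qed.

End FrameNorms.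

(** * Joining multiplicity-free representations *)

Section ContinuousMatrices.
Variable R : realType.
Local Notation C := (R[i]).
Local Notation normc := (@Normc.normc R).

Lemma mx_near_opnorm (T : topologicalType) m n (f : T -> 'M[C]_(m, n)) x (e : R) :
  continuous f -> 0 < e -> \forall y \near x, opnorm (f y - f x) < e.
Proof.
move=> /mx_continuousP cf e0; pose h := e / ((m * n)%:R + 1).
have k0 : 0 < (m * n)%:R + 1 :> R by rewrite ltr_wpDl ?ler0n.
have h0 : 0 < h by rewrite divr_gt0.
have : \forall y \near x, forall p : 'I_m * 'I_n, normc (f y p.1 p.2 - f x p.1 p.2) <= h.
  apply: (@filter_forall _ _ _ (nbhs x)) => -[k l] /=.
  have /cvgcP/(_ h h0) := cf k l x; apply: filterS => y.
  by rewrite normcBC => /ltW.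
apply: filterS => y H; apply: (@le_lt_trans _ _ ((m * n)%:R * h)).
  by apply: opnorm_le_entries => k l; rewrite !mxE; exact: (H (k, l)).
by rewrite mulrCA gtr_pMr// ltr_pdivrMr// mul1r ltrDl.
Qed.

Lemma continuous_reparam (T : topologicalType) m n (f : R -> 'M[C]_(m, n)) (h : T -> R) :
  continuous f -> continuous h -> continuous (fun t => f (h t)).
Proof. by move=> cf ch t; exact: continuous_comp (ch t) (cf (h t)). Qed.

Lemma left_half (t : R) : 0 <= t <= 1 ->
  [/\ 0 <= t / 2 <= 1, t / 2 <= 2^-1 & 2 * (t / 2) = t].
Proof. by move=> t01; split; [lra|lra|rewrite mulrC divfK ?pnatr_eq0]. Qed.

Lemma right_half (t : R) : 0 < t <= 1 -> [/\ 0 <= (t + 1) / 2 <= 1,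
  ((t + 1) / 2 <= 2^-1) = false & 2 * ((t + 1) / 2) - 1 = t].
Proof.
move=> t01; split; [lra|by apply/negbTE; rewrite -ltNge; lra|].
by rewrite mulrC divfK ?pnatr_eq0// addrK.
Qed.

(** With minimum and maximum the glued path becomes a sum of continuous ones. *)
Lemma continuous_glue m n (u : R) (f g : R -> 'M[C]_(m, n)) :
  continuous f -> continuous g -> f u = g u ->
  continuous (fun t => if t <= u then f t else g t).
Proof.
move=> cf cg fg.
have -> : (fun t => if t <= u then f t else g t) =
    (fun t => f (Num.min t u) + g (Num.max t u) - f u).
  apply/funext => t; case: leP => tu; first by rewrite -fg addrK.
  by rewrite [f u + _]addrC addrK.
have cmin : continuous (fun t : R => Num.min t u).
  by move=> t; apply: continuous_min; [exact: cvg_id|exact: cvg_cst].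
have cmax : continuous (fun t : R => Num.max t u).
  by move=> t; apply: continuous_max; [exact: cvg_id|exact: cvg_cst].
have cf' : continuous (fun t => f (Num.min t u)).
  exact: continuous_reparam cf cmin.
have cg' : continuous (fun t => g (Num.max t u)).
  exact: continuous_reparam cg cmax.
move: cf' cg' => /mx_continuousP cf' /mx_continuousP cg'.
apply/mx_continuousP => k l t.
rewrite /continuous_at; under eq_fun do rewrite !mxE; rewrite !mxE.
by apply: cvgB; [apply: cvgD; [exact: cf'|exact: cg']|exact: cvg_cst].
Qed.

End ContinuousMatrices.

Section Joining.
Variables (R : realType) (I : finType) (Z : I -> ndgraph R) (r : I -> nat).
Hypothesis r_gt0 : forall i, (0 < r i)%N.
Variable s : nat.
Local Notation C := (R[i]).
Local Notation A := (matfun Z r).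
Local Notation X := ({i : I & Z i}).
Implicit Types rho : A -> 'M[C]_s.

Lemma near_vary (F : seq A) i (p : Z i) (e : R) : 0 < e ->
  \forall z \near p, forall a, a \in F -> opnorm (a i z - a i p) < e.
Proof.
move=> e0; elim: F => [|a F IH]; first by near=> z.
have H := mx_near_opnorm p (@mf_continuous _ _ _ _ a i) e0.
apply: filterS2 H IH => z az Fz b; rewrite inE => /predU1P[->|]; [exact: az|exact: Fz].
Unshelve. all: by end_near.
Qed.

Definition multiplicity_free rho := exists (T : finType) (x : T -> X) U,
  @presents R I Z r s T x U rho /\ injective x.

Definition spec rho (y : X) := exists (T : finType) (x : T -> X) U m,
  @presents R I Z r s T x U rho /\ x m = y.

Definition close (F : seq A) (e : R) rho rho' :=
  forall a, a \in F -> opnorm (rho a - rho' a) < e.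

Lemma nearby_infinite (x : X) (N : set (Z (tag x))) (D : seq X) :
  nbhs (tagged x) N -> exists z, N z /\ existT Z (tag x) z \notin D.
Proof.
move=> /graph_star[L [a [aP aN _]]]; have [l] := star_arc aP.
have [z [az zD]] := arm_infinite aP l (map (tagged_as x) D).
exists z; split; first exact: aN.
apply: contra zD => zD; apply/mapP; exists (existT Z (tag x) z) => //.
by case: x N l z a aP aN az zD => i p /= *; rewrite tagged_asE.
Qed.

(** The points are moved apart within neighbourhoods on which the functions in F vary
    little; there is room for this, as neighbourhoods are infinite. *)
Lemma perturb_multiplicity_free (T : finType) (x : T -> X) U rho (F : seq A) (e : R) : 0 < e ->
  @presents R I Z r s T x U rho -> exists rho', multiplicity_free rho' /\ close F e rho rho'.
Proof.
move=> e0 [Uf rhoE]; have e2 : 0 < e / 2 by rewrite divr_gt0.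
pose N m := [set y : X | exists z, y = existT Z (tag (x m)) z /\
  forall a, a \in F -> opnorm (a (tag (x m)) z - a (tag (x m)) (tagged (x m))) < e / 2].
have [w [winj wN]] : exists w : T -> X, injective w /\ forall m, N m (w m) /\ w m \notin [::].
  apply: inj_choice => m D.
  have [z [Nz zD]] := nearby_infinite D (near_vary F (tagged (x m)) e2).
  by exists (existT Z (tag (x m)) z); split=> //; exists z.
pose z m := sval (cid (wN m).1); pose zP m := svalP (cid (wN m).1).
have wE : w = fun m => existT Z (tag (x m)) (z m).
  by apply/funext => m; exact: (zP m).1.
exists (fun a => \sum_m U m *m a (tag (x m)) (z m) *m (U m)^t*); split.
  exists T, (fun m => existT Z (tag (x m)) (z m)), U; split; last by rewrite -wE.
  by split.
move=> a aF; rewrite rhoE -sumrB.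
apply: (@le_lt_trans _ _ (e / 2)); last by move: e0; lra.
rewrite (eq_bigr (fun m => U m *m (ev a (x m) - a (tag (x m)) (z m)) *m (U m)^t*)).
  apply: opnorm_frame_le => //; first exact: ltW.
  by move=> m; rewrite opnormBC; apply: ltW; exact: (zP m).2.
by move=> m _; rewrite mulmxBr mulmxBl.
Qed.

(** The set K keeps track of points that the path is known to meet; the injectivity
    of the approximating homomorphism will rest on it. *)
Definition joined (F : seq A) (e : R) pi rho rho' (K : set X) :=
  exists g : R -> A -> 'M[C]_s,
  [/\ forall a, continuous (fun t => g t a), g 0 = rho /\ g 1 = rho',
      forall t, multiplicity_free (g t), forall t, close F e pi (g t) &
      forall y, K y -> exists2 t : R, 0 <= t <= 1 & spec (g t) y].

Section JoinedRelation.
Variables (F : seq A) (e : R) (pi : A -> 'M[C]_s).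

Lemma joined_sym rho rho' K : joined F e pi rho rho' K -> joined F e pi rho' rho K.
Proof.
move=> [g [cg [g0 g1] gn gF gK]]; exists (fun t => g (1 - t)); split.
- move=> a; have c1 : continuous (fun t : R => 1 - t).
    by move=> t; apply: cvgB; [exact: cvg_cst|exact: cvg_id].
  exact (continuous_reparam (cg a) c1).
- by rewrite subr0 subrr; split; [exact g1|exact g0].
- by move=> t; exact (gn (1 - t)).
- by move=> t; exact (gF (1 - t)).
move=> y /gK[t t01 yt]; exists (1 - t); last by rewrite subKr.
by move: t01; lra.
Qed.

Lemma joined_sub rho rho' K K' : K' `<=` K ->
  joined F e pi rho rho' K -> joined F e pi rho rho' K'.
Proof. by move=> KK [g [cg g01 gn gF gK]]; exists g; split; [exact cg|exact g01|exact gn|exact gF|move=> y /KK /gK]. Qed.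

Lemma joined_trans rho rho' rho'' K K' : joined F e pi rho rho' K ->
  joined F e pi rho' rho'' K' -> joined F e pi rho rho'' (K `|` K').
Proof.
move=> [g [cg [g0 g1] gn gF gK]] [h [ch [h0 h1] hn hF hK]].
have i20 : 0 < 2^-1 :> R by rewrite invr_gt0.
have i21 : 2^-1 < 1 :> R by rewrite invf_lt1 ?ltr1n.
exists (fun t => if t <= 2^-1 then g (2 * t) else h (2 * t - 1)); split.
- move=> a; have -> : (fun t => (if t <= 2^-1 then g (2 * t) else h (2 * t - 1)) a) =
      (fun t => if t <= 2^-1 then g (2 * t) a else h (2 * t - 1) a).
    by apply/funext => t; case: ifP.
  have c2 : continuous (fun t : R => 2 * t).
    by move=> t; apply: cvgM; [exact: cvg_cst|exact: cvg_id].
  apply: (@continuous_glue R s s 2^-1 (fun t => g (2 * t) a) (fun t => h (2 * t - 1) a)).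
  + exact (continuous_reparam (cg a) c2).
  + have c1 : continuous (fun t : R => 2 * t - 1).
      by move=> t; apply: cvgB; [exact: c2|exact: cvg_cst].
    exact (continuous_reparam (ch a) c1).
  + by rewrite mulfV ?pnatr_eq0// subrr g1 h0.
- rewrite (ltW i20) mulr0 g0 leNgt i21 /= mulr1.
  by rewrite (_ : 2 - 1 = 1) ?h1// -[2]/(1 + 1) addrK.
- by move=> t; case: ifP.
- by move=> t; case: ifP.
move=> y [/gK|/hK] [t t01 yt].
  have [h01 h2 hE] := left_half t01.
  by exists (t / 2); [exact h01|rewrite h2 hE; exact yt].
have [t0|tn0] := eqVneq t 0.
  have tE : 2 * 2^-1 = 1 :> R by rewrite mulfV ?pnatr_eq0.
  exists 2^-1; first by rewrite (ltW i20) (ltW i21).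
  by rewrite lexx tE g1 -h0 -t0; exact yt.
have tp : 0 < t <= 1.
  by rewrite lt_neqAle eq_sym tn0; exact t01.
have [h01 h2' hE] := right_half tp.
by exists ((t + 1) / 2); [exact h01|rewrite h2' hE; exact yt].
Qed.

End JoinedRelation.

Section Clusters.
Variables (J : finType) (ic : J -> I) (S : forall c, set (Z (ic c))).
Arguments S : clear implicits.
Hypothesis Sdisj : forall c c' u u', S c u -> S c' u' ->
  existT Z (ic c) u = existT Z (ic c') u' -> c = c'.

Definition crep m (z : forall c, 'I_(m c) -> Z (ic c))
    (V : forall c, 'I_(m c) -> 'M[C]_(s, r (ic c))) (a : A) : 'M[C]_s :=
  csum V (fun c j => a (ic c) (z c j)).

Definition inside m (z : forall c, 'I_(m c) -> Z (ic c)) := forall c j, S c (z c j).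

Lemma crep_presents m z V : @cframe _ s J (r \o ic) m V ->
  @presents R I Z r s {c : J & 'I_(m c)} (fun t => existT Z (ic (tag t)) (z (tag t) (tagged t)))
   (fun t => V (tag t) (tagged t)) (crep z V).
Proof.
by move=> Vf; split; [exact (cframe_frame Vf)|move=> a; exact (csum_sig _ _)].
Qed.

Lemma crep_multiplicity_free m z V : @cframe _ s J (r \o ic) m V -> inside z ->
  (forall c, injective (z c)) -> multiplicity_free (crep z V).
Proof.
move=> Vf zS zinj; do 3! eexists; split; first exact: crep_presents Vf.
move=> [c j] [c' j'] /= E; have cc' := Sdisj (zS _ _) (zS _ _) E.
move: j' E; case: _ / cc' => j' E.
by rewrite (zinj c j j' (eq_from_Tagged E)).
Qed.

Lemma crep_spec m z V c (j : 'I_(m c)) : @cframe _ s J (r \o ic) m V ->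
  spec (crep z V) (existT Z (ic c) (z c j)).
Proof.
move=> Vf; do 3! eexists; exists (existT (fun c => 'I_(m c)) c j).
by split; first exact: crep_presents Vf.
Qed.

(** The type of an isometry depends on its point. Points and isometries are therefore
    packed into pairs, so that both are transported together. *)
Lemma regroup (T : finType) (x : T -> X) U rho :
  @presents R I Z r s T x U rho ->
  (forall t, exists c u, S c u /\ x t = existT Z (ic c) u) ->
  exists (m : J -> nat) z V, [/\ @cframe _ s J (r \o ic) m V, @inside m z,
    injective x -> forall c, injective (z c), rho = crep z V &
    forall t, exists c j, x t = existT Z (ic c) (z c j)].
Proof.
move=> [[U1 U0 US] rhoE] xS.
pose cl t := sval (cid (xS t)).
have clP t : exists u, S (cl t) u /\ x t = existT Z (ic (cl t)) u.
  exact: svalP (cid (xS t)).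
pose fib c := [pred t | cl t == c]; pose m c := #|fib c|.
pose pt c (j : 'I_(m c)) : T := enum_val j.
have clpt c j : cl (pt c j) = c.
  by have := enum_valP j; rewrite inE => /eqP.
pose pk t : {y : X & 'M[C]_(s, r (tag y))} := existT _ (x t) (U t).
have H c (j : 'I_(m c)) : exists zV : Z (ic c) * 'M[C]_(s, r (ic c)),
    S c zV.1 /\ pk (pt c j) = existT _ (existT Z (ic c) zV.1) zV.2.
  have [] := clP (pt c j); rewrite clpt => u [Su xE].
  rewrite /pk; move: (U (pt c j)); rewrite xE => W.
  by exists (u, W).
pose zV c j := sval (cid (H c j)).
have zVP c j : S c (zV c j).1 /\ pk (pt c j) = existT _ (existT Z (ic c) (zV c j).1) (zV c j).2.
  exact: svalP (cid (H c j)).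
have sumE n (f : {y : X & 'M[C]_(s, r (tag y))} -> 'M[C]_n) : \sum_t f (pk t) =
    \sum_c \sum_(j < m c) f (existT _ (existT Z (ic c) (zV c j).1) (zV c j).2).
  rewrite (partition_big cl predT)//=; apply: eq_bigr => c _.
  rewrite (eq_bigl (fun t => t \in fib c)) => [|t]; last by rewrite inE.
  by rewrite big_enum_val; apply: eq_bigr => j _; rewrite -(zVP c j).2.
exists m, (fun c j => (zV c j).1), (fun c j => (zV c j).2); split.
- split.
  + move=> c j; have := U1 (pt c j).
    rewrite -[_ = _]/((fun P : {y : X & 'M[C]_(s, r (tag y))} =>
      (projT2 P)^t* *m projT2 P = 1%:M) (pk (pt c j))).
    by rewrite (zVP c j).2.
  + move=> c j j' jj'.
    have : pt c j != pt c j' by rewrite (inj_eq enum_val_inj).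
    move=> /U0; rewrite -[_ = _]/((fun P Q : {y : X & 'M[C]_(s, r (tag y))} =>
      (projT2 P)^t* *m projT2 Q = 0) (pk (pt c j)) (pk (pt c j'))).
    by rewrite (zVP c j).2 (zVP c j').2.
  + move=> c c' j j' cc'.
    have : pt c j != pt c' j' by apply: contra_neq cc' => E; rewrite -(clpt c j) E clpt.
    move=> /U0; rewrite -[_ = _]/((fun P Q : {y : X & 'M[C]_(s, r (tag y))} =>
      (projT2 P)^t* *m projT2 Q = 0) (pk (pt c j)) (pk (pt c' j'))).
    by rewrite (zVP c j).2 (zVP c' j').2.
  + by rewrite -[RHS]US (sumE s (fun P => projT2 P *m (projT2 P)^t*)).
- by move=> c j; exact: (zVP c j).1.
- move=> xinj c j j' E; apply: enum_val_inj; apply: xinj.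
  rewrite -[LHS]/(projT1 (pk (pt c j))) -[RHS]/(projT1 (pk (pt c j'))).
  by rewrite (zVP c j).2 (zVP c j').2 /= E.
- apply/funext => a; rewrite rhoE.
  exact: (sumE s (fun P => projT2 P *m ev a (projT1 P) *m (projT2 P)^t*)).
- move=> t; have tf : t \in fib (cl t) by rewrite inE.
  exists (cl t), (enum_rank_in tf t).
  rewrite -[LHS]/(projT1 (pk t)) -{1}(enum_rankK_in tf tf).
  by rewrite (zVP _ _).2.
Qed.

End Clusters.

End Joining.

Lemma three_quarters (R : realType) (e : R) : 0 < e -> e / 4 + (e / 4 + e / 4) < e.
Proof. by lra. Qed.

Lemma half_le (R : realType) (d e : R) : 0 < d -> d <= e / 2 -> e / 2 <= e.
Proof. by lra. Qed.

Section Walks.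
Variables (R : realType) (I : finType) (Z : I -> ndgraph R) (r : I -> nat).
Hypothesis r_gt0 : forall i, (0 < r i)%N.
Variable s : nat.
Local Notation C := (R[i]).
Local Notation A := (matfun Z r).
Local Notation X := ({i : I & Z i}).
Local Notation normc := (@Normc.normc R).
Variables (J : finType) (ic : J -> I) (p : forall c, Z (ic c)).
Variables (L : J -> finType) (arm : forall c, L c -> R -> Z (ic c)).
Arguments arm : clear implicits.
Hypothesis armP : forall c, star (p c) (arm c).
Local Notation S c := (star_set (arm c)).
Hypothesis Sdisj : forall c c' u u', S c u -> S c' u' ->
  existT Z (ic c) u = existT Z (ic c') u' -> c = c'.
Variables (m : J -> nat) (z0 : forall c, 'I_(m c) -> Z (ic c)).
Variable V0 : forall c, 'I_(m c) -> 'M[C]_(s, r (ic c)).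
Arguments z0 : clear implicits.
Arguments V0 : clear implicits.
Local Notation cframe := (@cframe _ s J (r \o ic) m).
Local Notation cunit V c k l := (@cunit _ s J (r \o ic) m V c k l : 'M[C]_s).
Implicit Types V W : forall c, 'I_(m c) -> 'M[C]_(s, r (ic c)).
Implicit Types z : forall c, 'I_(m c) -> Z (ic c).
Hypothesis m_gt0 : forall c, (0 < m c)%N.
Hypothesis z0S : inside (fun c => S c) z0.
Hypothesis V0f : cframe V0.
Variables (F : seq A) (e eta d : R).
Hypothesis e0 : 0 < e.
Hypothesis small_var : forall a c u u', a \in F -> S c u -> S c u' ->
  opnorm (a (ic c) u - a (ic c) u') <= e / 4.
Hypothesis eta_small : forall a, a \in F ->
  eta * (\sum_c \sum_(k < r (ic c)) \sum_(l < r (ic c)) normc (a (ic c) (p c) k l)) <= e / 4.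

Local Notation pi := (crep z0 V0).

Definition near_frame (b : R) (V : forall c, 'I_(m c) -> 'M[C]_(s, r (ic c))) := cframe V /\
  forall c k l, opnorm (cunit V c k l - cunit V0 c k l) <= b.

Lemma star_centre c : S c (p c).
Proof.
have [l] := star_arc (armP c).
by exists l, 0; rewrite lexx ler01 (star_center (armP c)).
Qed.

(** A representation with its points in the stars is determined, up to the
    oscillation of the functions on the stars, by its matrix units. *)
Lemma near_close z V : near_frame eta V -> inside (fun c => S c) z ->
  close F e pi (crep z V).
Proof.
move=> [Vf Vn] zS a aF.
pose Q W : 'M[C]_s := csum W (fun c _ => a (ic c) (p c)).
have vary (W : forall c, 'I_(m c) -> 'M[C]_(s, r (ic c))) y : cframe W -> inside (fun c => S c) y -> opnorm (crep y W a - Q W) <= e / 4.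
  move=> Wf yS; rewrite /crep /Q !csum_sig -sumrB.
  rewrite (eq_bigr (fun t : {c : J & 'I_(m c)} => W (tag t) (tagged t) *m
    (a (ic (tag t)) (y (tag t) (tagged t)) - a (ic (tag t)) (p (tag t))) *m
    (W (tag t) (tagged t))^t*)).
    apply: (opnorm_frame_le (cframe_frame Wf)); first by rewrite divr_ge0 ?ltW.
    by move=> t; apply: small_var aF (yS _ _) _; exact: star_centre.
  by move=> t _; rewrite mulmxBr mulmxBl.
have h1 := vary _ _ V0f z0S.
have h2 := vary _ _ Vf zS; rewrite opnormBC in h2.
have h3 : opnorm (Q V0 - Q V) <= e / 4.
  apply: le_trans (eta_small aF); rewrite opnormBC /Q !csum_const -sumrB mulr_sumr.
  apply: le_trans (opnorm_sum _ _ _) _; apply: ler_sum => c _.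
  rewrite -sumrB mulr_sumr.
  apply: le_trans (opnorm_sum _ _ _) _; apply: ler_sum => k _.
  rewrite -sumrB mulr_sumr.
  apply: le_trans (opnorm_sum _ _ _) _; apply: ler_sum => l _.
  rewrite -scalerBr mulrC; apply: le_trans (opnormZ_le _ _) _.
  by apply: ler_wpM2l; [exact: normc_ge0|exact: Vn].
have h4 := opnorm_tri (pi a) (Q V0) (crep z V a).
have h5 := opnorm_tri (Q V0) (Q V) (crep z V a).
apply: le_lt_trans h4 _; apply: le_lt_trans (lerD h1 (le_trans h5 (lerD h3 h2))) _.
exact: three_quarters e0.
Qed.

Definition placed (z : forall c, 'I_(m c) -> Z (ic c)) :=
  inside (fun c => S c) z /\ forall c, injective (z c).

Hypothesis d0 : 0 < d.
Hypothesis d_eta : d <= eta / 2.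
Hypothesis frame_path : forall (W : 'M[C]_s) V, cframe V -> W \is unitarymx ->
  (forall c k l, opnorm (W *m cunit V c k l *m W^t* - cunit V c k l) <= 2 * d) ->
  exists Wt : R -> 'M[C]_s,
    [/\ continuous Wt, forall t, Wt t \is unitarymx, Wt 0 = 1%:M /\ Wt 1 = W &
        forall t c k l, opnorm (Wt t *m cunit V c k l *m (Wt t)^t* - cunit V c k l) <= eta / 2].

(** Points and frame may be changed independently, since the frames that are
    close to the given one are all joined to each other. *)
Definition walk z z' (K : set X) := forall V V', near_frame d V -> near_frame d V' ->
  joined F e pi (crep z V) (crep z' V') K.

(** The points rest; the unitary that transports one frame to the other moves the
    matrix units only a little. *)
Lemma walk_refl z : placed z -> walk z z set0.
Proof.
move=> [zS zinj] V V' [Vf Vn] [V'f V'n].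
pose W := ctransport V V'.
have Wu : W \is unitarymx by exact (ctransport_unitary Vf V'f).
have WV : (fun c j => W *m V c j) = V'.
  apply: functional_extensionality_dep => c; apply/funext => j.
  exact (ctransportE V' j Vf).
have Wn c k l : opnorm (W *m cunit V c k l *m W^t* - cunit V c k l) <= 2 * d.
  rewrite cunit_conj WV.
  apply: le_trans (opnorm_tri _ (cunit V0 c k l) _) _.
  have h1 := V'n c k l; have h2 := Vn c k l; rewrite opnormBC in h2.
  by rewrite mulr_natl mulr2n; exact: lerD h1 h2.
have [Wt [cW Wtu [W0 W1] Wtn]] := frame_path Vf Wu Wn.
exists (fun t a => Wt t *m crep z V a *m (Wt t)^t*); split.
- move=> a; apply: continuous_mulmx; last exact (continuous_adj cW).
  by apply: continuous_mulmx; [exact: cW|exact: continuous_cst_mx].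
- split; apply/funext => a; first by rewrite W0 mul1mx adj1 mulmx1.
  by rewrite W1 /crep csum_conj WV.
- move=> t; have -> : (fun a => Wt t *m crep z V a *m (Wt t)^t*) =
      crep z (fun c j => Wt t *m V c j).
    by apply/funext => a; rewrite /crep csum_conj.
  exact (crep_multiplicity_free Sdisj (cframe_conj (Wtu t) Vf) zS zinj).
- move=> t; have -> : (fun a => Wt t *m crep z V a *m (Wt t)^t*) =
      crep z (fun c j => Wt t *m V c j).
    by apply/funext => a; rewrite /crep csum_conj.
  apply: near_close zS; split; first exact (cframe_conj (Wtu t) Vf).
  move=> c k l; rewrite -cunit_conj.
  apply: le_trans (opnorm_tri _ (cunit V c k l) _) _.
  have h1 := Wtn t c k l; have h2 := le_trans (Vn c k l) d_eta.
  by rewrite [leRHS](splitr eta); exact: lerD h1 h2.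
- by [].
Qed.

Lemma walk_sub z z' K K' : K' `<=` K -> walk z z' K -> walk z z' K'.
Proof.
move=> KK w V V' Vn V'n.
exact (joined_sub KK (w V V' Vn V'n)).
Qed.

Lemma walk_sym z z' K : walk z z' K -> walk z' z K.
Proof.
move=> w V V' Vn V'n.
exact (joined_sym (w V' V V'n Vn)).
Qed.

Lemma walk_trans z z' z'' K K' : walk z z' K -> walk z' z'' K' -> walk z z'' (K `|` K').
Proof.
have V0n : near_frame d V0.
  by split=> // c k l; rewrite subrr opnorm0 ltW.
move=> w w' V V' Vn V'n.
exact (joined_trans (w V V0 Vn V0n) (w' V0 V' V0n V'n)).
Qed.

(** Permuted points with some frame are the given points with the frame permuted back,
    whose matrix units are the same. *)
Lemma walk_perm z (g : forall c, {perm 'I_(m c)}) : placed z ->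
  walk z (fun c j => z c (g c j)) set0.
Proof.
move=> zP V V' Vn [V'f V'n].
pose h c : {perm 'I_(m c)} := ((g c)^-1)%g.
have E : crep (fun c j => z c (g c j)) V' = crep z (fun c j => V' c (h c j)).
  apply/funext => a; rewrite /crep -[RHS](csum_perm _ g); congr (csum _ _).
  apply: functional_extensionality_dep => c; apply/funext => j.
  by rewrite /h permK.
rewrite E; apply: walk_refl zP _ _ Vn _; split; first exact (cframe_perm h V'f).
by move=> c k l; rewrite (cunit_perm V' h); exact: V'n.
Qed.

Lemma placed_dfwith z c (y : 'I_(m c) -> Z (ic c)) : placed z ->
  (injective y /\ forall j, S c (y j)) -> placed (dfwith z y).
Proof.
move=> [zS zinj] [yinj yS]; split=> [c' j|c'].
  by have [cc'|cc'] := eqVneq c c'; [case: _ / cc' j => j; rewrite dfwith_in|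
    rewrite dfwith_out].
by have [<-|cc'] := eqVneq c c'; [rewrite dfwith_in|rewrite dfwith_out].
Qed.

Lemma walk_move z c (b : 'I_(m c)) (g : R -> Z (ic c)) : placed z -> continuous g ->
  (forall t, S c (g t)) -> g 0 = z c b -> (forall t j, j != b -> g t <> z c j) ->
  walk z (dfwith z (place (z c) b (g 1)))
    [set existT Z (ic c) (g t) | t in [set t | 0 <= t <= 1]].
Proof.
move=> zP cg gS g0 gz V V' [Vf Vn] V'n.
have placedg t : placed (dfwith z (place (z c) b (g t))).
  have [zS zinj] := zP; apply: (placed_dfwith zP); split=> [j j'|j]; rewrite /place.
    case: eqP => [->|/eqP jb]; case: eqP => [->|/eqP j'b] // E.
    - by case: (gz t j').
    - by case: (gz t j).
    - exact: zinj E.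
  by case: eqP.
pose zt t := dfwith z (place (z c) b (g t)).
suff J1 : joined F e pi (crep z V) (crep (zt 1) V)
    [set existT Z (ic c) (g t) | t in [set t | 0 <= t <= 1]].
  have := joined_trans J1 (walk_refl (placedg 1) (conj Vf Vn) V'n).
  by rewrite setU0.
have ptc c' j : continuous (fun t => zt t c' j).
  rewrite /zt; have [cc'|cc'] := eqVneq c c'; last first.
    move=> t; under eq_fun do rewrite dfwith_out//.
    exact: cvg_cst.
  case: _ / cc' j => j t; under eq_fun do rewrite dfwith_in.
  rewrite /place; case: eqP => _; [exact: cg|exact: cvg_cst].
exists (fun t => crep (zt t) V); split.
- move=> a; apply: continuous_sum_mx => c'; apply: continuous_sum_mx => j.
  apply: continuous_mulmx; last exact: continuous_cst_mx.
  apply: continuous_mulmx; first exact: continuous_cst_mx.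
  move=> t; exact: continuous_comp (ptc c' j t) (@mf_continuous _ _ _ _ a (ic c') _).
- split; last by [].
  have -> // : zt 0 = z.
  rewrite /zt; apply: functional_extensionality_dep => c'; apply/funext => j.
  have [cc'|cc'] := eqVneq c c'; last by rewrite dfwith_out.
  by case: _ / cc' j => j; rewrite dfwith_in /place; case: eqP => // ->.
- by move=> t; have [zS zinj] := placedg t; exact (crep_multiplicity_free Sdisj Vf zS zinj).
- move=> t; have [zS _] := placedg t; apply: near_close zS; split; first exact Vf.
  move=> c' k l; apply: le_trans (Vn c' k l) _; apply: le_trans d_eta _.
  exact: half_le d0 d_eta.
- move=> _ [t /= t01 <-]; exists t; first exact t01.
  have -> : g t = zt t c b by rewrite /zt dfwith_in /place eqxx.
  exact (crep_spec _ b Vf).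
Qed.

Lemma dfwith_dfwith z c (y y' : 'I_(m c) -> Z (ic c)) :
  dfwith (dfwith z y) y' = dfwith z y'.
Proof.
apply: functional_extensionality_dep => c'.
have [<-|cc'] := eqVneq c c'; first by rewrite !dfwith_in.
by rewrite !dfwith_out.
Qed.

Lemma walk_cluster z c (y : 'I_(m c) -> Z (ic c)) : placed z ->
  (injective y /\ forall j, S c (y j)) ->
  walk z (dfwith z y) [set existT Z (ic c) u | u in S c].
Proof.
move=> zP yP.
pose Jc (y1 y2 : 'I_(m c) -> Z (ic c)) (K : set (Z (ic c))) := walk (dfwith z y1) (dfwith z y2)
  [set existT Z (ic c) u | u in K].
have : Jc (z c) y [set u | S c u /\ inhabited 'I_(m c)].
  apply (tokens_joined (armP c)).
  - by move=> y1 y2 K _ _; exact: walk_sym.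
  - move=> y1 y2 y3 K K' _ _ _ w w'; apply: walk_sub (walk_trans w w').
    by rewrite image_setU.
  - by move=> y1 y2 K K' KK; apply: walk_sub; exact: image_subset.
  - move=> y1 g y1P; rewrite /Jc image_set0.
    have := @walk_perm (dfwith z y1) (dfwith (fun c => 1%g : {perm 'I_(m c)}) g)
      (placed_dfwith zP y1P).
    have -> // : (fun c' j => dfwith z y1 c' (dfwith (fun c => 1%g : {perm 'I_(m c)}) g c' j)) =
        dfwith z (y1 \o g).
      apply: functional_extensionality_dep => c'; apply/funext => j.
      have [cc'|cc'] := eqVneq c c'; last by rewrite !dfwith_out// perm1.
      by case: _ / cc' j => j; rewrite !dfwith_in.
  - move=> y1 b g y1P cg gS g0 gy.
    have E : dfwith z y1 c = y1 by rewrite dfwith_in.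
    have := @walk_move (dfwith z y1) c b g (placed_dfwith zP y1P) cg gS.
    rewrite E dfwith_dfwith => /(_ g0 gy); rewrite /Jc -image_comp.
    by [].
  - by split; [exact: zP.2|exact: zP.1].
  - exact yP.
rewrite /Jc.
have -> : dfwith z (z c) = z.
  apply: functional_extensionality_dep => c'.
  by have [<-|cc'] := eqVneq c c'; [rewrite dfwith_in|rewrite dfwith_out].
apply: walk_sub => _ [u Su <-]; exists u => //; split=> //.
by constructor; exact: Ordinal (m_gt0 c).
Qed.

Lemma walk_all z z' : placed z -> placed z' ->
  walk z z' [set x | exists c u, S c u /\ x = existT Z (ic c) u].
Proof.
move=> zP z'P; pose h (q : seq J) c := if c \in q then z' c else z c.
have hP q : placed (h q).
  split=> [c j|c]; rewrite /h; case: ifP => _; [exact: z'P.1|exact: zP.1|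
    exact: z'P.2|exact: zP.2].
have -> : z' = h (enum J).
  by apply: functional_extensionality_dep => c; rewrite /h mem_enum.
apply: (@walk_sub _ _ [set x | exists c u, [/\ c \in enum J, S c u & x = existT Z (ic c) u]]).
  by move=> x [c [u [Su ->]]]; exists c, u; rewrite mem_enum.
elim: (enum J) => [|c q IH].
  have -> : h [::] = z by apply: functional_extensionality_dep.
  by apply: walk_sub (walk_refl zP) => x [c [u []]].
have -> : h (c :: q) = dfwith (h q) (z' c).
  apply: functional_extensionality_dep => c'; rewrite /h inE.
  have [->|cc'] := eqVneq c' c; first by rewrite dfwith_in.
  by rewrite dfwith_out// eq_sym.
have z'c : injective (z' c) /\ forall j, S c (z' c j).
  by split; [exact: z'P.2|exact: z'P.1].
apply: walk_sub (walk_trans IH (walk_cluster (hP q) z'c)).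
move=> x [c' [u [+ Su ->]]]; rewrite inE => /predU1P[E|c'q].
  by right; move: u Su; rewrite E => u Su; exists u.
by left; exists c', u.
Qed.

End Walks.

Section LocalJoining.
Variables (R : realType) (I : finType) (Z : I -> ndgraph R) (r : I -> nat).
Hypothesis r_gt0 : forall i, (0 < r i)%N.
Variable s : nat.
Local Notation C := (R[i]).
Local Notation A := (matfun Z r).
Local Notation X := ({i : I & Z i}).
Local Notation normc := (@Normc.normc R).

Lemma sum_graph_hausdorff : hausdorff_space X.
Proof. by apply: sigT_hausdorff => i; exact: graph_hausdorff. Qed.

(** Urysohn's lemma, applied in each summand. *)
Lemma separation (P Q : set X) : closed P -> closed Q ->
  (forall x, P x -> Q x -> False) ->
  exists f : forall i, Z i -> R, [/\ forall i, continuous (f i),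
    forall x, P x -> at_pt f x = 0 & forall x, Q x -> at_pt f x = 1].
Proof.
move=> Pc Qc PQ.
have cl (D : set X) i : closed D -> closed [set z : Z i | D (existT Z i z)].
  move=> Dc; apply: (closed_comp (f := existT Z i)) => // z _.
  exact: existT_continuous.
have H i : exists f : Z i -> R, [/\ continuous f,
    forall z, P (existT Z i z) -> f z = 0 & forall z, Q (existT Z i z) -> f z = 1].
  have : uniform_separator [set z : Z i | P (existT Z i z)] [set z | Q (existT Z i z)].
    apply: normal_uniform_separator; [|exact: cl|exact: cl|].
      by apply: compact_normal; [exact: graph_hausdorff|exact: ndgraph_compact].
    by apply/seteqP; split=> // z [/= /PQ]; exact.
  move=> /(@uniform_separatorP _ R)[f [cf _ f0 f1]].
  by exists f; split=> // z Dz; [apply: f0|apply: f1]; exists z.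
exists (fun i => sval (cid (H i))).
by split=> [i|[i z]|[i z]]; have [] := svalP (cid (H i)) => // _; [move=> + _|move=> _]; exact.
Qed.

Lemma separate_points (T : finType) (x : T -> X) : injective x ->
  exists N : T -> set X, (forall c, nbhs (x c) (N c)) /\
    forall c c' y, N c y -> N c' y -> c = c'.
Proof.
move=> xinj.
have H (q : T * T) : exists B : set X * set X, [/\ nbhs (x q.1) B.1, nbhs (x q.2) B.2 &
    q.1 != q.2 -> forall y, B.1 y -> B.2 y -> False].
  have [E|E] := eqVneq q.1 q.2; first by exists (setT, setT); split=> //; exact: filterT.
  apply: contrapT => nB; move/eqP: E; apply; apply: xinj.
  apply: sum_graph_hausdorff => D D' ND ND'; apply: contrapT => /set0P/negP.
  rewrite negbK => /eqP DD'; apply: nB; exists (D, D'); split=> // _ y Dy D'y.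
  by have : (D `&` D') y by []; rewrite DD'.
have [B BP] := choice H.
exists (fun c => [set y | forall c', (B (c, c')).1 y /\ (B (c', c)).2 y]); split.
  move=> c; apply: (@filter_forall _ _ _ (nbhs (x c))) => c'.
  have [b1 _ _] := BP (c, c'); have [_ b2 _] := BP (c', c).
  exact: filterI b1 b2.
move=> c c' y Ny N'y; apply/eqP; apply/negPn/negP => cc'.
have [_ _ H'] := BP (c, c'); apply: (H' cc' y); [exact: (Ny c').1|exact: (N'y c).2].
Qed.

(** The clusters are indexed by the distinct values of x. *)
Lemma star_neighbourhoods (T : finType) (x : T -> X) (F : seq A) (e : R) : 0 < e ->
  exists (J : finType) (ic : J -> I) (p : forall c, Z (ic c)) (L : J -> finType)
    (arm : forall c, L c -> R -> Z (ic c)),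
  [/\ forall c, star (p c) (arm c),
      forall c c' u u', star_set (arm c) u -> star_set (arm c') u' ->
        existT Z (ic c) u = existT Z (ic c') u' -> c = c',
      forall c, nbhs (p c) (star_set (arm c)),
      forall a c u u', a \in F -> star_set (arm c) u -> star_set (arm c) u' ->
        opnorm (a (ic c) u - a (ic c) u') <= e &
      (forall t, exists c, x t = existT Z (ic c) (p c)) /\
      forall c, exists t, existT Z (ic c) (p c) = x t].
Proof.
move=> e0; have e2 : 0 < e / 2 by rewrite divr_gt0.
pose J : finType := seq_sub (codom x); pose ic (c : J) := tag (ssval c).
pose p (c : J) : Z (ic c) := tagged (ssval c).
have pE c : existT Z (ic c) (p c) = ssval c by rewrite /ic /p; case: (ssval c).
have [N [Nn Ndisj]] := separate_points (x := fun c : J => ssval c) val_inj.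
have H c : exists LA : {L : finType & L -> R -> Z (ic c)},
    [/\ star (p c) (projT2 LA), star_set (projT2 LA) `<=` [set z | N c (existT Z (ic c) z) /\
         forall a, a \in F -> opnorm (a (ic c) z - a (ic c) (p c)) < e / 2] &
        nbhs (p c) (star_set (projT2 LA))].
  have [|L [a [aP aN an]]] := @graph_star R (Z (ic c)) (p c) [set z | N c (existT Z (ic c) z) /\
         forall a, a \in F -> opnorm (a (ic c) z - a (ic c) (p c)) < e / 2].
    apply: filterI; last exact: near_vary.
    by apply: existT_continuous; rewrite pE; exact: Nn.
  by exists (existT _ L a).
pose LA c := sval (cid (H c)); pose LAP c := svalP (cid (H c)).
exists J, ic, p, (fun c => projT1 (LA c)), (fun c => projT2 (LA c)); split.
- by move=> c; have [] := LAP c.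
- move=> c c' u u'; have [_ SN _] := LAP c; have [_ SN' _] := LAP c'.
  move=> /SN[Nu _] /SN'[Nu' _] E; apply: (Ndisj c c' _ Nu).
  by rewrite E.
- by move=> c; have [] := LAP c.
- move=> a c u u' aF; have [_ SN _] := LAP c => /SN[_ /(_ a aF) h1] /SN[_ /(_ a aF) h2].
  apply: le_trans (opnorm_tri _ (a (ic c) (p c)) _) _.
  rewrite opnormBC in h2; rewrite [leRHS](splitr e); exact: lerD (ltW h1) (ltW h2).
- split=> [t|c]; first by exists (SeqSub (codom_f x t)); rewrite pE.
  by have /codomP[t tE] := ssvalP c; exists t; rewrite pE.
Qed.

Section ClusterTests.
Variables (J : finType) (ic : J -> I) (p : forall c, Z (ic c)).
Variables (L : J -> finType) (arm : forall c, L c -> R -> Z (ic c)).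
Arguments arm : clear implicits.
Hypothesis armP : forall c, star (p c) (arm c).
Local Notation S c := (star_set (arm c)).
Hypothesis Sdisj : forall c c' u u', S c u -> S c' u' ->
  existT Z (ic c) u = existT Z (ic c') u' -> c = c'.
Hypothesis Snbhs : forall c, nbhs (p c) (S c).

(** A representation on which this element is small has all its points in the
    stars. *)
Lemma centre_test : exists a : A, (forall c, a (ic c) (p c) = 0) /\
  forall i z, (forall c u, S c u -> existT Z i z <> existT Z (ic c) u) -> a i z = 1%:M.
Proof.
pose P : set X := range (fun c => existT Z (ic c) (p c)).
pose W : set X := \bigcup_c (existT Z (ic c) @` (S c)^°).
have Pc : closed P.
  apply (accessible_finite_set_closed.1 (hausdorff_accessible sum_graph_hausdorff)).
  by apply: finite_image; exact: finite_finset.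
have Wo : open W.
  by apply: bigcup_open => c _; apply: existT_open_map; exact: open_interior.
have [|f [cf fP fW]] := separation Pc (open_closedC Wo).
  move=> _ [c _ <-]; apply; exists c => //; exists (p c) => //.
  exact: Snbhs.
have [a [_ aE]] := @central_exists R I Z r f cf.
exists a; split=> [c|i z nS]; rewrite aE.
  by rewrite [f _ _](fP (existT Z (ic c) (p c)))// ?raddf0//; exists c.
rewrite [f _ _](fW (existT Z i z))// => -[c _ [u Su uE]].
by apply: (nS c u); [exact: interior_subset Su|rewrite uE].
Qed.

(** A representation with all its points in the stars takes this element to a matrix
    unit of the cluster c. *)
Lemma unit_test c (k l : 'I_(r (ic c))) : exists a : A,
  (forall u, S c u -> a (ic c) u = delta_mx k l) /\
  forall c' u, c' != c -> S c' u -> a (ic c') u = 0.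
Proof.
have Dc c' : closed (existT Z (ic c') @` (S c')).
  apply: compact_closed; first exact: sum_graph_hausdorff.
  apply: continuous_compact; last exact: star_compact (armP c').
  by apply: continuous_subspaceT; exact: existT_continuous.
have Pc : closed (\bigcup_(c' in [set c' | c' != c]) (existT Z (ic c') @` (S c'))).
  by apply: closed_bigcup => //; exact: finite_finset.
have [|f [cf fP fS]] := separation Pc (Dc c).
  move=> x [c' /= c'c [u' Su' <-]] [u Su uE].
  by move/eqP: c'c; apply; apply: Sdisj Su' Su (esym uE).
exists (@scalar_fun R I Z r f (@unit_family R I r (ic c) k l) cf); split=> [u Su|c' u c'c Su].
  by rewrite /= unit_familyE [f _ _](fS (existT Z (ic c) u)) ?scale1r.
rewrite /= [f _ _](fP (existT Z (ic c') u)) ?scale0r//.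
by exists c' => //; exists u.
Qed.

End ClusterTests.

Lemma scale_bound (u b : R) : 0 < u -> 0 <= b -> u / (b + 1) * b <= u.
Proof.
move=> u0 b0; have b1 : 0 < b + 1 by rewrite ltr_wpDl.
rewrite mulrAC ler_pdivrMr// ler_pM2l//.
by rewrite lerDl.
Qed.

Lemma mxtrace_le_opnorm (M : 'M[C]_s) : normc (\tr M) <= s%:R * opnorm M.
Proof.
rewrite /mxtrace; apply: (@le_trans _ _ (\sum_(k < s) opnorm M)).
  elim/big_ind2 : _ => [|x b y c xb yc|k _].
  - by rewrite Normc.normc0.
  - exact: le_trans (ler_normcD _ _) (lerD xb yc).
  - exact: normc_le_opnorm.
by rewrite sumr_const card_ord mulr_natl.
Qed.

Lemma close_nat (m n : nat) : normc (m%:R - n%:R : C) < 1 -> m = n.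
Proof.
have E : (m%:R - n%:R : C) = (m%:R - n%:R : R)%:C.
  by rewrite (rmorphB (@real_complex R)) !rmorph_nat.
rewrite E normcR; case: (ltngtP m n) => // mn.
  by rewrite distrC -(natrB R (ltnW mn)) (normr_nat R) -[X in _ < X](mulr1n 1) ltr_nat ltnS leqn0 subn_eq0 leqNgt mn.
by rewrite -(natrB R (ltnW mn)) (normr_nat R) -[X in _ < X](mulr1n 1) ltr_nat ltnS leqn0 subn_eq0 leqNgt mn.
Qed.

(** Close matrix units have equal traces, so both representations have as many points in
    each star as pi has, and [walk_all] carries one to the other. On the way whole stars
    are swept, and these contain the points of all representations close to pi. *)
Theorem local_joined (T0 : finType) (x0 : T0 -> X) U0 (pi : A -> 'M[C]_s) (F : seq A) (e : R) :
  @presents R I Z r s T0 x0 U0 pi -> 0 < e ->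
  exists (G : seq A) (d : R) (K : set X), [/\ 0 < d,
    forall rho rho', multiplicity_free rho -> multiplicity_free rho' -> close G d pi rho -> close G d pi rho' ->
      joined F e pi rho rho' K &
    forall (T : finType) (x : T -> X) U sigma, @presents R I Z r s T x U sigma ->
      close G d pi sigma -> forall t, K (x t)].
Proof.
move=> pres0 e0; have e4 : 0 < e / 4 by rewrite divr_gt0.
have [J [ic [p [L [arm [armP Sdisj Snbhs small_var [x0p px0]]]]]]] :=
  star_neighbourhoods x0 F e4.
have Sp c : star_set (arm c) (p c) by exact: nbhs_singleton (Snbhs c).
have [ga [ga0 ga1]] := centre_test Snbhs.
pose hu (q : {c : J & 'I_(r (ic c)) * 'I_(r (ic c))}%type) :=
  sval (cid (unit_test armP Sdisj (tagged q).1 (tagged q).2)).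
pose huP (q : {c : J & 'I_(r (ic c)) * 'I_(r (ic c))}%type) := svalP (cid (unit_test armP Sdisj (tagged q).1 (tagged q).2)).
pose G := ga :: codom hu.
pose K := [set y | exists c u, star_set (arm c) u /\ y = existT Z (ic c) u].
have insideK d (T : finType) (x : T -> X) U sigma : @presents R I Z r s T x U sigma -> d <= 1 ->
    close G d pi sigma -> forall t, exists c u, star_set (arm c) u /\ x t = existT Z (ic c) u.
  move=> [Uf sE] d1 cl t; apply: contrapT => nS.
  have h : opnorm (sigma ga) < 1.
    apply: lt_le_trans d1; have := cl ga (mem_head _ _).
    have [_ piE] := pres0.
    have -> : pi ga = 0.
      rewrite piE big1// => t' _; have [c cE] := x0p t'.
      have -> : ev ga (x0 t') = 0 by move: (U0 t'); rewrite cE => ?; exact: ga0.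
      by rewrite mulmx0 mul0mx.
    by rewrite sub0r opnormN.
  have h' : opnorm (ev ga (x t)) < 1.
    apply: le_lt_trans h; rewrite sE.
    exact (opnorm_frame_ge Uf (fun t => ev ga (x t)) t).
  have := le_lt_trans (normc_le_opnorm _ (Ordinal (r_gt0 _)) (Ordinal (r_gt0 _))) h'.
  rewrite /ev ga1; first by rewrite mxE eqxx Normc.normc1 ltxx.
  move=> c u Su E; apply: nS; exists c, u; split=> //.
  by rewrite -E; case: (x t).
have [c0|m [z0 [V0 [V0f z0S _ piE x0z]]]] := regroup (S := fun c => star_set (arm c)) pres0 _.
  by have [c cE] := x0p c0; exists c, (p c).
have m_gt0 c : (0 < m c)%N.
  have [t tE] := px0 c; have [c' [j jE]] := x0z t.
  have cc' := Sdisj _ _ _ _ (Sp c) (z0S _ _) (etrans tE jE).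
  by rewrite cc'; exact: leq_ltn_trans (ltn_ord j).
have unitE m' z V c (k l : 'I_(r (ic c))) : @inside _ _ _ _ ic (fun c => star_set (arm c)) m' z ->
    crep z V (hu (existT _ c (k, l))) = @cunit _ s J (fun c => r (ic c)) m' V c k l.
  move=> zS; have [h1 h0] := huP (existT _ c (k, l)).
  rewrite /crep /csum (bigD1 c)//= [X in _ + X]big1 ?addr0 => [|c' c'c].
    by apply: eq_bigr => j _; rewrite h1.
  by rewrite big1// => j _; rewrite h0// mulmx0 mul0mx.
pose B (a : A) : R := \sum_c \sum_(k < r (ic c)) \sum_(l < r (ic c)) normc (a (ic c) (p c) k l).
have B0 a : 0 <= B a by do 3!apply: sumr_ge0 => ? _; exact: normc_ge0.
have B1 a : 0 < B a + 1 by rewrite ltr_wpDl.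
have [a aF|eta eta0 etaP] := @min_seq_gt0 R A F (fun a => e / 4 / (B a + 1)).
  by rewrite divr_gt0.
have eta_small a : a \in F -> eta * B a <= e / 4.
  move=> aF; apply: le_trans (ler_wpM2r (B0 a) (etaP a aF)) _.
  exact: scale_bound.
have eta2 : 0 < eta / 2 by rewrite divr_gt0.
have [delta delta0 pathP] := @unitary_path_close R J (fun c => r (ic c)) (fun c => r_gt0 (ic c)) _ eta2.
(* The last bound forces the traces that count the points of a cluster, being natural
   numbers, to agree. *)
have [d [d0 d1 d_eta d_delta ds]] : exists d : R, [/\ 0 < d, d <= 1, d <= eta / 2,
    2 * d <= delta & s%:R * d < 1].
  have s1 : 0 < s%:R + 1 :> R by rewrite ltr_wpDl.
  pose d := Num.min (Num.min 1 (eta / 2)) (Num.min (delta / 2) (s%:R + 1)^-1).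
  exists d; split.
  - by rewrite !lt_min ltr01 eta2 divr_gt0// invr_gt0.
  - by rewrite !ge_min lexx.
  - by rewrite !ge_min lexx !orbT.
  - by rewrite -ler_pdivlMl// mulrC !ge_min lexx !orbT.
  apply: (@le_lt_trans _ _ (s%:R * (s%:R + 1)^-1)).
    by rewrite ler_wpM2l// !ge_min lexx !orbT.
  by rewrite ltr_pdivrMr// mul1r ltrDl.
exists G, d, K; split=> //; last by move=> T x U sigma sP cl t; exact: insideK sP d1 cl t.
have config_of rho : multiplicity_free rho -> close G d pi rho ->
    exists z (V : forall c, 'I_(m c) -> 'M[C]_(s, r (ic c))),
    [/\ placed arm z, near_frame V0 d V & rho = crep z V].
  move=> [T [x [U [pres xinj]]]] cl.
  have [|m' [z [V [Vf zS zinj rhoE _]]]] := regroup (S := fun c => star_set (arm c)) pres _.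
    exact: insideK pres d1 cl.
  have cu c k l : opnorm (@cunit _ s J (fun c => r (ic c)) m' V c k l -
      @cunit _ s J (fun c => r (ic c)) m V0 c k l) < d.
    rewrite -(unitE _ _ _ _ _ _ zS) -(unitE _ _ _ _ _ _ z0S) -rhoE -piE opnormBC.
    by apply: cl; rewrite inE codom_f orbT.
  have mm' : m' = m.
    apply/funext => c; apply: close_nat.
    pose k := Ordinal (r_gt0 (ic c)).
    rewrite -(cunit_trace k Vf) -(cunit_trace k V0f) -raddfB.
    apply: le_lt_trans (mxtrace_le_opnorm _) _; apply: le_lt_trans ds.
    by apply: ler_wpM2l; [exact: ler0n|exact: ltW (cu c k k)].
  subst m'; exists z, V; split=> //; first by split=> //; exact: zinj.
  by split=> // c k l; exact: ltW (cu c k l).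
move=> rho rho' rn rn' cl cl'.
have [z [V [zP Vn ->]]] := config_of rho rn cl.
have [z' [V' [z'P V'n ->]]] := config_of rho' rn' cl'.
rewrite piE.
have frame_path (W : 'M[C]_s) (Y : forall c, 'I_(m c) -> 'M[C]_(s, r (ic c))) :
    @cframe _ s J (r \o ic) m Y -> W \is unitarymx ->
    (forall c k l, opnorm (W *m (@cunit _ s J (r \o ic) m Y c k l : 'M[C]_s) *m W^t* -
       (@cunit _ s J (r \o ic) m Y c k l : 'M[C]_s)) <= 2 * d) ->
    exists Wt : R -> 'M[C]_s, [/\ continuous Wt, forall t, Wt t \is unitarymx,
      Wt 0 = 1%:M /\ Wt 1 = W & forall t c k l,
      opnorm (Wt t *m (@cunit _ s J (r \o ic) m Y c k l : 'M[C]_s) *m (Wt t)^t* -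
        (@cunit _ s J (r \o ic) m Y c k l : 'M[C]_s)) <= eta / 2].
  move=> Yf Wu Wn.
  exact (pathP s _ W (munits_cunit Yf) Wu (fun c k l => le_trans (Wn c k l) d_delta)).
exact (walk_all armP Sdisj m_gt0 z0S V0f e0 small_var eta_small d0 d_eta frame_path
  zP z'P Vn V'n).
Qed.

End LocalJoining.

(** * Approximation along a graph *)

Lemma interpolate (R : realType) (u v t : R) : u < v -> 0 <= t <= 1 ->
  u <= u + t * (v - u) <= v.
Proof. by move=> uv t01; nra. Qed.

Section Following.
Variables (R : realType) (I : finType) (Z : I -> ndgraph R) (r : I -> nat).
Hypothesis r_gt0 : forall i, (0 < r i)%N.
Variable s : nat.
Local Notation C := (R[i]).
Local Notation A := (matfun Z r).
Local Notation X := ({i : I & Z i}).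
Implicit Types rho : A -> 'M[C]_s.

Definition presented rho := exists (T : finType) (x : T -> X) U,
  @presents R I Z r s T x U rho.

Lemma close_sub (F G : seq A) (d e : R) (pi rho : A -> 'M[C]_s) :
  {subset F <= G} -> d <= e -> close G d pi rho -> close F e pi rho.
Proof. by move=> FG de cl a /FG /cl h; exact: lt_le_trans h de. Qed.

Lemma close_trans (F : seq A) (d e : R) (pi pi' rho : A -> 'M[C]_s) :
  close F d pi pi' -> close F e pi' rho -> close F (d + e) pi rho.
Proof.
move=> c1 c2 a aF; apply: le_lt_trans (opnorm_tri _ (pi' a) _) _.
exact: ltrD (c1 a aF) (c2 a aF).
Qed.

Lemma close_sym (F : seq A) (e : R) (pi rho : A -> 'M[C]_s) :
  close F e pi rho -> close F e rho pi.
Proof. by move=> cl a /cl; rewrite opnormBC. Qed.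

Lemma near_close_family (Y : topologicalType) (pi : Y -> A -> 'M[C]_s) y
    (F : seq A) (e : R) : (forall a, continuous (fun y => pi y a)) -> 0 < e ->
  \forall y' \near y, close F e (pi y) (pi y').
Proof.
move=> cpi e0; elim: F => [|a F IH]; first by near=> y'.
have H := mx_near_opnorm y (cpi a) e0.
apply: filterS2 H IH => y' ay Fy b; rewrite inE => /predU1P[->|bF]; last exact: Fy.
by rewrite opnormBC.
Unshelve. all: by end_near.
Qed.

Section Paths.
Variables (pi : R -> A -> 'M[C]_s) (F : seq A) (e : R).
Hypothesis pi_presented : forall t, presented (pi t).
Hypothesis pi_continuous : forall a, continuous (fun t => pi t a).
Hypothesis e0 : 0 < e.

(** The tests G and the bound d precede the representations at the ends, so that these
    can be chosen close enough for several paths at once: for two adjacent intervals,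
    or for all edges at a vertex. *)
Definition follows (u v : R) := exists (G : seq A) (d : R), 0 < d /\
  forall rho rho', multiplicity_free rho -> multiplicity_free rho' -> close G d (pi u) rho ->
    close G d (pi v) rho' -> exists g : R -> A -> 'M[C]_s,
  [/\ forall a, continuous (fun t => g t a), g u = rho /\ g v = rho',
      forall t, multiplicity_free (g t), forall t, u <= t <= v -> close F e (pi t) (g t) &
      forall t y, u <= t <= v -> spec (pi t) y ->
        exists t', u <= t' <= v /\ spec (g t') y].

(** Over a short interval the path hardly moves, and [local_joined] at t0 applies. *)
Lemma follows_local t0 : exists2 h : R, 0 < h & forall u v, u < v ->
  `|u - t0| < h -> `|v - t0| < h -> follows u v.
Proof.
have [T0 [x0 [U0 pres0]]] := pi_presented t0.
have e2 : 0 < e / 2 by rewrite divr_gt0.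
have [G [d [K [d0 GJ GK]]]] := local_joined r_gt0 F pres0 e2.
have d2 : 0 < d / 2 by rewrite divr_gt0.
have H := near_close_family t0 (G ++ F) pi_continuous (_ : 0 < Num.min (e / 2) (d / 2)).
have /H/nbhs_ballP[h /= h0 hP] : 0 < Num.min (e / 2) (d / 2) by rewrite lt_min e2 d2.
have cF t : `|t - t0| < h -> close F (e / 2) (pi t) (pi t0).
  move=> th; apply: close_sym; have : ball t0 h t by rewrite /ball /= distrC.
  move=> /hP; apply: close_sub; last by rewrite ge_min lexx.
  by move=> a aF; rewrite mem_cat aF orbT.
have cG t : `|t - t0| < h -> close G (d / 2) (pi t0) (pi t).
  move=> th; have : ball t0 h t by rewrite /ball /= distrC.
  move=> /hP; apply: close_sub; last by rewrite ge_min lexx orbT.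
  by move=> a aG; rewrite mem_cat aG.
have mid u v t : `|u - t0| < h -> `|v - t0| < h -> u <= t <= v -> `|t - t0| < h.
  by rewrite !ltr_norml; lra.
exists h => // u v uv uh vh; exists G, (d / 2); split=> // rho rho' rn rn' ru rv.
have cl : close G d (pi t0) rho by rewrite (splitr d); exact: close_trans (cG u uh) ru.
have cl' : close G d (pi t0) rho' by rewrite (splitr d); exact: close_trans (cG v vh) rv.
have [g [cg [g0 g1] gn gF gK]] := GJ rho rho' rn rn' cl cl'.
have vu0 : 0 < v - u by rewrite subr_gt0.
exists (fun t => g ((t - u) / (v - u))); split.
- move=> a; have c1 : continuous (fun t : R => (t - u) / (v - u)).
    move=> t; apply: cvgM; last exact: cvg_cst.
    by apply: cvgB; [exact: cvg_id|exact: cvg_cst].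
  exact (continuous_reparam (cg a) c1).
- by rewrite subrr mul0r divff ?gt_eqF.
- by move=> t; exact (gn ((t - u) / (v - u))).
- move=> t t01; rewrite (splitr e); apply: close_trans (cF t _) (gF ((t - u) / (v - u))).
  exact: mid uh vh t01.
move=> t y tuv [T [x [U [k [pres <-]]]]].
have /gK[t' t'01 yt'] : K (x k).
  apply: (GK _ _ _ _ pres); have h2 : d / 2 <= d by rewrite ler_pdivrMr// ler_peMr ?ler1n// ltW.
  apply: close_sub h2 (cG t _) => //; exact: mid uh vh tuv.
exists (u + t' * (v - u)); split.
  exact: interpolate uv t'01.
by rewrite addrAC subrr add0r mulfK ?gt_eqF.
Qed.

Lemma follows_cat u w v : u < w -> w < v -> follows u w -> follows w v -> follows u v.
Proof.
move=> uw wv [G [d [d0 H]]] [G' [d' [d'0 H']]].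
exists (G ++ G'), (Num.min d d'); split; first by rewrite lt_min d0.
have subG : {subset G <= G ++ G'} by move=> a aG; rewrite mem_cat aG.
have subG' : {subset G' <= G ++ G'} by move=> a aG; rewrite mem_cat aG orbT.
have dm : Num.min d d' <= d by rewrite ge_min lexx.
have d'm : Num.min d d' <= d' by rewrite ge_min lexx orbT.
move=> rho rho' rn rn' cl cl'.
have [T [x [U pres]]] := pi_presented w.
have dd0 : 0 < Num.min d d' by rewrite lt_min d0.
have [rhow [rwn rwc]] := perturb_multiplicity_free (G ++ G') dd0 pres.
have [g [cg [g0 g1] gn gF gK]] := H rho rhow rn rwn (close_sub subG dm cl) (close_sub subG dm rwc).
have [k [ck [k0 k1] kn kF kK]] := H' rhow rho' rwn rn' (close_sub subG' d'm rwc) (close_sub subG' d'm cl').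
exists (fun t => if t <= w then g t else k t); split.
- move=> a; have -> : (fun t => (if t <= w then g t else k t) a) =
      (fun t => if t <= w then g t a else k t a) by apply/funext => t; case: ifP.
  by apply: (continuous_glue (cg a) (ck a)); rewrite g1 k0.
- by rewrite (ltW uw) g0 leNgt wv.
- by move=> t; case: ifP => _; [exact (gn t)|exact (kn t)].
- move=> t /andP[ut tv]; case: leP => [tw|/ltW wt].
    by apply (gF t); rewrite ut tw.
  by apply (kF t); rewrite wt tv.
move=> t y /andP[ut tv] yt; case: (leP t w) => [tw|/ltW wt].
  have [|t' [/andP[ut' t'w] yt']] := gK t y _ yt; first by rewrite ut tw.
  exists t'; split; first by rewrite ut' (le_trans t'w (ltW wv)).
  by rewrite t'w.
have [|t' [/andP[wt' t'v] yt']] := kK t y _ yt; first by rewrite wt tv.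
exists t'; split; first by rewrite t'v (le_trans (ltW uw) wt').
have [t'w|//] := leP t' w; have t'E : t' = w by apply/le_anti; rewrite t'w wt'.
by rewrite t'E g1 -k0 -t'E.
Qed.

Lemma follows_edge : follows 0 1.
Proof.
apply: interval_chaining => [t t01|u w v _ uw wv _]; last exact: follows_cat.
have [h h0 hP] := follows_local t; exists h => // u v _ uv _; exact: hP.
Qed.

End Paths.

(** At each vertex one multiplicity-free representation is chosen, close enough for all
    edges; then each edge is followed between those chosen at its ends. *)
Theorem graph_approx (Y : ndgraph R) (pi : Y -> A -> 'M[C]_s) (F : seq A) (e : R) :
  (forall y, presented (pi y)) -> (forall a, continuous (fun y => pi y a)) -> 0 < e ->
  exists rho : Y -> A -> 'M[C]_s, [/\ forall a, continuous (fun y => rho y a),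
    forall y, multiplicity_free (rho y), forall y, close F e (pi y) (rho y) &
    forall y x, spec (pi y) x -> exists y', spec (rho y') x].
Proof.
move=> pip cpi e0; have [V [E [c cP]]] := graph_cells Y.
have fol k : follows (fun t => pi (c k t)) F e 0 1.
  refine (follows_edge F (fun t => pip (c k t)) _ e0).
  have ck : continuous (c k) by exact: cells_continuous cP k.
  exact (fun a t => continuous_comp (ck t) (cpi a (c k t))).
have [G GP] := choice fol; have [d dP] := choice GP.
have d0 k : 0 < d k := (dP k).1.
have fP k := (dP k).2.
have [k _|dm dm0 dmP] := @min_seq_gt0 R E (enum E) d; first exact: d0.
pose Gs := flatten [seq G k | k <- enum E].
have subG k : {subset G k <= Gs}.
  by move=> a aG; apply/flattenP; exists (G k) => //; rewrite map_f ?mem_enum.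
have Hv y : exists rho, multiplicity_free rho /\ close Gs dm (pi y) rho.
  have [T [x [U pres]]] := pip y; exact: perturb_multiplicity_free dm0 pres.
have [v vP] := choice Hv.
have vc k y : close (G k) (d k) (pi y) (v y).
  by apply: close_sub (vP y).2 => //; exact: dmP (mem_enum _ _).
have Hg k := fP k _ _ (vP (c k 0)).1 (vP (c k 1)).1 (vc k (c k 0)) (vc k (c k 1)).
have [g gP] := choice Hg.
have Hrho y : exists rho, forall k t, 0 <= t <= 1 -> c k t = y -> rho = g k t.
  have [Vy|nVy] := pselect (V y).
    exists (v y) => k t t01 yE; have [_ [g0 g1] _ _ _] := gP k.
    have [t0|t1] : t = 0 \/ t = 1 by apply: (cells_vertex (k := k) cP t01); rewrite yE.
      by rewrite t0 g0 -t0 yE.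
    by rewrite t1 g1 -t1 yE.
  have [k [t [t01 yE]]] := cells_surj cP y; exists (g k t) => k' t' t'01 yE'.
  have inner k1 t1 : 0 <= t1 <= 1 -> c k1 t1 = y -> 0 < t1 < 1.
    move=> /andP[t0 t1'] ty; rewrite !lt_neqAle t0 t1' !andbT.
    have [V0 V1] := cells_end cP k1.
    by apply/andP; split; apply/eqP => tE; apply: nVy; rewrite -ty -?tE// tE.
  by have [-> ->] := cells_inj cP (inner _ _ t01 (esym yE)) (inner _ _ t'01 yE') (etrans (esym yE) (esym yE')).
have [rho rhoP] := choice Hrho.
have at_edge y : exists k t, [/\ 0 <= t <= 1, y = c k t & rho y = g k t].
  have [k [t [t01 yE]]] := cells_surj cP y.
  by exists k, t; split=> //; exact: rhoP t01 (esym yE).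
exists rho; split.
- move=> a; apply: (cells_continuousP cP) => k.
  apply: (@subspace_eq_continuous _ _ _ (fun t => g k t a)).
    by move=> t; rewrite inE /= in_itv /= => t01;
      exact (congr1 (fun h => h a) (esym (rhoP _ k _ t01 erefl))).
  apply: continuous_subspaceT; have [cg _ _ _ _] := gP k; exact: cg.
- by move=> y; have [k [t [_ _ ->]]] := at_edge y; have [_ _ gn _ _] := gP k.
- move=> y; have [k [t [t01 yE ->]]] := at_edge y; have [_ _ _ gF _] := gP k.
  by rewrite yE; exact: gF.
move=> y x; have [k [t [t01 -> _]]] := at_edge y; have [_ _ _ _ gK] := gP k.
move=> /(gK t x t01)[t' [t'01 xt']]; exists (c k t').
by rewrite (rhoP _ _ _ t'01 erefl).
Qed.

End Following.

Lemma frame_mxdiag (C : numClosedFieldType) s (T : finType) (d : T -> nat)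
    (U : forall t, 'M[C]_(s, d t)) : frame U ->
  exists W : 'M[C]_(s, \sum_(k < #|T|) d (enum_val k)),
    [/\ W *m W^t* = 1%:M, W^t* *m W = 1%:M & forall M : forall t, 'M[C]_(d t),
      \sum_t U t *m M t *m (U t)^t* = W *m (\mxdiag_(k < #|T|) M (enum_val k)) *m W^t*].
Proof.
move=> [U1 U0 US]; pose W := \mxrow_(k < #|T|) U (enum_val k).
have WE : W^t* = \mxcol_(k < #|T|) (U (enum_val k))^t*.
  by rewrite /W tr_mxrow; apply/matrixP => p q; rewrite !mxE.
have WM (M : forall t, 'M[C]_(d t)) :
    \sum_t U t *m M t *m (U t)^t* = W *m (\mxdiag_(k < #|T|) M (enum_val k)) *m W^t*.
  rewrite WE /W mul_mxrow_mxdiag mul_mxrow_mxcol.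
  by rewrite (big_enum_val (A := T) (fun t => U t *m M t *m (U t)^t*)).
exists W; split=> //.
  rewrite -[RHS]US WE /W mul_mxrow_mxcol.
  by rewrite (big_enum_val (A := T) (fun t => U t *m (U t)^t*)).
rewrite WE /W mul_mxcol_mxrow -mxdiagZ /mxdiag.
apply: eq_mxblock => j k; have [jk|jk] := eqVneq j k.
  by move: jk => <-; rewrite conform_mx_id U1.
by rewrite U0// (inj_eq enum_val_inj).
Qed.

Section Approximation.
Variables (R : realType) (I J : finType).
Variables (Z : I -> ndgraph R) (r : I -> nat) (Y : J -> ndgraph R) (s : J -> nat).
Hypothesis r_gt0 : forall i, (0 < r i)%N.
Local Notation C := (R[i]).
Local Notation A := (matfun Z r).
Local Notation B := (matfun Y s).
Local Notation X := ({i : I & Z i}).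
Implicit Types f : A -> B.

Definition at_point f j (y : Y j) (a : A) : 'M[C]_(s j) := f a j y.

Lemma star_rep_at f j (y : Y j) : star_hom f -> unital f -> star_rep (@at_point f j y).
Proof.
move=> fh f1; split.
- by move=> c a b; rewrite /at_point (star_homD fh) (star_homZ fh).
- by move=> a b; rewrite /at_point; have := star_homM fh a b => /= ->.
- by move=> a; rewrite /at_point; have := star_homS fh a => /= ->.
- by rewrite /at_point f1.
Qed.

Lemma presents_star_rep n (T : finType) (x : T -> X) U rho :
  @presents R I Z r n T x U rho -> star_rep rho.
Proof.
move=> [[U1 U0 US] rE]; split.
- move=> c a b; rewrite !rE scaler_sumr -big_split; apply: eq_bigr => t _.
  by rewrite mulmxDr mulmxDl -scalemxAr -scalemxAl.
- by move=> a b; rewrite !rE (frame_mul U1 U0).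
- by move=> a; rewrite !rE frame_adj.
- by rewrite rE -[RHS]US; apply: eq_bigr => t _; rewrite mulmx1.
Qed.

(** If no evaluation after f contained the one at x, compactness would give an
    element that is nonzero at x and is killed by f. *)
Lemma spectrum_covers f : star_hom f -> unital f -> injective f ->
  forall x : X, exists j (y : Y j), spec (@at_point f j y) x.
Proof.
move=> fh f1 finj x; apply: contrapT => nx.
pose P (D : set {j : J & Y j}) := exists a h, [/\ central a h, 0 < at_pt h x &
  forall w, D w -> f a (tag w) (tagged w) = 0].
have : P setT.
  apply: compact_ind; first exact: sum_graph_compact.
  - have c1 i : continuous (fun _ : Z i => 1 : R) by move=> z; exact: cvg_cst.
    have [a ca] := central_exists r c1.
    by exists a, (fun _ _ => 1); split.
  - move=> D E [a [h [[ch aE] hx aD]]] [b [g [[cg bE] gx bD]]].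
    exists (matfunM a b), (fun i z => h i z * g i z); split.
    + split=> [i z|i z]; first by apply: cvgM; [exact: ch|exact: cg].
      by rewrite (rmorphM (@real_complex R)) scalar_mxM -aE -bE.
    + exact: mulr_gt0.
    + have := star_homM fh a b => /= -> w /= [/aD ->|/bD ->].
        by rewrite mul0mx.
      by rewrite mulmx0.
  - by move=> D E DE [a [h [ah hx aE]]]; exists a, h; split=> // w /DE; exact: aE.
  - move=> [j y].
    have [T [w [U pres]]] := rep_presented r_gt0 (star_rep_at y fh f1).
    have wx t : w t <> x.
      by move=> wtx; apply: nx; exists j, y, T, w, U, t.
    have Pc : closed (range w).
      apply (accessible_finite_set_closed.1 (hausdorff_accessible (@sum_graph_hausdorff R I Z))).
      by apply: finite_image; exact: finite_finset.
    have Qc : closed [set x].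
      apply (accessible_finite_set_closed.1 (hausdorff_accessible (@sum_graph_hausdorff R I Z))).
      exact: finite_set1.
    have [|h [ch hw hx]] := separation Pc Qc.
      by move=> _ [t _ <-] /wx.
    have [a ah] := @central_exists R I Z r h ch; have [_ aE] := ah.
    have fa0 : f a j y = 0.
      have [_ rE] := pres; rewrite -[LHS]/(at_point f y a) rE big1// => t _.
      by rewrite /ev aE [h _ _](hw (w t)) ?raddf0 ?mulmx0 ?mul0mx//; exists t.
    have i20 : 0 < 2^-1 :> R by rewrite invr_gt0.
    (* Near y all points satisfy h < 1/2, so the part g of h above 1/2 is killed. *)
    pose g i z : R := Num.max 0 (h i z - 2^-1).
    have cg i : continuous (fun z : Z i => Num.max (0 : R) (h i z - 2^-1)).
      move=> z; apply: (@continuous_max R (Z i) (fun _ => 0) (fun z => h i z - 2^-1) z); first exact: cvg_cst.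
      by apply: cvgB; [exact: ch|exact: cvg_cst].
    have [b bg] := @central_exists R I Z r g cg; have [_ bE] := bg.
    have nb : \forall y' \near y, opnorm (f a j y' - f a j y) < 2^-1.
      exact: mx_near_opnorm (@mf_continuous _ _ _ _ (f a) j) i20.
    exists (existT _ j @` [set y' | opnorm (f a j y' - f a j y) < 2^-1]).
      exact: existT_nbhs.
    exists b, g; split=> //.
      rewrite /at_pt /g [h _ _](hx x)// lt_max; apply/orP; right.
      by rewrite subr_gt0 invf_lt1 ?ltr1n.
    move=> _ [y' /= + <-]; rewrite fa0 subr0 => fa /=.
    have [T' [w' [U' [U'f rE]]]] := rep_presented r_gt0 (star_rep_at y' fh f1).
    rewrite -[LHS]/(at_point f y' b) rE big1// => t _.
    have le : opnorm (ev a (w' t)) < 2^-1.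
      apply: le_lt_trans fa; rewrite -[f a j y']/(at_point f y' a) rE.
      exact (opnorm_frame_ge U'f (fun t => ev a (w' t)) t).
    have k := Ordinal (r_gt0 (tag (w' t))).
    have := le_lt_trans (normc_le_opnorm _ k k) le.
    rewrite /ev aE mxE eqxx mulr1n normcR => /ltr_normlW hle.
    rewrite bE /g max_l ?raddf0 ?mulmx0 ?mul0mx//.
    by rewrite subr_le0 ltW.
move=> [a [h [[_ aE] hx fa]]].
have a0 : a = 0.
  apply: finj; have -> : f 0 = 0 by rewrite -(subrr (0 : A)) (star_homB fh) subrr.
  by apply: matfunP => j y; exact: (fa (existT _ j y)).
have := aE (tag x) (tagged x); rewrite a0 => /matrixP /(_ (Ordinal (r_gt0 _)) (Ordinal (r_gt0 _))).
by rewrite !mxE eqxx mulr1n => /esym /complexI h0; move: hx; rewrite /at_pt h0 ltxx.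
Qed.

(** All properties but injectivity hold point by point. An element in the kernel of the
    new map vanishes at the points of all the new representations, which still cover
    the domain. *)
Theorem approximate f (F : seq A) (e : R) : star_hom f -> unital f -> injective f -> 0 < e ->
  exists g : A -> B, [/\ star_hom g, unital g, injective g, maximally_homogeneous g &
    forall a, a \in F -> supnorm (f a - g a) <= e].
Proof.
move=> fh f1 finj e0.
have H j : exists rho : Y j -> A -> 'M[C]_(s j), [/\ forall a, continuous (fun y => rho y a),
    forall y, multiplicity_free (rho y), forall y, close F e (@at_point f j y) (rho y) &
    forall y x, spec (@at_point f j y) x -> exists y', spec (rho y') x].
  apply: (graph_approx r_gt0 F) => //.
    by move=> y; exact: (rep_presented r_gt0 (star_rep_at y fh f1)).
  by move=> a; exact: mf_continuous.
pose rho j := sval (cid (H j)); pose rhoP j := svalP (cid (H j)).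
have rc a j : continuous (fun y => rho j y a) by have [h _ _ _] := rhoP j; exact (h a).
have rn j y : multiplicity_free (rho j y) by have [_ h _ _] := rhoP j; exact (h y).
have rcl j y : close F e (@at_point f j y) (rho j y) by have [_ _ h _] := rhoP j; exact (h y).
have rs j y : star_rep (rho j y).
  by have [T [x [U [pres _]]]] := rn j y; exact: presents_star_rep pres.
pose g a : B := MatFun (fun j => rc a j).
have gh : star_hom g.
  split.
  - by move=> c a b; apply: matfunP => j y /=; exact: star_rep_linear (rs j y) c a b.
  - by move=> a b; apply: matfunP => j y /=; exact: star_repM (rs j y) a b.
  - by move=> a; apply: matfunP => j y /=; exact: star_repS (rs j y) a.
exists g; split.
- exact gh.
- by apply: matfunP => j y; exact: star_rep1 (rs j y).
- move=> a b gab; apply: matfunP => i z; apply/eqP; rewrite -subr_eq0; apply/eqP.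
  have g0 : g (a - b) = 0 by rewrite (star_homB gh) gab subrr.
  have [j [y sp]] := spectrum_covers fh f1 finj (existT _ i z).
  have [y' [T [x [U [t [[[U1 U0 US] rE] xt]]]]]] : exists y', spec (rho j y') (existT _ i z).
    by have [_ _ _ cov] := rhoP j; exact: cov sp.
  have E0 : ev (a - b) (x t) = 0.
    rewrite -(frame_compress U1 U0 (fun t => ev (a - b) (x t)) t) -rE.
    have -> : rho j y' (a - b) = 0 by have := congr1 (fun h : B => h j y') g0.
    by rewrite mulmx0 mul0mx.
  by move: E0; rewrite xt.
- move=> j y; have [T [x [U [[Uf rE] xinj]]]] := rn j y.
  have [W [WW WW' WM]] := frame_mxdiag Uf.
  exists #|T|, (fun k => x (enum_val k)), W; split=> //.
    by move=> k k' /xinj /enum_val_inj.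
  by move=> a; rewrite -[LHS]/(rho j y a) rE WM.
- move=> a aF; apply: supnorm_le; first exact: ltW.
  by move=> j y; apply: ltW; exact: rcl aF.
Qed.

End Approximation.

(** * Choice of the new maps *)

Section Assembly.
Variables (R : realType) (I : nat -> finType) (Z : forall n, I n -> ndgraph R).
Variable r : forall n, I n -> nat.
Arguments Z : clear implicits.
Arguments r : clear implicits.
Local Notation A n := (matfun (Z n) (r n)).
Variables (phi : forall n, A n -> A n.+1) (d : forall n, nat -> A n).
Arguments phi : clear implicits.
Arguments d : clear implicits.
Hypothesis r_gt0 : forall n i, (0 < r n i)%N.
Hypothesis phi_hom : forall n, star_hom (phi n).
Hypothesis phi_unital : forall n, unital (phi n).
Hypothesis phi_inj : forall n, injective (phi n).

Lemma approximant_exists n (F : seq (A n)) : exists g : A n -> A n.+1,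
  [/\ star_hom g, unital g, injective g, maximally_homogeneous g &
    forall a, a \in F -> supnorm (phi n a - g a) <= 2^-1 ^+ n.+1].
Proof.
have e0 : 0 < 2^-1 ^+ n.+1 :> R by rewrite exprn_gt0// invr_gt0.
exact (approximate (@r_gt0 n) F (phi_hom n) (phi_unital n) (@phi_inj n) e0).
Qed.

Definition approximant n (F : seq (A n)) := sval (cid (approximant_exists F)).

(** The lists and the new maps are defined together: the lists at n.+1 contain the images
    of those at n under both maps, and the new map at n is chosen close to the old one
    on the list of index n. *)
Fixpoint tracked n : nat -> seq (A n) :=
  match n with
  | 0 => fun N => map (d 0) (iota 0 N.+1)
  | n'.+1 => fun N => map (d n'.+1) (iota 0 N.+1) ++
      map (phi n') (tracked n' N) ++ map (approximant (tracked n' n')) (tracked n' N)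
  end.

Definition new_map n : A n -> A n.+1 := approximant (tracked n n).

Lemma new_mapP n : [/\ star_hom (@new_map n), unital (@new_map n), injective (@new_map n),
  maximally_homogeneous (@new_map n) &
  forall a, a \in tracked n n -> supnorm (phi n a - new_map a) <= 2^-1 ^+ n.+1].
Proof. exact (svalP (cid (approximant_exists (tracked n n)))). Qed.

Lemma trackedS n N : tracked n.+1 N = map (d n.+1) (iota 0 N.+1) ++
  map (phi n) (tracked n N) ++ map (@new_map n) (tracked n N).
Proof. by []. Qed.

Lemma tracked_dense n N k : (k <= N)%N -> d n k \in tracked n N.
Proof.
move=> kN; have dk : d n k \in map (d n) (iota 0 N.+1) by rewrite map_f// mem_iota.
by case: n dk => [//|n] dk; rewrite trackedS mem_cat dk.
Qed.

Lemma tracked_mono n N M : (N <= M)%N -> {subset tracked n N <= tracked n M}.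
Proof.
move=> NM; have dd m a : a \in map (d m) (iota 0 N.+1) -> a \in map (d m) (iota 0 M.+1).
  move=> /mapP[k kN ->]; rewrite map_f//; move: kN; rewrite !mem_iota /= !add0n !ltnS.
  by move=> kN; exact: leq_trans kN NM.
elim: n => [|n IH] a; first exact: dd.
rewrite !trackedS !mem_cat => /orP[/dd ->//|/orP[/mapP[b /IH bM ->]|/mapP[b /IH bM ->]]].
  by rewrite map_f// orbT.
by rewrite (map_f _ bM) !orbT.
Qed.

Lemma new_map_intertwined :
  (forall n a (e : R), 0 < e -> exists k, supnorm (a - d n k) < e) ->
  intertwined (A := fun n => A n) phi new_map (fun n N => [set a | a \in tracked n N]).
Proof.
move=> dense; split.
- exact phi_hom.
- by move=> n; have [] := new_mapP n.
- move=> n N a aN; have {}aN : a \in tracked n N := aN; split.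
    by change (phi n a \in tracked n.+1 N); rewrite trackedS !mem_cat (map_f _ aN) orbT.
  by change (new_map a \in tracked n.+1 N); rewrite trackedS !mem_cat (map_f _ aN) !orbT.
- move=> n N a Nn aN; rewrite rnorm_matfun; have [_ _ _ _] := new_mapP n.
  by apply; exact: tracked_mono Nn _ aN.
move=> n a e e0; have [k ak] := dense n a e e0.
by exists k, (d n k); split; [exact: tracked_dense|rewrite rnorm_matfun].
Qed.

End Assembly.

Local Close Scope sesquilinear_scope.
Local Close Scope ring_scope.
Local Close Scope complex_scope.
Local Close Scope classical_set_scope.

Theorem theorem3p5 (R : realType) (I : nat -> finType)
    (Z : forall n, I n -> ndgraph R) (r : forall n, I n -> nat)
    (phi : forall n, matfun (Z n) (r n) -> matfun (Z n.+1) (r n.+1))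
    (A : cstarAlgType R) (alpha : forall n, matfun (Z n) (r n) -> A) :
  (forall n i, 0 < r n i) ->
  (forall n, star_hom (phi n)) ->
  (forall n, unital (phi n)) ->
  (forall n, injective (phi n)) ->
  is_inductive_limit (A := fun n => matfun (Z n) (r n)) phi alpha ->
  exists psi : forall n, matfun (Z n) (r n) -> matfun (Z n.+1) (r n.+1),
    (forall n, [/\ star_hom (psi n), unital (psi n), injective (psi n) &
                   maximally_homogeneous (psi n)]) /\
    exists (B : cstarAlgType R) (beta : forall n, matfun (Z n) (r n) -> B),
      is_inductive_limit (A := fun n => matfun (Z n) (r n)) psi beta /\
      star_isomorphic A B.
Proof.
move=> r_gt0 phi_hom phi_unital phi_inj lim.
pose d n := sval (cid (matfun_separable (Z n) (r n))).
pose dense n := svalP (cid (matfun_separable (Z n) (r n))).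
pose psi := new_map d r_gt0 phi_hom phi_unital phi_inj.
exists psi; split.
  by move=> n; have [h1 h2 h3 h4 _] := new_mapP d r_gt0 phi_hom phi_unital phi_inj n; split.
have tw := new_map_intertwined r_gt0 phi_hom phi_unital phi_inj dense.
have [beta betaP] := inductive_limit_intertwined tw lim.
exists A, beta; split; first exact betaP.
exists id; split; last by exists id.
by split.
Qed.
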